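(* Let $\alpha\in\mathbb{R}\setminus\mathbb{Q}$. For every $\epsilon>0$, $c>0$ and $K>0$ (and $v\in C^\omega_\epsilon(\mathbb{T},\mathbb{R})$ with weight $\xi$ as in the context), there exist $\delta_*>0$, $q_*>0$ and a subsequence $p_n/q_n$ of the best approximations of $\alpha$ with the following property. Let $d\ge1$ with $\hat v_d\neq0$, let $p_n/q_n$ satisfy $q_n>q_*$ and let $E\in[-3-\inf|v_d|,\,3+\sup|v_d|]$. Then there exist no $\rho\in C^\omega_\epsilon(\mathbb{T},\mathbb{R})$ with $\|\rho\|_\epsilon\le K$ and $U_d\in C^\omega_\epsilon(\mathbb{T},\mathrm{HSp}(2d,2,\psi_d,\omega_1))$ such that $$|||L^{E,d}(\cdot)U_d(\cdot)-U_d(\cdot+\alpha)\,(e^{2\pi i\rho(\cdot)}I_2)|||_\epsilon\le e^{(-c+\delta_* )q_n},\qquad |||U_d|||_\epsilon\le e^{\delta_*q_n}.$$ Moreover, if $\beta(\alpha)>0$ and the subsequence $p_n/q_n$ satisfies $q_{n+1}>e^{(\beta-o(1))q_n}$, then the same statement holds upon replacing $\alpha$ by $p_n/q_n$ in the displayed inequality (i.e. $U_d(\cdot+\alpha)$ by $U_d(\cdot+p_n/q_n)$).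
   Context: $\mathbb{T}=\mathbb{R}/\mathbb{Z}$; $C^\omega_\epsilon(\mathbb{T},* )$ is the space of $*$-valued functions on $\mathbb{T}$ extending holomorphically (and boundedly) to $\{|\mathrm{Im}\,x|<\epsilon\}$, with $\|f\|_\epsilon=\sup_{|\mathrm{Im}\,x|<\epsilon}\|f(x)\|$. A function $v\in C^\omega_\epsilon(\mathbb{T},\mathbb{R})$ with Fourier coefficients $\hat v_k$, $|\hat v_k|\le e^{-2\pi\epsilon|k|}$, is fixed, and $v_d(x)=\sum_{k=-d}^d\hat v_ke^{2\pi ikx}$. The constants $\delta_*,q_*$ and the subsequence do not depend on $d$. For a function $f$ on $\mathbb{T}$ with values in $\mathbb{C}^{2d}$ (or in $2d\times 2$ matrices), with components (rows) indexed as $f(x)=(f(d-1,x),f(d-2,x),\dots,f(0,x),f(-1,x),\dots,f(-d,x))^\top$, put $|||f|||_\epsilon=\sum_{k=-d}^{d-1}e^{-\xi|k|}\|f(k,\cdot)\|_\epsilon$, where $\xi>0$ is fixed with $\xi\ll2\pi\epsilon$ (sufficiently small compared with $2\pi\epsilon$). $L^{E,d}(x)$ is the $2d\times2d$ transfer matrix of $\sum_{k=-d}^d\hat v_ku_{n+k}+2\cos(2\pi(x+n\alpha))u_n=Eu_n$: its first row is $\frac1{\hat v_d}(-\hat v_{d-1},\dots,-\hat v_1,\;E-2\cos(2\pi x)-\hat v_0,\;-\hat v_{-1},\dots,-\hat v_{-d})$ (the entry involving $E$ is in column $d$), and for $2\le i\le2d$ its $i$-th row has a single nonzero entry, equal to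 $1$, in column $i-1$. $C_d$ is the upper triangular Toeplitz $d\times d$ matrix with $(C_d)_{ij}=\hat v_{d-(j-i)}$ for $j\ge i$ and $0$ otherwise, $S_d=\begin{pmatrix}0&-C_d^*\\C_d&0\end{pmatrix}$, $\psi_d(u,w)=u^*S_dw$, $\mathcal{J}_2=\begin{pmatrix}0&-1\\1&0\end{pmatrix}$, $\omega_1(u,w)=u^*\mathcal{J}_2w$, and $\mathrm{HSp}(2d,2,\psi_d,\omega_1)=\{M\in\mathbb{C}^{2d\times2}:M^*S_dM=\mathcal{J}_2\}$ (the condition is imposed for $x\in\mathbb{T}$). Best approximations of $\alpha$ are its continued fraction convergents $p_n/q_n$; $q_{n+1}$ is the denominator of the convergent following $p_n/q_n$, and $\beta=\beta(\alpha)=\limsup_{n\to\infty}\frac{\ln q_{n+1}}{q_n}$. The condition $q_{n+1}>e^{(\beta-o(1))q_n}$ is understood along the subsequence, with $o(1)\to0$. *)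

(* Defs.v *)
From mathcomp Require Import all_boot all_order all_algebra.
From mathcomp Require Import all_classical all_reals all_analysis.
From mathcomp Require Import complex.
Set Implicit Arguments.
Unset Strict Implicit.
Unset Printing Implicit Defensive.
Import Order.TTheory GRing.Theory Num.Theory.
Import numFieldNormedType.Exports.
Local Open Scope classical_set_scope.
Local Open Scope complex_scope.
Local Open Scope ring_scope.

Section ContinuedFraction.
Variable R : realType.
Implicit Types (alpha : R) (n : nat) (s : nat -> nat).

Fixpoint cf_rem alpha n : R :=
  if n is m.+1 then
    (cf_rem alpha m - (Num.floor (cf_rem alpha m))%:~R)^-1
  else alpha.

Definition cf_digit alpha n : int := Num.floor (cf_rem alpha n).

Fixpoint cf_num alpha n : int :=
  match n with
  | 0 => cf_digit alpha 0
  | n'.+1 => match n' with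
    | 0 => cf_digit alpha 1 * cf_digit alpha 0 + 1
    | m.+1 => cf_digit alpha n * cf_num alpha n' + cf_num alpha m
    end
  end.

Fixpoint cf_den alpha n : int :=
  match n with
  | 0 => 1
  | n'.+1 => match n' with
    | 0 => cf_digit alpha 1
    | m.+1 => cf_digit alpha n * cf_den alpha n' + cf_den alpha m
    end
  end.

Definition cf_denR alpha n : R := (cf_den alpha n)%:~R.

Definition convergent alpha n : R := (cf_num alpha n)%:~R / cf_denR alpha n.

Definition betaCF alpha : \bar R :=
  limn_esup (fun n => (ln (cf_denR alpha n.+1) / cf_denR alpha n)%:E).

Definition subsequence s : Prop := {homo s : m n / (m < n)%N}.

(* q_(n+1) > e^((beta - o(1)) q_n) along s.  The sequence b plays the role of
   beta - o(1); the convergence takes place in \bar R, which also gives a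
   meaning to the condition when beta = +oo. *)
Definition liouville_along alpha s : Prop :=
  exists b : nat -> R,
    (b n)%:E @[n --> \oo] --> betaCF alpha /\
    forall n, expR (b n * cf_denR alpha (s n)) < cf_denR alpha (s n).+1.

End ContinuedFraction.

Section AnalyticFunctions.
Variable R : realType.
Implicit Types (eps : R) (z : R[i]).

(* The absolute value of a complex number as an element of R (the norm `|z|
   of R[i] takes its values in R[i]). *)
Definition cabs z : R := ComplexField.Normc.normc z.

Definition cexp z : R[i] :=
  (expR (complex.Re z))%:C * (cos (complex.Im z) +i* sin (complex.Im z)).

Definition e2pi z : R[i] := cexp ((0 +i* (2 * pi)) * z).

Definition strip eps : set R[i] := [set z | `|complex.Im z| < eps].

(* An element of C^omega_eps(T, C) is represented by its holomorphic
   extension; the values of f outside the strip are irrelevant. *)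
Definition Comega eps (f : R[i] -> R[i]) : Prop :=
  [/\ (forall z, strip eps z -> f (z + 1) = f z),
      (forall z, strip eps z ->
         derivable (f : (R[i])^o -> (R[i])^o) z 1)
    & (exists M : R, forall z, strip eps z -> cabs (f z) <= M)].

Definition Comega_real eps (f : R[i] -> R[i]) : Prop :=
  Comega eps f /\ (forall x : R, complex.Im (f x%:C) = 0).

Definition Comega_mx eps m n (F : R[i] -> 'M[R[i]]_(m, n)) : Prop :=
  forall i j, Comega eps (fun z => F z i j).

Definition strip_sup eps (g : R[i] -> R) : \bar R :=
  ereal_sup [set (g z)%:E | z in strip eps].

Definition strip_norm eps (f : R[i] -> R[i]) : \bar R :=
  strip_sup eps (fun z => cabs (f z)).

Definition fourier_coef (f : R -> R[i]) (k : int) : R[i] :=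
  let g x := f x * e2pi (- (k%:~R * x)%:C) in
  (\int[lebesgue_measure]_(x in `[0%R, 1%R]) complex.Re (g x))
  +i* (\int[lebesgue_measure]_(x in `[0%R, 1%R]) complex.Im (g x)).

Definition trig_trunc (c : int -> R[i]) (d : nat) (x : R) : R[i] :=
  \sum_(j < d.*2.+1) c (j%:Z - d%:Z) * e2pi (((j%:Z - d%:Z)%:~R * x)%:C).

End AnalyticFunctions.

Section TransferMatrix.
Variable R : realType.
Implicit Types (c : int -> R[i]) (d : nat).

Definition row_l2 m n (A : 'M[R[i]]_(m, n)) (i : 'I_m) : R :=
  Num.sqrt (\sum_(j < n) cabs (A i j) ^+ 2).

(* Row i (counted from 0) carries the component of index k = d - 1 - i, so
   that k runs from d - 1 down to - d. *)
Definition comp_index d (i : 'I_(d + d)) : int := d%:Z - 1 - i%:Z.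

Definition weighted_norm (xi eps : R) d n
    (F : R[i] -> 'M[R[i]]_(d + d, n)) : \bar R :=
  (\sum_(i < d + d)
     (expR (- xi * (absz (comp_index i))%:R))%:E
     * strip_sup eps (fun z => row_l2 (F z) i))%E.

(* With rows and columns counted from 0, the entry - c_(d-1-j) / c_d of the
   first row stands in column j, and the energy term in column d - 1.  The
   function 2 cos (2 pi x) is extended to complex z. *)
Definition transfer_mx c d (E : R) (z : R[i]) : 'M[R[i]]_(d + d) :=
  \matrix_(i, j)
    if i == 0%N :> nat then
      ((if j.+1 == d then E%:C - (e2pi z + e2pi (- z)) else 0)
       - c (comp_index j)) / c d
    else (i == j.+1 :> nat)%:R.

Definition C_mx c d : 'M[R[i]]_d :=
  \matrix_(i, j) if (i <= j)%N then c (d%:Z - (j%:Z - i%:Z)) else 0.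

Definition adjmx m n (A : 'M[R[i]]_(m, n)) : 'M[R[i]]_(n, m) :=
  (map_mx Num.conj A)^T.

Definition S_mx c d : 'M[R[i]]_(d + d) :=
  block_mx 0 (- adjmx (C_mx c d)) (C_mx c d) 0.

Definition J2 : 'M[R[i]]_(1 + 1) := block_mx 0 (- 1%:M) 1%:M 0.

Definition HSp c d (M : 'M[R[i]]_(d + d, 2)) : Prop :=
  adjmx M *m S_mx c d *m M = J2.

Definition Comega_HSp eps c d (U : R[i] -> 'M[R[i]]_(d + d, 2)) : Prop :=
  Comega_mx eps U /\ (forall x : R, HSp c (U x%:C)).

Definition conj_defect c d (E a : R) (rho : R[i] -> R[i])
    (U : R[i] -> 'M[R[i]]_(d + d, 2)) (z : R[i]) : 'M[R[i]]_(d + d, 2) :=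
  transfer_mx c d E z *m U z - U (z + a%:C) *m (e2pi (rho z))%:M.

(* Here a is the translation applied to U,
   err bounds the defect of the conjugacy and bnd bounds U. *)
Definition almost_conjugates (xi eps K : R) c d (E a err bnd : R)
    (rho : R[i] -> R[i]) (U : R[i] -> 'M[R[i]]_(d + d, 2)) : Prop :=
  [/\ Comega_real eps rho /\ (strip_norm eps rho <= K%:E)%E,
      Comega_HSp eps c U,
      (weighted_norm xi eps (conj_defect c E a rho U) <= err%:E)%E
    & (weighted_norm xi eps U <= bnd%:E)%E].

Definition no_almost_conjugacy (xi eps K c : R) (v : int -> R[i])
    (delta qstar : R) (q a : nat -> R) : Prop :=
  forall (d n : nat) (E : R),
    (1 <= d)%N -> v d%:Z != 0 -> qstar < q n ->
    - 3 - inf (range (fun x : R => cabs (trig_trunc v d x))) <= E ->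
    E <= 3 + sup (range (fun x : R => cabs (trig_trunc v d x))) ->
    ~ exists (rho : R[i] -> R[i]) (U : R[i] -> 'M[R[i]]_(d + d, 2)),
        almost_conjugates xi eps K v E (a n)
          (expR ((- c + delta) * q n)) (expR (delta * q n)) rho U.

End TransferMatrix.

(* Main.v *)
Require Import Defs.
From mathcomp Require Import all_boot all_order all_algebra.
From mathcomp Require Import all_classical all_reals all_analysis.
From mathcomp Require Import complex.
From mathcomp Require Import ring lra zify.

(** An almost conjugacy would produce two almost solutions of one second order
    difference equation, both decaying at both ends; such solutions are almost
    proportional, and this is incompatible with the symplectic normalisation.

    Let u_k be the component of index k of a column of U.  The rows of the
    transfer matrix below the first say u_(k+1)(x) = u_k(x + a) e(rho(x)) up to
    the defect, where e(x) = exp(2 pi i x).  If rho were a constant rho0, then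
    u_k(x) = f(x + k a) e(k rho0) with f = u_0, and the first row would read
      sum_k v_k e(k rho0) f(x + k a) + (2 cos 2 pi x - E) f(x) = 0.
    On Fourier coefficients this is the Schrodinger equation
      F(m+1) + F(m-1) = (E - V_m) F(m),  V_m = sum_k v_k e(k (rho0 + m a)),
    with coefficients bounded independently of the degree d.

    Reduction to constant rho ([gauge_exists]).  One solves the cohomological
    equation rho - rho0 = phi(x + a) - phi(x) for the frequencies up to q/4.
    Since |a - p/q| <= 1/q^2, the divisors e(k a) - 1 are at least 1/q there
    ([small_divisor]), and the frequencies left out contribute an error that is
    exponentially small in q.  The solution phi is real on the real line, and
    it is o(q) on a strip: for a fixed number of small k the divisors stay away
    from 0 because alpha is irrational, and the remaining k are damped by the
    decay of the Fourier coefficients of rho ([small_divisor_sum]).  Hence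
    f = u_0 e(phi) has Fourier coefficients at most e^((delta + o(1)) q - h |m|).
    All estimates other than this decay use real x only, where every exponential
    factor has modulus 1, so that no constant depends on d ([orbit_bound],
    [residual_bound]).

    Contradiction ([core_inequality]).  For the two columns of U the
    coefficients F0, F1 have an almost constant Wronskian, which is tiny at
    the index q + 1 and therefore for all |m| <= q + 1 ([wronskian_bound]).  At the index m0
    where the coefficients with |m| <= N = q/J are largest, some normalised
    combination of F0 and F1 vanishes; it is tiny at the two neighbours of m0,
    because the Wronskian is, and so it is tiny for all |m| <= N by the
    recurrence, while for |m| > N it is small by decay ([near_dependence]).  By
    Fourier inversion the corresponding combination of the two columns of U is
    then small on the real line, and pairing it with the columns through the
    symplectic form contradicts M^* S M = J
    ([combination_lower_bound]).  The choice of scales is: N is a small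
    multiple of q, so that the growth of the recurrence over N steps costs less
    than the smallness of the defect, and delta is much smaller still, so that
    e^(delta q) costs less than the decay over N steps ([scale_contradiction]).

    The estimates see a through |a q - p| <= 1/q and its distance to alpha, which
    treats a = alpha and a = p_n/q_n together.  On the analytic side, complex
    differentiability on a strip gives the decay of Fourier coefficients by
    Goursat's theorem ([goursat], [fcoef_decay]), and Chernoff's argument gives
    Fourier inversion ([fourier_inversion]). *)

Import Order.TTheory GRing.Theory Num.Theory.
Import numFieldNormedType.Exports.
Local Open Scope classical_set_scope.
Local Open Scope complex_scope.
Local Open Scope ring_scope.
Set Implicit Arguments.
Unset Strict Implicit.
Unset Printing Implicit Defensive.

(** * The real-valued modulus of a complex number *)

Section ComplexModulus.
Context {R : realType}.
Implicit Types (x y t : R) (z w : R[i]).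

Lemma cabsE z : `|z| = (cabs z)%:C.
Proof. by rewrite normc_def; case: z. Qed.

Lemma cabs_ge0 z : 0 <= cabs z.
Proof. by case: z => a b; exact: sqrtr_ge0. Qed.

Lemma cabs0 : cabs (0 : R[i]) = 0. Proof. exact: ComplexField.Normc.normc0. Qed.

Lemma cabs1 : cabs (1 : R[i]) = 1. Proof. exact: ComplexField.Normc.normc1. Qed.

Lemma cabsM z w : cabs (z * w) = cabs z * cabs w.
Proof. exact: ComplexField.Normc.normcM. Qed.

Lemma cabsV z : cabs z^-1 = (cabs z)^-1.
Proof. exact: ComplexField.Normc.normcV. Qed.

Lemma cabsN z : cabs (- z) = cabs z.
Proof. by apply/complexI; rewrite -!cabsE normrN. Qed.

Lemma cabsD z w : cabs (z + w) <= cabs z + cabs w.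
Proof. by rewrite -lecR rmorphD -!cabsE ler_normD. Qed.

Lemma cabsB z w : cabs (z - w) <= cabs z + cabs w.
Proof. by rewrite -(cabsN w) cabsD. Qed.

Lemma cabs_distC z w : cabs (z - w) = cabs (w - z).
Proof. by rewrite -cabsN opprB. Qed.

Lemma cabs_real x : cabs x%:C = `|x|.
Proof. by rewrite /cabs /= expr0n addr0 sqrtr_sqr. Qed.

Lemma cabs_i : cabs ('i : R[i]) = 1.
Proof. by rewrite /cabs /= expr0n add0r expr1n sqrtr1. Qed.

Lemma cabs_nat n : cabs (n%:R : R[i]) = n%:R.
Proof. by rewrite -(rmorph_nat (real_complex R)) cabs_real ger0_norm. Qed.

Lemma cabs_eq0 z : (cabs z == 0) = (z == 0).
Proof.
apply/eqP/eqP => [|->]; last exact: cabs0.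
exact: ComplexField.Normc.eq0_normc.
Qed.

Lemma cabs_gt0 z : (0 < cabs z) = (z != 0).
Proof. by rewrite lt_def cabs_ge0 cabs_eq0 andbT. Qed.

Lemma cabs_conj z : cabs (Num.conj z) = cabs z.
Proof. by apply/complexI; rewrite -!cabsE norm_conjC. Qed.

Lemma cabs_sqr z : cabs z ^+ 2 = complex.Re z ^+ 2 + complex.Im z ^+ 2.
Proof. by case: z => a b; rewrite /cabs /= sqr_sqrtr// addr_ge0 ?sqr_ge0. Qed.

Lemma Re_le_cabs z : `|complex.Re z| <= cabs z.
Proof.
rewrite -(ler_pXn2r (n := 2)) ?nnegrE ?cabs_ge0//.
by rewrite cabs_sqr real_normK ?num_real// lerDl sqr_ge0.
Qed.

Lemma Im_le_cabs z : `|complex.Im z| <= cabs z.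
Proof.
rewrite -(ler_pXn2r (n := 2)) ?nnegrE ?cabs_ge0//.
by rewrite cabs_sqr real_normK ?num_real// lerDr sqr_ge0.
Qed.

Lemma complex_split z : z = (complex.Re z)%:C + 'i * (complex.Im z)%:C.
Proof. by case: z => a b; apply/eqP; rewrite eq_complex /=; apply/andP; split; apply/eqP; ring. Qed.

Lemma cabs_le_ReIm z : cabs z <= `|complex.Re z| + `|complex.Im z|.
Proof.
rewrite [in leLHS](complex_split z); apply: (le_trans (cabsD _ _)).
by rewrite cabsM cabs_i mul1r !cabs_real.
Qed.

Lemma cabs_sum (I : Type) (r : seq I) (P : pred I) (F : I -> R[i]) :
  cabs (\sum_(i <- r | P i) F i) <= \sum_(i <- r | P i) cabs (F i).
Proof.
elim/big_ind2 : _ => //; first by rewrite cabs0.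
by move=> z a w b za wb; apply: (le_trans (cabsD _ _)); exact: lerD.
Qed.

Lemma cReD z w : complex.Re (z + w) = complex.Re z + complex.Re w.
Proof. by case: z; case: w. Qed.
Lemma cImD z w : complex.Im (z + w) = complex.Im z + complex.Im w.
Proof. by case: z; case: w. Qed.
Lemma cReN z : complex.Re (- z) = - complex.Re z.
Proof. by case: z. Qed.
Lemma cImN z : complex.Im (- z) = - complex.Im z.
Proof. by case: z. Qed.
Lemma cReM z w : complex.Re (z * w) =
  complex.Re z * complex.Re w - complex.Im z * complex.Im w.
Proof. by case: z; case: w. Qed.
Lemma cImM z w : complex.Im (z * w) =
  complex.Re z * complex.Im w + complex.Im z * complex.Re w.
Proof. by case: z; case: w. Qed.

End ComplexModulus.

(** * Derivatives of functions of a complex or a real variable *)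

Section Derivatives.
Context {R : realType}.
Implicit Types (f g : R[i] -> R[i]) (u P Q : R -> R[i]).

(** Derivatives are stated as first order expansions in the real-valued modulus,
    for functions of a complex variable and, below, of a real one.  In this form
    restricting a holomorphic function to a line, and comparing primitives with
    such restrictions, needs no change of topology. *)
Definition cderiv f (z l : R[i]) := forall e : R, 0 < e ->
  exists2 r : R, 0 < r & forall w, cabs w < r ->
    cabs (f (z + w) - f z - w * l) <= e * cabs w.

Definition rderiv u (x : R) (l : R[i]) := forall e : R, 0 < e ->
  exists2 r : R, 0 < r & forall t, `|t| < r ->
    cabs (u (x + t) - u x - t%:C * l) <= e * `|t|.

Definition ccont u := forall (x e : R), 0 < e ->
  exists2 r : R, 0 < r & forall t, `|t| < r -> cabs (u (x + t) - u x) <= e.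

Lemma cderiv_local f g z l (r : R) : 0 < r ->
  (forall w, cabs w < r -> f (z + w) = g (z + w)) -> cderiv f z l -> cderiv g z l.
Proof.
move=> r0 fg df e /df[s s0 H]; exists (Num.min r s) => [|w]; first by rewrite lt_min r0.
rewrite lt_min => /andP[wr /H]; rewrite fg//.
by have := fg 0; rewrite cabs0 addr0 => ->.
Qed.

Lemma cderiv_bound f z l : cderiv f z l -> exists2 r : R, 0 < r &
  forall w, cabs w < r -> cabs (f (z + w) - f z) <= (1 + cabs l) * cabs w.
Proof.
move=> /(_ _ ltr01)[r r0 H]; exists r => // w /H.
rewrite mul1r => H1; rewrite -[X in cabs X](subrK (w * l)).
by apply: (le_trans (cabsD _ _)); rewrite cabsM mulrDl mul1r [cabs l * _]mulrC lerD.
Qed.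

Lemma cderivD f g z l k : cderiv f z l -> cderiv g z k ->
  cderiv (fun z => f z + g z) z (l + k).
Proof.
move=> df dg e e0; have e2 : 0 < e / 2 by rewrite divr_gt0.
have [r r0 Hf] := df _ e2; have [s s0 Hg] := dg _ e2.
exists (Num.min r s) => [|w]; first by rewrite lt_min r0.
rewrite lt_min => /andP[/Hf fw /Hg gw].
have -> : f (z + w) + g (z + w) - (f z + g z) - w * (l + k) =
  (f (z + w) - f z - w * l) + (g (z + w) - g z - w * k) by ring.
by apply: (le_trans (cabsD _ _)); lra.
Qed.

Lemma cderiv_cst (c z : R[i]) : cderiv (fun=> c) z 0.
Proof.
move=> e e0; exists 1 => // w _.
by rewrite subrr mulr0 subr0 cabs0 mulr_ge0 ?cabs_ge0// ltW.
Qed.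

Lemma cderiv_id (z : R[i]) : cderiv id z 1.
Proof.
move=> e e0; exists 1 => // w _.
have -> : z + w - z - w * 1 = 0 by ring.
by rewrite cabs0 mulr_ge0 ?cabs_ge0// ltW.
Qed.

Lemma cderivM f g z l k : cderiv f z l -> cderiv g z k ->
  cderiv (fun z => f z * g z) z (l * g z + f z * k).
Proof.
move=> df dg e e0.
have [r0 r0p Hf0] := cderiv_bound df.
have gz0 := cabs_ge0 (g z); have fz0 := cabs_ge0 (f z).
have l0 := cabs_ge0 l; have k0 := cabs_ge0 k.
set a := (1 + cabs (g z)); set b := (1 + cabs (f z)).
set m := (1 + cabs l) * (1 + cabs k).
have a0 : 0 < a by rewrite /a; lra.
have b0 : 0 < b by rewrite /b; lra.
have m0 : 0 < m by rewrite /m mulr_gt0//; lra.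
have ea : 0 < e / 3 / a by rewrite !divr_gt0.
have eb : 0 < e / 3 / b by rewrite !divr_gt0.
have [r1 r1p Hf] := df _ ea; have [r2 r2p Hg] := dg _ eb.
have [r3 r3p Hg0] := cderiv_bound dg.
exists (Num.min (Num.min r0 r1) (Num.min (Num.min r2 r3) (e / 3 / m))) => [|w].
  by rewrite !lt_min r0p r1p r2p r3p !divr_gt0.
rewrite !lt_min => /andP[/andP[w0 w1] /andP[/andP[w2 w3] w4]].
set F := f (z + w) - f z; set G := g (z + w) - g z.
have -> : f (z + w) * g (z + w) - f z * g z - w * (l * g z + f z * k) =
  (F - w * l) * g z + f z * (G - w * k) + F * G by rewrite /F /G; ring.
have c0 := cabs_ge0 w.
have A : cabs ((F - w * l) * g z) <= e / 3 * cabs w.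
  rewrite cabsM (le_trans (y := (e / 3 / a * cabs w) * a))//.
    by apply: ler_pM; rewrite ?cabs_ge0 ?Hf// /a; lra.
  by rewrite mulrAC divfK// gt_eqF.
have B : cabs (f z * (G - w * k)) <= e / 3 * cabs w.
  rewrite cabsM (le_trans (y := b * (e / 3 / b * cabs w)))//.
    by apply: ler_pM; rewrite ?cabs_ge0 ?Hg// /b; lra.
  by rewrite mulrA [b * _]mulrC divfK// gt_eqF.
have D : cabs (F * G) <= e / 3 * cabs w.
  rewrite cabsM (le_trans (y := ((1 + cabs l) * cabs w) * ((1 + cabs k) * cabs w)))//.
    by apply: ler_pM; rewrite ?cabs_ge0 ?Hf0 ?Hg0.
  rewrite mulrACA -/m mulrA ler_wpM2r// mulrC.
  by rewrite -ler_pdivlMr// ltW.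
have /le_trans -> // := cabsD ((F - w * l) * g z + f z * (G - w * k)) (F * G).
have := cabsD ((F - w * l) * g z) (f z * (G - w * k)).
by lra.
Qed.

Lemma cderivZ f (c z l : R[i]) : cderiv f z l -> cderiv (fun z => c * f z) z (c * l).
Proof.
move=> df; have := cderivM (cderiv_cst c z) df.
by rewrite mul0r add0r.
Qed.

Lemma cderiv_comp f g z l k : cderiv f z l -> cderiv g (f z) k ->
  cderiv (fun z => g (f z)) z (l * k).
Proof.
move=> df dg e e0.
have l0 := cabs_ge0 l; have k0 := cabs_ge0 k.
have [r0 r0p Hf0] := cderiv_bound df.
have a0 : 0 < 1 + cabs l by lra.
have b0 : 0 < 1 + cabs k by lra.
have ea : 0 < e / 2 / (1 + cabs l) by rewrite !divr_gt0.
have eb : 0 < e / 2 / (1 + cabs k) by rewrite !divr_gt0.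
have [r1 r1p Hf] := df _ eb; have [r2 r2p Hg] := dg _ ea.
exists (Num.min (Num.min r0 r1) (r2 / (1 + cabs l))) => [|w].
  by rewrite !lt_min r0p r1p divr_gt0.
rewrite !lt_min => /andP[/andP[w0 w1]]; rewrite ltr_pdivlMr// => w2.
set F := f (z + w) - f z.
have c0 := cabs_ge0 w.
have Fb : cabs F <= (1 + cabs l) * cabs w by exact: Hf0.
have Fr : cabs F < r2 by rewrite (le_lt_trans Fb)// mulrC.
have -> : g (f (z + w)) - g (f z) - w * (l * k) =
  (g (f z + F) - g (f z) - F * k) + (F - w * l) * k.
  by rewrite /F [f z + _]addrC subrK; ring.
apply: (le_trans (cabsD _ _)).
have A : cabs (g (f z + F) - g (f z) - F * k) <= e / 2 * cabs w.
  apply: (le_trans (Hg _ Fr)).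
  apply: (le_trans (y := e / 2 / (1 + cabs l) * ((1 + cabs l) * cabs w))).
    by rewrite ler_wpM2l// ltW.
  by rewrite mulrA divfK// gt_eqF.
have B : cabs ((F - w * l) * k) <= e / 2 * cabs w.
  rewrite cabsM (le_trans (y := (e / 2 / (1 + cabs k) * cabs w) * (1 + cabs k)))//.
    by apply: ler_pM; rewrite ?cabs_ge0 ?Hf//; lra.
  by rewrite mulrAC divfK// gt_eqF.
lra.
Qed.

Lemma cderiv_sum (I : Type) (r : seq I) (F : I -> R[i] -> R[i]) (z : R[i]) :
  (forall i, exists l, cderiv (F i) z l) ->
  exists l, cderiv (fun z => \sum_(i <- r) F i z) z l.
Proof.
move=> H; elim: r => [|i r [l IH]].
  exists 0 => e e0; have [s s0 Hs] := cderiv_cst 0 z e0.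
  by exists s => // w /Hs; rewrite !big_nil.
have [k Hk] := H i; exists (k + l) => e e0.
have [s s0 Hs] := cderivD Hk IH e0.
by exists s => // w /Hs; rewrite !big_cons.
Qed.

Lemma rderivD u P x l k : rderiv u x l -> rderiv P x k ->
  rderiv (fun x => u x + P x) x (l + k).
Proof.
move=> df dg e e0; have e2 : 0 < e / 2 by rewrite divr_gt0.
have [r r0 Hf] := df _ e2; have [s s0 Hg] := dg _ e2.
exists (Num.min r s) => [|w]; first by rewrite lt_min r0.
rewrite lt_min => /andP[/Hf fw /Hg gw].
have -> : u (x + w) + P (x + w) - (u x + P x) - w%:C * (l + k) =
  (u (x + w) - u x - w%:C * l) + (P (x + w) - P x - w%:C * k) by ring.
by apply: (le_trans (cabsD _ _)); lra.
Qed.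

Lemma rderivZ u (c : R[i]) x l : rderiv u x l -> rderiv (fun x => c * u x) x (c * l).
Proof.
move=> du e e0; have c0 := cabs_ge0 c; have a0 : 0 < 1 + cabs c by lra.
have ea : 0 < e / (1 + cabs c) by rewrite divr_gt0.
have [r r0 H] := du _ ea; exists r => // t /H tr.
have -> : c * u (x + t) - c * u x - t%:C * (c * l) = c * (u (x + t) - u x - t%:C * l) by ring.
rewrite cabsM (le_trans (y := (1 + cabs c) * (e / (1 + cabs c) * `|t|)))//.
  by apply: ler_pM; rewrite ?cabs_ge0//; lra.
by rewrite mulrA [(1 + _) * _]mulrC divfK// gt_eqF.
Qed.

Lemma rderivB u P x l k : rderiv u x l -> rderiv P x k ->
  rderiv (fun x => u x - P x) x (l - k).
Proof.
move=> du dP; have := rderivD du (rderivZ (-1) dP); rewrite mulN1r.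
by move=> H e /H [r r0 {}H]; exists r => // t /H; rewrite !mulN1r.
Qed.

Lemma rderiv_shift u (s x : R) l : rderiv u (x + s) l -> rderiv (fun x => u (x + s)) x l.
Proof. by move=> du e /du[r r0 H]; exists r => // t /H; rewrite [x + t + s]addrAC. Qed.

Lemma cderiv_horizontal f (x y : R) l :
  cderiv f (x +i* y) l -> rderiv (fun t => f (t +i* y)) x l.
Proof.
move=> df e /df[r r0 H]; exists r => // t tr.
have := H t%:C; rewrite cabs_real => /(_ tr).
by have -> : (x +i* y) + t%:C = (x + t) +i* y by apply/eqP; rewrite eq_complex /= addr0 !eqxx.
Qed.

Lemma cderiv_vertical f (x y : R) l :
  cderiv f (x +i* y) l -> rderiv (fun t => f (x +i* t)) y ('i * l).
Proof.
move=> df e /df[r r0 H]; exists r => // t tr.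
have := H (0 +i* t); rewrite {1 3}/cabs /= expr0n add0r sqrtr_sqr => /(_ tr).
have -> : (x +i* y) + (0 +i* t) = x +i* (y + t) by apply/eqP; rewrite eq_complex /= addr0 !eqxx.
by have -> : (0 +i* t) * l = t%:C * ('i * l) by rewrite [0 +i* t]complex_split /= !rmorph0; ring.
Qed.

Lemma rderiv_ccont u : (forall x, exists l, rderiv u x l) -> ccont u.
Proof.
move=> H x e e0; have [l Hl] := H x; have [r r0 Hr] := Hl _ ltr01.
have l0 := cabs_ge0 l; have a0 : 0 < 1 + cabs l by lra.
exists (Num.min r (e / (1 + cabs l))) => [|t].
  by rewrite lt_min r0 divr_gt0.
rewrite lt_min => /andP[/Hr {}Hr]; rewrite ltr_pdivlMr// => te.
rewrite -[X in cabs X](subrK (t%:C * l)).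
apply: (le_trans (cabsD _ _)); rewrite cabsM cabs_real; nra.
Qed.

End Derivatives.

(** * Integrals of continuous complex-valued functions *)

Lemma derivable_expansion (K : numFieldType) (f : K^o -> K^o) (z : K) :
  derivable f z 1 -> exists l : K, l = 'D_1 f z /\ forall e : K, 0 < e ->
  exists2 r : K, 0 < r &
    forall w, `|w| < r -> `|f (z + w) - f z - w * l| <= e * `|w|.
Proof.
move=> df; exists ('D_1 f z); split => // e e0.
have /cvgrPdist_le/(_ _ e0) := df; rewrite near_withinE => /nbhs_norm0P[r /= r0 H].
exists r => // w wr; have [->|w0] := eqVneq w 0.
  by rewrite addr0 subrr mul0r subr0 normr0 mulr0.
have := H w wr w0; rewrite /GRing.scale /= mulr1 -/('D_1 f z) => {}H.
have -> : f (z + w) - f z - w * 'D_1 f z = - (w * ('D_1 f z - w^-1 * (f (w + z) - f z))).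
  by rewrite [w + z]addrC; field.
by rewrite normrN normrM mulrC ler_wpM2r.
Qed.

Section Integral.
Context {R : realType}.
Implicit Types (f g : R[i] -> R[i]) (u P Q : R -> R[i]).

Lemma is_derive_expansion (f : R -> R) (x l e : R) : is_derive x 1 f l -> 0 < e ->
  exists2 r : R, 0 < r & forall t, `|t| < r -> `|f (x + t) - f x - t * l| <= e * `|t|.
Proof.
move=> [df <-] e0; have [k [-> H]] := derivable_expansion df.
exact: H.
Qed.

Lemma expansion_is_derive (f : R -> R) (x l : R) :
  (forall e, 0 < e -> exists2 r : R, 0 < r &
     forall t, `|t| < r -> `|f (x + t) - f x - t * l| <= e * `|t|) ->
  is_derive x 1 f l.
Proof.
move=> H.
have L : (fun h => h^-1 *: ((f \o shift x) (h *: (1:R)) - f x)) @ 0^' --> l.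
  apply/cvgrPdist_le => e /H[r r0 {}H]; rewrite near_withinE.
  apply/nbhs_ballP; exists r => //= t; rewrite /ball /= sub0r normrN => /H {}H t0.
  have -> : l - t^-1 *: (f (t *: 1 + x) - f x) = - (t^-1 * (f (x + t) - f x - t * l)).
    by rewrite /GRing.scale /= mulr1 [t + x]addrC; field.
  rewrite normrN normrM normfV mulrC ler_pdivrMr ?normr_gt0//.
by split; [apply/cvg_ex; exists l | exact: cvg_lim L].
Qed.

Lemma rderiv_Re u x l : rderiv u x l -> is_derive x 1 (fun t => complex.Re (u t)) (complex.Re l).
Proof.
move=> du; apply: expansion_is_derive => e /du[r r0 H]; exists r => // t /H.
apply: le_trans; apply: le_trans (Re_le_cabs _).
by rewrite !(cReD, cReN, cReM) /= mul0r subr0.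
Qed.

(** Multiplying by the conjugate of the increment turns it into a real number, so
    that the real mean value theorem applies to one real part, without loss. *)
Lemma mean_value_cabs P u (a b M : R) : a <= b ->
  (forall x, a <= x <= b -> rderiv P x (u x)) ->
  (forall x, a <= x <= b -> cabs (u x) <= M) ->
  cabs (P b - P a) <= M * (b - a).
Proof.
move=> ab dP uM; set D := P b - P a.
have [->|D0] := eqVneq D 0.
  rewrite cabs0 mulr_ge0 ?subr_ge0//.
  by apply: le_trans (uM a _); rewrite ?cabs_ge0 ?lexx.
pose c := Num.conj D.
have d x : a <= x <= b ->
    is_derive x 1 (fun t => complex.Re (c * P t)) (complex.Re (c * u x)).
  by move=> /dP dx; apply: rderiv_Re; exact: rderivZ.
have [||x] := @MVT_segment R (fun x => complex.Re (c * P x)) (fun x => complex.Re (c * u x)) a b ab.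
- by move=> x /andP[xa xb]; apply: d; move: xa xb; rewrite !bnd_simp => /ltW -> /ltW ->.
- apply: derivable_within_continuous => x; rewrite in_itv /= => xab.
  by have [] := d x xab.
rewrite in_itv /= => xab; rewrite -cReN -cReD -mulrN -mulrDr -/D => H.
have E : complex.Re (c * D) = cabs D ^+ 2.
  rewrite mulrC -normCK cabsE.
  by rewrite -rmorphXn.
have : cabs D ^+ 2 <= cabs D * (M * (b - a)).
  rewrite -E H mulrA ler_wpM2r ?subr_ge0//.
  rewrite (le_trans (ler_norm _))// (le_trans (Re_le_cabs _))// cabsM cabs_conj.
  by rewrite ler_wpM2l ?cabs_ge0 ?uM.
by rewrite expr2 ler_pM2l// cabs_gt0.
Qed.

(** The integral from - B is a primitive to the right of - B; after subtracting
    their values at 0, the primitives for different B agree. *)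
Lemma real_primitive (f : R -> R) : continuous f ->
  exists F : R -> R, forall x : R, is_derive x 1 F (f x).
Proof.
move=> cf.
pose G B x := (\int[lebesgue_measure]_(t in [set` `[(- B), x]]) f t)%R.
have dG (B x : R) : - B < x -> is_derive x 1 (G B) (f x).
  move=> Bx.
  have [] := @continuous_FTC1_closed R f (- B) x (x + 1) _ _ Bx (cf x).
  - by rewrite ltrDl.
  - apply: continuous_compact_integrable; first exact: segment_compact.
    exact: continuous_subspaceT.
  by move=> d1 d2; split => //; rewrite -derive1E.
pose F x := G (`|x| + 1) x - G (`|x| + 1) 0.
have GE (B B' x : R) : `|x| < B -> `|x| < B' -> G B x - G B 0 = G B' x - G B' 0.
  move=> xB xB'.
  have nx := normr_ge0 x; have B0 : - B < 0 by lra.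
  have B0' : - B' < 0 by lra.
  have key a b : a <= b -> - B < a -> - B' < a -> G B b - G B' b = G B a - G B' a.
    move=> ab aB aB'.
    have [||y _] := @MVT_segment R (fun x => G B x - G B' x) (fun=> 0) a b ab.
    - move=> y; rewrite in_itv /= => /andP[ay yb].
      rewrite -(subrr (f y)); apply: is_deriveB; apply: dG; exact: lt_trans ay.
    - apply: derivable_within_continuous => y; rewrite in_itv /= => /andP[ay yb].
      apply: derivableB; [have [] // := dG B y _|have [] // := dG B' y _]; exact: lt_le_trans ay.
    by rewrite mul0r => /eqP; rewrite subr_eq0 => /eqP.
  have /andP[x1 x2] : (- B < x) && (- B' < x).
    by move: xB xB'; rewrite !ltr_norml => /andP[-> _] /andP[-> _].
  have [x0|x0] := leP 0 x.
    by have := key _ _ x0 B0 B0'; lra.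
  by have := key _ _ (ltW x0) x1 x2; lra.
exists F => x; set B := `|x| + 2.
have dx : is_derive x 1 (fun y => G B y - G B 0) (f x).
  rewrite -[f x]subr0; apply: is_deriveB; apply: dG.
  by have : - `|x| <= x by [have := ler_norm (- x); rewrite normrN; lra]; rewrite /B; lra.
apply: expansion_is_derive => e e0; have [r r0 H] := is_derive_expansion dx e0.
exists (Num.min r 1) => [|t]; first by rewrite lt_min r0 ltr01.
rewrite lt_min => /andP[/H {}H t1].
have E y : `|y| < B -> F y = G B y - G B 0.
  by move=> yB; apply: GE; rewrite // ltrDl.
have xB : `|x| < B by rewrite /B; lra.
have xtB : `|x + t| < B by rewrite (le_lt_trans (ler_normD _ _))// /B; lra.
by rewrite (E _ xB) (E _ xtB).
Qed.

Definition cprim P u := forall x, rderiv P x (u x).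

Lemma cprim_exists u : ccont u -> exists P, cprim P u.
Proof.
move=> cu.
have cRe : continuous (fun x => complex.Re (u x)).
  move=> x; apply/cvgrPdist_le => e /(cu x)[r r0 H].
  apply/nbhs_ballP; exists r => //= t; rewrite /ball /= distrC => /H.
  rewrite [x + _]addrC subrK => /(le_trans (Re_le_cabs _)).
  by rewrite cReD cReN distrC.
have cIm : continuous (fun x => complex.Im (u x)).
  move=> x; apply/cvgrPdist_le => e /(cu x)[r r0 H].
  apply/nbhs_ballP; exists r => //= t; rewrite /ball /= distrC => /H.
  rewrite [x + _]addrC subrK => /(le_trans (Im_le_cabs _)).
  by rewrite cImD cImN distrC.
have [F dF] := real_primitive cRe; have [G dG] := real_primitive cIm.
exists (fun x => F x +i* G x) => x e e0.
have e2 : 0 < e / 2 by rewrite divr_gt0.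
have [r r0 Hr] := is_derive_expansion (dF x) e2.
have [s s0 Hs] := is_derive_expansion (dG x) e2.
exists (Num.min r s) => [|t]; first by rewrite lt_min r0.
rewrite lt_min => /andP[/Hr {}Hr /Hs {}Hs].
apply: (le_trans (cabs_le_ReIm _)); rewrite !(cReD, cReN, cReM, cImD, cImN, cImM) /= mul0r subr0 mul0r addr0.
by lra.
Qed.

(** The integral is the increment of a primitive.  Only continuous integrands
    occur, and additivity over intervals, linearity and the bound by the supremum
    then reduce to facts about derivatives. *)
Definition cint u (a b : R) : R[i] :=
  xget 0 [set v | exists2 P, cprim P u & v = P b - P a].

Lemma cintE P u a b : cprim P u -> cint u a b = P b - P a.
Proof.
move=> PP; rewrite /cint.
have /(xgetPex 0)[Q QP ->] : exists v, [set v | exists2 P, cprim P u & v = P b - P a] v.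
  by exists (P b - P a), P.
have d0 x : rderiv (fun x => Q x - P x) x 0 by rewrite -(subrr (u x)); exact: rderivB.
have key c d : c <= d -> Q d - P d = Q c - P c.
  move=> cd; apply/eqP; rewrite -subr_eq0 -cabs_eq0 eq_le cabs_ge0 andbT.
  have := @mean_value_cabs _ (fun=> 0) c d 0 cd (fun x _ => d0 x).
  by rewrite mul0r; apply => x _; rewrite cabs0.
have : Q b - P b = Q a - P a.
  by have [/key ->|/ltW/key ->] := leP a b.
by move=> /eqP; rewrite subr_eq => /eqP ->; ring.
Qed.

Lemma cint_chasles u a b c : ccont u -> cint u a b + cint u b c = cint u a c.
Proof. by move=> /cprim_exists[P PP]; rewrite !(cintE _ _ PP); ring. Qed.

Lemma cintZ (k : R[i]) u a b : ccont u -> cint (fun x => k * u x) a b = k * cint u a b.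
Proof.
move=> /cprim_exists[P PP]; rewrite (cintE _ _ PP).
have Q : cprim (fun x => k * P x) (fun x => k * u x) by move=> x; exact: rderivZ.
by rewrite (cintE _ _ Q); ring.
Qed.

Lemma cintD u w a b : ccont u -> ccont w ->
  cint (fun x => u x + w x) a b = cint u a b + cint w a b.
Proof.
move=> /cprim_exists[P PP] /cprim_exists[Q QQ]; rewrite (cintE _ _ PP) (cintE _ _ QQ).
have H : cprim (fun x => P x + Q x) (fun x => u x + w x) by move=> x; exact: rderivD.
by rewrite (cintE _ _ H); ring.
Qed.

Lemma ccontZ (k : R[i]) u : ccont u -> ccont (fun x => k * u x).
Proof.
move=> cu x e e0; have c0 := cabs_ge0 k.
have k1 : 0 < 1 + cabs k by lra.
have ek : 0 < e / (1 + cabs k) by rewrite divr_gt0.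
have [r r0 H] := cu x _ ek; exists r => // t /H {}H.
rewrite -mulrBr cabsM (le_trans (y := (1 + cabs k) * (e / (1 + cabs k))))//.
  by apply: ler_pM; rewrite ?cabs_ge0//; lra.
by rewrite mulrC divfK// gt_eqF.
Qed.

Lemma ccontD u w : ccont u -> ccont w -> ccont (fun x => u x + w x).
Proof.
move=> cu cw x e e0; have e2 : 0 < e / 2 by rewrite divr_gt0.
have [r r0 Hr] := cu x _ e2; have [s s0 Hs] := cw x _ e2.
exists (Num.min r s) => [|t]; first by rewrite lt_min r0.
rewrite lt_min => /andP[/Hr {}Hr /Hs {}Hs].
have -> : u (x + t) + w (x + t) - (u x + w x) = (u (x + t) - u x) + (w (x + t) - w x) by ring.
by apply: (le_trans (cabsD _ _)); lra.
Qed.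

Lemma ccontM u w : ccont u -> ccont w -> ccont (fun x => u x * w x).
Proof.
move=> cu cw x e e0.
have u0 := cabs_ge0 (u x); have w0 := cabs_ge0 (w x).
set A := 1 + cabs (u x); set B := 1 + cabs (w x).
have A0 : 0 < A by rewrite /A; lra.
have B0 : 0 < B by rewrite /B; lra.
have eB : 0 < e / 2 / B by rewrite !divr_gt0.
have eA : 0 < Num.min 1 (e / 2 / A) by rewrite lt_min ltr01 !divr_gt0.
have [r r0 Hr] := cu x _ eB; have [s s0 Hs] := cw x _ eA.
exists (Num.min r s) => [|t]; first by rewrite lt_min r0.
rewrite lt_min => /andP[/Hr {}Hr /Hs]; rewrite le_min => /andP[Hs1 Hs2].
have -> : u (x + t) * w (x + t) - u x * w x =
  (u (x + t) - u x) * w (x + t) + u x * (w (x + t) - w x) by ring.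
apply: (le_trans (cabsD _ _)).
have wB : cabs (w (x + t)) <= B.
  by rewrite -[w (x + t)](subrK (w x)); apply: (le_trans (cabsD _ _)); rewrite /B; lra.
have P1 : cabs ((u (x + t) - u x) * w (x + t)) <= e / 2.
  rewrite cabsM (le_trans (y := (e / 2 / B) * B))//.
    by apply: ler_pM; rewrite ?cabs_ge0.
  by rewrite divfK// gt_eqF.
have P2 : cabs (u x * (w (x + t) - w x)) <= e / 2.
  rewrite cabsM (le_trans (y := A * (e / 2 / A)))//.
    by apply: ler_pM; rewrite ?cabs_ge0// /A; lra.
  by rewrite mulrC divfK// gt_eqF.
by lra.
Qed.

Lemma ccont_cst (c : R[i]) : ccont (fun=> c).
Proof. by move=> x e e0; exists 1 => // t _; rewrite subrr cabs0 ltW. Qed.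

Lemma ccont_shift u s : ccont u -> ccont (fun x => u (x + s)).
Proof. by move=> cu x e /(cu (x + s))[r r0 H]; exists r => // t /H; rewrite [x + t + s]addrAC. Qed.

Lemma ccont_sum (I : Type) (r : seq I) (F : I -> R -> R[i]) :
  (forall i, ccont (F i)) -> ccont (fun x => \sum_(i <- r) F i x).
Proof.
move=> H; elim: r => [|i r IH] x e e0.
  by exists 1 => // t _; rewrite !big_nil subrr cabs0 ltW.
have [s s0 Hs] := ccontD (H i) IH x e0.
by exists s => // t /Hs; rewrite !big_cons.
Qed.

Lemma cint_bound u a b M : a <= b -> ccont u ->
  (forall x, a <= x <= b -> cabs (u x) <= M) -> cabs (cint u a b) <= M * (b - a).
Proof.
move=> ab /cprim_exists[P PP] uM; rewrite (cintE _ _ PP).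
by apply: mean_value_cabs uM => // x _; exact: PP.
Qed.

(** If P is a primitive of u, then P (x + 1) - P x has derivative 0. *)
Lemma cint_periodic_shift u s : ccont u -> (forall x, u (x + 1) = u x) ->
  cint (fun x => u (x + s)) 0 1 = cint u 0 1.
Proof.
move=> /cprim_exists[P PP] per; rewrite (cintE _ _ PP).
have Q : cprim (fun x => P (x + s)) (fun x => u (x + s)).
  by move=> x; apply: rderiv_shift; exact: PP.
rewrite (cintE _ _ Q).
have H : cprim (fun x => P (x + 1) - P x) (fun=> 0).
  by move=> x; rewrite -(subrr (u x)) -{1}per; apply: rderivB => //; apply: rderiv_shift.
have C : cprim (fun=> 0) (fun=> 0 : R[i]).
  by move=> x e e0; exists 1 => // t _; rewrite mulr0 !subr0 cabs0 mulr_ge0 // ltW.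
have := cintE 0 s H; rewrite (cintE 0 s C) subrr => /eqP; rewrite eq_sym subr_eq0 => /eqP.
by rewrite !add0r [1 + s]addrC.
Qed.

Lemma eq_cint u w a b : u =1 w -> cint u a b = cint w a b.
Proof. by move=> /funext ->. Qed.

End Integral.

(** * The complex exponential *)

Section Exponential.
Context {R : realType}.
Implicit Types (z w : R[i]) (x y t : R).

Definition tau_i : R[i] := 0 +i* (2 * pi).

Lemma cexpD z w : cexp (z + w) = cexp z * cexp w.
Proof.
case: z => a b; case: w => c d; rewrite /cexp /= expRD cosD sinD.
by apply/eqP; rewrite eq_complex /=; apply/andP; split; apply/eqP; ring.
Qed.

Lemma cexp0 : cexp (0 : R[i]) = 1.
Proof.
by rewrite /cexp /= expR0 cos0 sin0; apply/eqP; rewrite eq_complex /=; apply/andP; split; apply/eqP; ring.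
Qed.

Lemma cabs_cis x : cabs (cos x +i* sin x) = 1.
Proof. by rewrite /cabs /= cos2Dsin2 sqrtr1. Qed.

Lemma cabs_cexp z : cabs (cexp z) = expR (complex.Re z).
Proof. by rewrite /cexp cabsM cabs_cis mulr1 cabs_real ger0_norm ?expR_ge0. Qed.

(** With w = a + i b, the remainder splits into that of exp at a, that of cos and
    sin at b, and the product a b. *)
Lemma cderiv_cexp0 : cderiv (@cexp R) 0 1.
Proof.
move=> e e0; have e5 : 0 < Num.min 1 (e / 6) by rewrite lt_min ltr01 divr_gt0.
have [r1 r10 H1] := is_derive_expansion (is_derive_expR (0 : R)) e5.
have [r2 r20 H2] := is_derive_expansion (is_derive_sin (0 : R)) e5.
have [r3 r30 H3] := is_derive_expansion (is_derive_cos (0 : R)) e5.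
exists (Num.min (Num.min r1 r2) (Num.min r3 (Num.min 1 (e / 6)))) => [|[a b]].
  by rewrite !lt_min r10 r20 r30 ltr01 divr_gt0.
rewrite 3!lt_min => /andP[/andP[w1 w2] /andP[w3 w4]].
have aw : `|a| <= cabs (a +i* b) := Re_le_cabs (a +i* b).
have bw : `|b| <= cabs (a +i* b) := Im_le_cabs (a +i* b).
have := H1 _ (le_lt_trans aw w1); have := H2 _ (le_lt_trans bw w2).
have := H3 _ (le_lt_trans bw w3).
rewrite !(add0r, sin0, cos0, oppr0, mulr0, subr0, addr0, mulr1, expR0) => A B D.
set m := cabs (a +i* b) in aw bw w1 w2 w3 w4 *.
have m0 : 0 <= m := cabs_ge0 _.
move: w4; rewrite lt_min => /andP[m1 me].
have -> : cexp (a +i* b) - cexp 0 - a +i* b =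
  (expR a - 1 - a)%:C * (cos b +i* sin b) +
  (1 + a)%:C * ((cos b - 1) +i* (sin b - b)) + 'i * (a * b)%:C.
  rewrite cexp0 /cexp /=.
  by apply/eqP; rewrite eq_complex /=; apply/andP; split; apply/eqP; ring.
have E5 : Num.min 1 (e / 6) <= e / 6 by rewrite ge_min lexx orbT.
have E1 : Num.min 1 (e / 6) <= 1 by rewrite ge_min lexx.
have T1 : cabs ((expR a - 1 - a)%:C * (cos b +i* sin b)) <= e / 6 * m.
  rewrite cabsM cabs_cis mulr1 cabs_real (le_trans D)//.
  by apply: ler_pM; rewrite ?le_min ?ler01 ?divr_ge0 ?(ltW e0).
have T2 : cabs ((1 + a)%:C * ((cos b - 1) +i* (sin b - b))) <= 2 * (e / 6 * m + e / 6 * m).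
  rewrite cabsM cabs_real; apply: ler_pM; rewrite ?cabs_ge0//.
    by rewrite (le_trans (ler_normD _ _))// normr1; lra.
  apply: (le_trans (cabs_le_ReIm _)); rewrite /=; apply: lerD.
    by rewrite (le_trans A)//; apply: ler_pM; rewrite ?le_min ?ler01 ?divr_ge0 ?(ltW e0).
  by rewrite (le_trans B)//; apply: ler_pM; rewrite ?le_min ?ler01 ?divr_ge0 ?(ltW e0).
have T3 : cabs ('i * (a * b)%:C : R[i]) <= e / 6 * m.
  rewrite cabsM cabs_i mul1r cabs_real normrM.
  by apply: ler_pM => //; rewrite (le_trans aw)// ltW.
apply: (le_trans (cabsD _ _)).
apply: (le_trans (lerD (cabsD _ _) (lexx _))).
by lra.
Qed.

Lemma cderiv_cexp z : cderiv (@cexp R) z (cexp z).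
Proof.
move=> e e0; have z0 : 0 < cabs (cexp z) by rewrite cabs_cexp expR_gt0.
have ez : 0 < e / cabs (cexp z) by rewrite divr_gt0.
have [r r0 H] := cderiv_cexp0 ez; exists r => // w /H.
rewrite add0r cexp0 mulr1 => {}H.
have -> : cexp (z + w) - cexp z - w * cexp z = cexp z * (cexp w - 1 - w).
  by rewrite cexpD; ring.
rewrite cabsM (le_trans (ler_wpM2l (ltW z0) H))//.
by rewrite mulrA [_ * (e / _)]mulrC divfK// gt_eqF.
Qed.

Lemma e2piD z w : e2pi (z + w) = e2pi z * e2pi w.
Proof. by rewrite /e2pi mulrDr cexpD. Qed.

Lemma e2pi0 : e2pi (0 : R[i]) = 1.
Proof. by rewrite /e2pi mulr0 cexp0. Qed.

Lemma e2piN z : e2pi (- z) * e2pi z = 1.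
Proof. by rewrite -e2piD addNr e2pi0. Qed.

Lemma e2pi1 : e2pi (1 : R[i]) = 1.
Proof.
rewrite /e2pi mulr1 /cexp /= expR0 mulr_natl cos2pi sin2pi.
by apply/eqP; rewrite eq_complex /=; apply/andP; split; apply/eqP; ring.
Qed.

Lemma e2pi_nat n : e2pi (n%:R : R[i]) = 1.
Proof. by elim: n => [|n IH]; rewrite ?e2pi0// -natr1 e2piD IH e2pi1 mulr1. Qed.

Lemma e2pi_int (k : int) : e2pi (k%:~R : R[i]) = 1.
Proof.
case: k => n; first exact: e2pi_nat.
by rewrite NegzE mulrNz -[RHS](e2piN n.+1%:R) [in RHS]e2pi_nat mulr1.
Qed.

Lemma cabs_e2pi z : cabs (e2pi z) = expR (- (2 * pi * complex.Im z)).
Proof. by rewrite /e2pi cabs_cexp cReM /= mul0r add0r. Qed.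

Lemma cabs_e2pi_real z : complex.Im z = 0 -> cabs (e2pi z) = 1.
Proof. by rewrite cabs_e2pi => ->; rewrite mulr0 oppr0 expR0. Qed.

Lemma cderiv_e2pi z : cderiv (@e2pi R) z (tau_i * e2pi z).
Proof.
have := cderivZ tau_i (cderiv_id z); rewrite mulr1 => d1.
exact: (cderiv_comp d1 (cderiv_cexp _)).
Qed.

Lemma cderiv_e2piM (k z : R[i]) :
  exists l, cderiv (fun z => e2pi (k * z)) z l.
Proof.
have := cderivZ k (cderiv_id z) => d1.
by eexists; exact: (cderiv_comp d1 (cderiv_e2pi _)).
Qed.

End Exponential.

(** * Goursat's theorem on rectangles *)

Section Goursat.
Context {R : realType}.
Implicit Types (g : R[i] -> R[i]) (a b c d x y s t : R).

(** The counterclockwise boundary integral of g over the rectangle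
    [a, b] x [c, d]. *)
Definition rect_int g a b c d : R[i] :=
  cint (fun x => g (x +i* c)) a b - cint (fun x => g (x +i* d)) a b
  + 'i * (cint (fun y => g (b +i* y)) c d - cint (fun y => g (a +i* y)) c d).

(** Subdivision principle: a property that passes from the four quarters of a
    rectangle to the rectangle, and holds for all small rectangles around each
    point, holds for the rectangle itself.  If it failed, a sequence of nested
    quarters on which it fails would shrink to a point. *)
Lemma bisection (Q : R -> R -> R -> Prop) (a0 c0 w h : R) : 0 <= w -> 0 <= h ->
  (forall a c s, 0 < s -> Q a c (s / 2) -> Q (a + s / 2 * w) c (s / 2) ->
     Q a (c + s / 2 * h) (s / 2) -> Q (a + s / 2 * w) (c + s / 2 * h) (s / 2) ->
     Q a c s) ->
  (forall x y, a0 <= x <= a0 + w -> c0 <= y <= c0 + h ->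
     exists2 r, 0 < r & forall a c s, 0 < s < r ->
       a <= x <= a + s * w -> c <= y <= c + s * h -> Q a c s) ->
  Q a0 c0 1.
Proof.
move=> w0 h0 Qsplit Qloc; apply: contrapT => nQ.
pose sz n : R := (2 ^- n).
have sz0 n : 0 < sz n by rewrite /sz invr_gt0 exprn_gt0.
have szS n : sz n.+1 = sz n / 2 by rewrite /sz exprS invfM mulrC.
have step (p : R * R) n : exists p' : R * R, ~ Q p.1 p.2 (sz n) ->
    [/\ ~ Q p'.1 p'.2 (sz n.+1), p.1 <= p'.1, p'.1 + sz n.+1 * w <= p.1 + sz n * w,
        p.2 <= p'.2 & p'.2 + sz n.+1 * h <= p.2 + sz n * h].
  case: p => a c /=; rewrite szS; have s0 := sz0 n.
  have sw : 0 <= sz n / 2 * w by rewrite mulr_ge0// divr_ge0// ltW.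
  have sh : 0 <= sz n / 2 * h by rewrite mulr_ge0// divr_ge0// ltW.
  have [q1|] := pselect (Q a c (sz n / 2)); last by exists (a, c); split => //=; lra.
  have [q2|] := pselect (Q (a + sz n / 2 * w) c (sz n / 2)); last first.
    by exists (a + sz n / 2 * w, c); split => //=; lra.
  have [q3|] := pselect (Q a (c + sz n / 2 * h) (sz n / 2)); last first.
    by exists (a, c + sz n / 2 * h); split => //=; lra.
  have [q4|] := pselect (Q (a + sz n / 2 * w) (c + sz n / 2 * h) (sz n / 2)); last first.
    by exists (a + sz n / 2 * w, c + sz n / 2 * h); split => //=; lra.
  by exists (a, c) => nq; exfalso; apply: nq; exact: Qsplit.
have [nxt Hn] : exists nxt : R * R -> nat -> R * R, forall p n, ~ Q p.1 p.2 (sz n) ->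
    [/\ ~ Q (nxt p n).1 (nxt p n).2 (sz n.+1), p.1 <= (nxt p n).1,
        (nxt p n).1 + sz n.+1 * w <= p.1 + sz n * w,
        p.2 <= (nxt p n).2 & (nxt p n).2 + sz n.+1 * h <= p.2 + sz n * h].
  exists (fun p n => sval (cid (step p n))) => p n.
  by case: cid.
pose fix sq n := if n is m.+1 then nxt (sq m) m else (a0, c0).
have nQn n : ~ Q (sq n).1 (sq n).2 (sz n).
  elim: n => [|n IH]; first by rewrite /sz expr0 invr1.
  by have [] := Hn _ _ IH.
have lim (pr : R * R -> R) (k z0 : R) : pr (a0, c0) = z0 -> 0 <= k ->
   (forall n, pr (sq n) <= pr (sq n.+1) /\ pr (sq n.+1) + sz n.+1 * k <= pr (sq n) + sz n * k) ->
   exists2 x, z0 <= x <= z0 + k & forall n, pr (sq n) <= x <= pr (sq n) + sz n * k.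
  move=> E k0 mono.
  have up n m : (n <= m)%N -> pr (sq n) <= pr (sq m) /\
      pr (sq m) + sz m * k <= pr (sq n) + sz n * k.
    elim: m => [|m IH]; first by rewrite leqn0 => /eqP ->.
    rewrite leq_eqVlt => /orP[/eqP ->//|/IH[A B]].
    by have [C D] := mono m; split; lra.
  have le n m : pr (sq n) <= pr (sq m) + sz m * k.
    have szk j : 0 <= sz j * k by rewrite mulr_ge0// ltW.
    have [/up[A _]|/ltnW/up[_ B]] := leqP n m.
      by rewrite (le_trans A)// lerDl.
    by apply: le_trans B; rewrite lerDl.
  pose S := range (fun n => pr (sq n)).
  have hs : has_sup S by split; [exists (pr (sq 0)), 0|exists (pr (sq 0) + sz 0 * k) => _ [n _ <-]].
  have main n : pr (sq n) <= sup S <= pr (sq n) + sz n * k.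
    apply/andP; split; first by apply: ub_le_sup; [case: hs|exists n].
    by apply: sup_le_ub; [case: hs|move=> _ [m _ <-]].
  exists (sup S) => //; have := main 0; rewrite /= E /sz expr0 invr1 mul1r.
  by [].
have [|x xab xn] := lim fst w a0 erefl w0 _.
  by move=> n; have [] := Hn _ _ (nQn n).
have [|y yab yn] := lim snd h c0 erefl h0 _.
  by move=> n; have [] := Hn _ _ (nQn n).
have [r r0 H] := Qloc x y xab yab.
have [n snr] : exists n, sz n < r.
  have [n _ /(_ n (leqnn n))] := near_infty_natSinv_expn_lt (PosNum r0).
  by rewrite div1r => ?; exists n.
by apply: (nQn n); apply: H; rewrite ?sz0.
Qed.

(** For integrands A with an explicit primitive F, as affine functions have. *)
Lemma cint_approx (u F A : R -> R[i]) a b M : a <= b -> ccont u -> cprim F A ->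
  (forall x, a <= x <= b -> cabs (u x - A x) <= M) ->
  cabs (cint u a b - (F b - F a)) <= M * (b - a).
Proof.
move=> ab /cprim_exists[P PP] FA uM; rewrite (cintE _ _ PP).
have -> : P b - P a - (F b - F a) = (P b - F b) - (P a - F a) by ring.
apply: (@mean_value_cabs _ (fun x => P x - F x) (fun x => u x - A x)) => // x _.
exact: rderivB.
Qed.

(** The boundary integral is additive under subdivision, vanishes for affine
    functions, and differs from that of the tangent map at z by o(s ^ 2) on a
    rectangle of scale s around z.  The bisection principle is applied to the
    bound eta * s ^ 2 for arbitrary eta. *)
Lemma goursat g a0 c0 w h : 0 <= w -> 0 <= h ->
  (forall y, ccont (fun x => g (x +i* y))) ->
  (forall x, ccont (fun y => g (x +i* y))) ->
  (forall x y, a0 <= x <= a0 + w -> c0 <= y <= c0 + h ->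
     exists l, cderiv g (x +i* y) l) ->
  rect_int g a0 (a0 + w) c0 (c0 + h) = 0.
Proof.
move=> w0 h0 ch cv dg; apply/eqP; rewrite -cabs_eq0 eq_le cabs_ge0 andbT.
apply/ler_addgt0Pr => eta eta0; rewrite add0r.
pose Q a c s := cabs (rect_int g a (a + s * w) c (c + s * h)) <= eta * s ^+ 2.
suff : Q a0 c0 1 by rewrite /Q !mul1r expr1n mulr1.
apply: (@bisection Q a0 c0 w h w0 h0) => [a c s s0|x y xab yab].
  rewrite /Q => q1 q2 q3 q4.
  have ws : a + s / 2 * w + s / 2 * w = a + s * w by field.
  have hs : c + s / 2 * h + s / 2 * h = c + s * h by field.
  rewrite ws in q2 q4; rewrite hs in q3 q4.
  move: q1 q2 q3 q4; set m := a + s / 2 * w; set b := a + s * w.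
  set n := c + s / 2 * h; set d := c + s * h => q1 q2 q3 q4.
  have -> : rect_int g a b c d = (rect_int g a m c n + rect_int g m b c n) +
      (rect_int g a m n d + rect_int g m b n d).
    rewrite /rect_int -(cint_chasles a m b (ch c)) -(cint_chasles a m b (ch d)).
    by rewrite -(cint_chasles c n d (cv a)) -(cint_chasles c n d (cv b)); ring.
  apply: (le_trans (cabsD _ _)).
  apply: (le_trans (lerD (cabsD _ _) (cabsD _ _))).
  by rewrite expr2 in q1 q2 q3 q4 *; lra.
have [l dl] := dg x y xab yab.
set z := x +i* y in dl.
pose k := 1 + w + h.
have k0 : 0 < k by rewrite /k; lra.
have e0 : 0 < eta / (4 * k ^+ 2) by rewrite divr_gt0// mulr_gt0// exprn_gt0.
set e := eta / (4 * k ^+ 2) in e0.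
have [r r0 Hr] := dl _ e0.
exists (r / k) => [|a c s]; first by rewrite divr_gt0.
rewrite ltr_pdivlMr// => /andP[s0 skr] /andP[ax xb] /andP[cy yd].
pose b := a + s * w; pose d := c + s * h.
have ab : a <= b by rewrite lerDl mulr_ge0// ltW.
have cd : c <= d by rewrite lerDl mulr_ge0// ltW.
rewrite /Q -/b -/d.
pose A zeta := g z + l * (zeta - z).
pose F (zeta : R[i]) := g z * zeta + (l / 2) * (zeta * zeta) - (l * z) * zeta.
have dF zeta : cderiv F zeta (A zeta).
  have d1 := cderivZ (g z) (cderiv_id zeta).
  have d2 := cderivZ (l / 2) (cderivM (cderiv_id zeta) (cderiv_id zeta)).
  have d3 := cderivZ (- (l * z)) (cderiv_id zeta).
  have := cderivD (cderivD d1 d2) d3.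
  have -> : g z * 1 + l / 2 * (1 * id zeta + id zeta * 1) + - (l * z) * 1 = A zeta.
    by rewrite /A /=; field.
  apply: (@cderiv_local _ _ _ _ _ 1) => // v _.
  by rewrite /F /= mulNr.
have close t1 t2 : a <= t1 <= b -> c <= t2 <= d ->
    cabs (g (t1 +i* t2) - A (t1 +i* t2)) <= e * (s * k).
  move=> /andP[at1 t1b] /andP[ct2 t2d].
  pose v := (t1 - x) +i* (t2 - y).
  have vs : cabs v <= s * (w + h).
    apply: (le_trans (cabs_le_ReIm _)); rewrite mulrDr; apply: lerD => /=.
      by rewrite ler_norml; move: xb t1b; rewrite /b; lra.
    by rewrite ler_norml; move: yd t2d; rewrite /d; lra.
  have vk : cabs v <= s * k.
    by rewrite (le_trans vs)// ler_wpM2l ?(ltW s0)// /k; lra.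
  have zv : t1 +i* t2 = z + v.
    by apply/eqP; rewrite eq_complex /=; apply/andP; split; apply/eqP; ring.
  rewrite zv /A; have -> : g (z + v) - (g z + l * (z + v - z)) = g (z + v) - g z - v * l by ring.
  rewrite (le_trans (Hr _ _))//; first by rewrite (le_lt_trans vk).
  by rewrite ler_wpM2l// ltW.
have esk : 0 <= e * (s * k) by rewrite mulr_ge0 ?(ltW e0)// mulr_ge0 ?(ltW s0) ?(ltW k0).
have H y' : c <= y' <= d -> cabs (cint (fun x => g (x +i* y')) a b -
    (F (b +i* y') - F (a +i* y'))) <= e * (s * k) * (s * k).
  move=> y'cd; apply: (@le_trans _ _ (e * (s * k) * (b - a))).
    apply: (@cint_approx _ (fun x => F (x +i* y')) (fun x => A (x +i* y'))) => //.
      by move=> t; apply: cderiv_horizontal.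
    by move=> t tab; apply: close.
  rewrite ler_wpM2l// (_ : b - a = s * w); last by rewrite /b; ring.
  by rewrite ler_wpM2l ?(ltW s0)// /k; lra.
have V x' : a <= x' <= b -> cabs ('i * cint (fun y => g (x' +i* y)) c d -
    (F (x' +i* d) - F (x' +i* c))) <= e * (s * k) * (s * k).
  move=> x'ab; apply: (@le_trans _ _ (e * (s * k) * (d - c))).
    have -> : 'i * cint (fun y => g (x' +i* y)) c d - (F (x' +i* d) - F (x' +i* c)) =
      'i * (cint (fun y => g (x' +i* y)) c d - (- 'i * F (x' +i* d) - - 'i * F (x' +i* c))).
      have i2 : 'i * 'i = -1 :> R[i] by rewrite -expr2 sqr_i.
      rewrite mulrBr; congr (_ - _).
      transitivity (- ('i * 'i) * (F (x' +i* d) - F (x' +i* c))); last by ring.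
      by rewrite i2 opprK mul1r.
    rewrite cabsM cabs_i mul1r.
    apply: (@cint_approx _ (fun y => - 'i * F (x' +i* y)) (fun y => A (x' +i* y))) => //.
      move=> t; have := rderivZ (- 'i) (cderiv_vertical (dF (x' +i* t))).
      by rewrite mulrA mulNr -expr2 sqr_i opprK mul1r.
    by move=> t tab; apply: close.
  rewrite ler_wpM2l// (_ : d - c = s * h); last by rewrite /d; ring.
  by rewrite ler_wpM2l ?(ltW s0)// /k; lra.
have lc : c <= c <= d by rewrite lexx. have ld : c <= d <= d by rewrite lexx cd.
have la : a <= a <= b by rewrite lexx. have lb : a <= b <= b by rewrite lexx ab.
have := H c lc; have := H d ld; have := V a la; have := V b lb.
set m := e * (s * k) * (s * k).
have -> : eta * s ^+ 2 = m + m + (m + m).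
  by rewrite /m /e; field; rewrite gt_eqF.
rewrite /rect_int.
set X1 := cint _ _ _; set X2 := cint _ _ _; set X3 := cint _ _ _; set X4 := cint _ _ _.
move=> h1 h2 h3 h4.
have -> : X4 - X3 + 'i * (X1 - X2) = (X4 - (F (b +i* c) - F (a +i* c)) - (X3 - (F (b +i* d) - F (a +i* d))))
   + (('i * X1 - (F (b +i* d) - F (b +i* c))) - ('i * X2 - (F (a +i* d) - F (a +i* c)))) by ring.
apply: (le_trans (cabsD _ _)); apply: lerD; apply: (le_trans (cabsB _ _)); exact: lerD.
Qed.

End Goursat.

(** * Decay of Fourier coefficients of functions analytic on a strip *)

Section Decay.
Context {R : realType}.
Implicit Types (f g : R[i] -> R[i]) (u : R -> R[i]) (eps x y t : R) (m : int).

Definition holo eps f := forall z, strip eps z -> exists l, cderiv f z l.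
Definition strip_periodic eps f := forall z, strip eps z -> f (z + 1) = f z.

Definition echar m (z : R[i]) : R[i] := e2pi (m%:~R * z).

Definition fcoef u m : R[i] := cint (fun x => u x * echar (- m) x%:C) 0 1.

Lemma echar1 m z : echar m (z + 1) = echar m z.
Proof. by rewrite /echar mulrDr mulr1 e2piD e2pi_int mulr1. Qed.

Lemma echarD m z w : echar m (z + w) = echar m z * echar m w.
Proof. by rewrite /echar mulrDr e2piD. Qed.

Lemma echarM m k z : echar m z * echar k z = echar (m + k) z.
Proof. by rewrite /echar -e2piD -mulrDl -intrD. Qed.

Lemma echar0 m : echar m 0 = 1. Proof. by rewrite /echar mulr0 e2pi0. Qed.

Lemma echar0m z : echar 0 z = 1. Proof. by rewrite /echar mul0r e2pi0. Qed.

Lemma cderiv_echar m z : exists l, cderiv (echar m) z l.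
Proof. exact: cderiv_e2piM. Qed.

Lemma cabs_echar m z : cabs (echar m z) = expR (- (2 * pi * m%:~R * complex.Im z)).
Proof.
rewrite /echar cabs_e2pi cImM -(rmorph_int (real_complex R)) /= mul0r addr0.
by rewrite mulrA.
Qed.

Lemma cabs_echar_real m x : cabs (echar m x%:C) = 1.
Proof. by rewrite cabs_echar /= mulr0 oppr0 expR0. Qed.

Lemma ccont_echar m : ccont (fun x => echar m x%:C).
Proof.
apply: rderiv_ccont => x; have [l] := cderiv_echar m x%:C.
by move=> /cderiv_horizontal; exists l.
Qed.

Lemma clamp_lip (h s t : R) :
  `|Num.max (- h) (Num.min h s) - Num.max (- h) (Num.min h t)| <= `|s - t|.
Proof.
have minl (a b : R) : `|Num.min h a - Num.min h b| <= `|a - b|.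
  have := ler_norm (a - b); have := ler_norm (- (a - b)); rewrite normrN.
  rewrite ler_norml !minEle; set n := `|a - b| => n1 n2.
  by do 2?[case: ifPn => /=; rewrite -?ltNge => ?]; apply/andP; split; lra.
have maxl (a b : R) : `|Num.max (- h) a - Num.max (- h) b| <= `|a - b|.
  have := ler_norm (a - b); have := ler_norm (- (a - b)); rewrite normrN.
  rewrite ler_norml !maxEle; set n := `|a - b| => n1 n2.
  by do 2?[case: ifPn => /=; rewrite -?ltNge => ?]; apply/andP; split; lra.
exact: le_trans (maxl _ _) (minl _ _).
Qed.

(** The two vertical sides of a rectangle of width 1 cancel by periodicity, so
    that Goursat's theorem leaves the two horizontal ones.  The imaginary part is
    clamped to a smaller strip only to obtain integrands continuous everywhere. *)
Lemma line_integral_const g eps y : holo eps g -> strip_periodic eps g -> `|y| < eps ->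
  cint (fun x => g (x +i* y)) 0 1 = cint (fun x => g (x +i* 0)) 0 1.
Proof.
move=> hg pg yeps; have y0 := normr_ge0 y.
pose h := (`|y| + eps) / 2.
have h0 : 0 < h by rewrite /h; lra.
have heps : h < eps by rewrite /h; lra.
have yh : `|y| < h by rewrite /h; lra.
pose cl t := Num.max (- h) (Num.min h t).
have cl_in t : `|cl t| <= h.
  by rewrite ler_norml /cl le_max lexx /= ge_max ge_min lexx /= andbT; lra.
have cl_id t : `|t| <= h -> cl t = t.
  by rewrite ler_norml /cl => /andP[t1 t2]; rewrite (min_idPr _)// (max_idPr _).
pose G (z : R[i]) := g (complex.Re z +i* cl (complex.Im z)).
have Gcont (z : R[i]) (e : R) : 0 < e -> exists2 r : R, 0 < r &
    forall w, cabs w < r -> cabs (G (z + w) - G z) <= e.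
  move=> e0; pose z' := complex.Re z +i* cl (complex.Im z).
  have [l /cderiv_bound[r r0 H]] : exists l, cderiv g z' l.
    by apply: hg; rewrite /strip /=; exact: le_lt_trans (cl_in _) _.
  have l0 := cabs_ge0 l; have a0 : 0 < 1 + cabs l by lra.
  exists (Num.min (r / 2) (e / (1 + cabs l) / 2)) => [|w].
    by rewrite lt_min !divr_gt0.
  rewrite lt_min !ltr_pdivlMr// => /andP[wr we].
  pose v := complex.Re w +i* (cl (complex.Im (z + w)) - cl (complex.Im z)).
  have vw : cabs v <= cabs w * 2.
    apply: (le_trans (cabs_le_ReIm _)); rewrite /=.
    have := clamp_lip h (complex.Im (z + w)) (complex.Im z).
    rewrite -/(cl _) -/(cl _) cImD addrAC subrr add0r -cImD => A.
    have := Re_le_cabs w; have := Im_le_cabs w; lra.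
  have -> : G (z + w) = g (z' + v).
    congr g; apply/eqP; rewrite eq_complex /= cReD eqxx /=; apply/eqP; ring.
  rewrite (le_trans (H _ (le_lt_trans vw wr)))//.
  by rewrite mulrC (le_trans (ler_wpM2r _ vw)) ?(ltW a0)// ltW.
have Gloc x t : `|t| < h -> exists l, cderiv G (x +i* t) l.
  move=> th; have [l Hl] : exists l, cderiv g (x +i* t) l.
    by apply: hg; rewrite /strip /=; exact: lt_trans heps.
  exists l; apply: (@cderiv_local _ _ _ _ _ (h - `|t|)) Hl; first by rewrite subr_gt0.
  move=> w wr; rewrite /G cl_id; first by congr g; rewrite [LHS]complex_split [RHS]complex_split.
  rewrite cImD /= (le_trans (ler_normD _ _))// -lerBrDl ltW//.
  by rewrite (le_lt_trans (Im_le_cabs _)).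
have ch t : ccont (fun x => G (x +i* t)).
  move=> x e /(Gcont (x +i* t))[r r0 H]; exists r => // s sr.
  have := H s%:C; rewrite cabs_real => /(_ sr).
  by have -> : (x +i* t) + s%:C = (x + s) +i* t by apply/eqP; rewrite eq_complex /= addr0 !eqxx.
have cv x : ccont (fun t => G (x +i* t)).
  move=> t e /(Gcont (x +i* t))[r r0 H]; exists r => // s sr.
  have := H (0 +i* s); rewrite {1}/cabs /= expr0n add0r sqrtr_sqr => /(_ sr).
  by have -> : (x +i* t) + (0 +i* s) = x +i* (t + s) by apply/eqP; rewrite eq_complex /= addr0 !eqxx.
have Gper x t : G ((x + 1) +i* t) = G (x +i* t).
  rewrite /G /= -[RHS]pg; last by rewrite /strip /=; exact: le_lt_trans (cl_in _) _.
  by congr g; apply/eqP; rewrite eq_complex /= addr0 !eqxx.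
have key c d : c <= d -> `|c| < h -> `|d| < h ->
    cint (fun x => G (x +i* c)) 0 1 = cint (fun x => G (x +i* d)) 0 1.
  move=> cd ch' dh.
  have := @goursat _ G 0 c 1 (d - c) ler01 _ ch cv; rewrite subr_ge0 => /(_ cd).
  rewrite add0r [c + _]addrC subrK /rect_int => E.
  have /E : forall x t, 0 <= x <= 1 -> c <= t <= d -> exists l, cderiv G (x +i* t) l.
    move=> x t _ /andP[ct td]; apply: Gloc.
    by move: ch' dh; rewrite !ltr_norml; lra.
  have -> : (fun t => G (1 +i* t)) = (fun t => G (0 +i* t)).
    by apply/funext => t; rewrite -[RHS]Gper add0r.
  by rewrite subrr mulr0 addr0 => /eqP; rewrite subr_eq0 => /eqP.
have GE t : `|t| < h -> (fun x => g (x +i* t)) = (fun x => G (x +i* t)).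
  by move=> th; apply/funext => x; rewrite /G /= cl_id// ltW.
rewrite (GE y yh) (GE 0) ?normr0//.
have [y0'|/ltW y0'] := leP 0 y; last by apply: key; rewrite ?normr0.
by apply/esym; apply: key; rewrite ?normr0.
Qed.

Lemma line_ccont f eps y : holo eps f -> `|y| < eps -> ccont (fun x => f (x +i* y)).
Proof.
move=> hf yeps; apply: rderiv_ccont => x; have [l Hl] := hf (x +i* y) yeps.
by exists l; exact: cderiv_horizontal.
Qed.

Lemma holoM eps f g : holo eps f -> holo eps g -> holo eps (fun z => f z * g z).
Proof.
move=> hf hg z zs; have [l Hl] := hf z zs; have [k Hk] := hg z zs.
by eexists; exact: cderivM Hl Hk.
Qed.

(** The line of integration is moved to the height - h or h, on which the
    character has modulus exp (- 2 pi h |m|). *)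
Lemma fcoef_decay f eps (M h : R) m : holo eps f -> strip_periodic eps f ->
  (forall z, strip eps z -> cabs (f z) <= M) -> 0 <= h < eps ->
  cabs (fcoef (fun x => f x%:C) m) <= M * expR (- (2 * pi * h * (absz m)%:R)).
Proof.
move=> hf pf fM /andP[h0 heps].
pose g (z : R[i]) := f z * echar (- m) z.
pose y := if (0 <= m)%R then - h else h.
have ny : `|y| = h by rewrite /y; case: ifP; rewrite ?normrN ger0_norm.
have hg : holo eps g by apply: holoM => // z _; exact: cderiv_echar.
have pg : strip_periodic eps g by move=> z zs; rewrite /g pf// echar1.
have yeps : `|y| < eps by rewrite ny.
have -> : fcoef (fun x => f x%:C) m = cint (fun x => g (x +i* y)) 0 1.
  by rewrite (line_integral_const hg pg yeps).
rewrite -[leRHS]mulr1 -[X in _ * X]subr0; apply: cint_bound => //.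
  exact: line_ccont yeps.
move=> x _; rewrite /g cabsM ler_pM ?cabs_ge0 ?fM//.
rewrite cabs_echar ler_expR lerN2 /=.
have E : (- m)%:~R * y = h * (absz m)%:R.
  rewrite /y; case: m {g y ny hg pg yeps} => n /=.
    by rewrite mulrNz; ring.
  by rewrite NegzE opprK mulrC.
by rewrite -(mulrA (2 * pi) (- m)%:~R) E mulrA.
Qed.

End Decay.

(** * Lower and upper bounds for characters on the real line *)

Section SineBound.
Context {R : realType}.
Implicit Types (x t : R).

(** The mean value theorem on [0, pi / 4] and the half-angle formula give
    sin x = 2 sin (x / 2) cos (x / 2) >= x cos (pi / 4) ^ 2. *)
Lemma sin_lower x : 0 <= x <= pi / 2 -> x / 2 <= sin x.
Proof.
move=> /andP[x0 xpi]; have pi0 := pi_gt0 R.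
pose y := x / 2.
have y0 : 0 <= y by rewrite /y; lra.
have ypi : y <= pi / 4 by rewrite /y; lra.
have c4 : cos (pi / 4) ^+ 2 = (1 / 2 : R).
  have := cos_pihalf R; have -> : pi / 2 = pi / 4 + pi / 4 :> R by field.
  by rewrite cosD -!expr2 => h; have := cos2Dsin2 (pi / 4 : R); lra.
have c40 : 0 <= cos (pi / 4 : R) by apply: cos_ge0_pihalf; lra.
have cmono t : 0 <= t <= pi / 4 -> cos (pi / 4) <= cos t.
  move=> /andP[t0 t1]; rewrite leNgt; apply/negP => lt.
  by move: lt; rewrite ltr_cos ?in_itv /=; lra.
have siny : y * cos (pi / 4) <= sin y.
  have [|c] := @MVT_segment R sin cos 0 y y0 (fun c _ => is_derive_sin c).
    by apply: continuous_subspaceT => c; exact: continuous_sin.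
  rewrite in_itv /= => /andP[c0 cy]; rewrite sin0 !subr0 => ->.
  by rewrite mulrC ler_wpM2r// cmono// c0 /= (le_trans cy).
have -> : x = y + y by rewrite /y; field.
rewrite sinD; have cy := cmono y; rewrite y0 ypi in cy; move: (cy isT) => {}cy.
have : y * cos (pi / 4) * cos (pi / 4) <= sin y * cos y.
  by apply: ler_pM => //; rewrite mulr_ge0.
by rewrite -mulrA -expr2 c4; lra.
Qed.

End SineBound.

Section CharacterBounds.
Context {R : realType}.
Implicit Types (s t : R).

Lemma e2pi_realE t : e2pi t%:C = cos (2 * pi * t) +i* sin (2 * pi * t).
Proof.
rewrite /e2pi /cexp /= !(mul0r, mulr0, subr0, add0r, addr0) oppr0 expR0.
by apply/eqP; rewrite eq_complex /=; apply/andP; split; apply/eqP; ring.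
Qed.

Lemma e2pi_sub1 t : cabs (e2pi t%:C - 1) = 2 * `|sin (pi * t)|.
Proof.
have -> : e2pi t%:C - 1 = (2 * sin (pi * t))%:C * ('i * (cos (pi * t) +i* sin (pi * t))).
  rewrite e2pi_realE (_ : 2 * pi * t = pi * t + pi * t); last by ring.
  have c2 := cos2Dsin2 (pi * t); rewrite cosD sinD.
  move: (cos (pi * t)) (sin (pi * t)) c2 => c s c2.
  by apply/eqP; rewrite eq_complex /=; apply/andP; split; apply/eqP; [transitivity (c * c - s * s - (c ^+ 2 + s ^+ 2)); [rewrite c2|]|]; ring.
by rewrite !cabsM cabs_i cabs_cis !mulr1 cabs_real normrM ger0_norm.
Qed.

(** The modulus on the right is 2 |sin (pi r)| with r = t - k, and pi >= 2. *)
Lemma e2pi_sub1_lower t (k : int) : `|t - k%:~R| <= 1 / 2 ->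
  2 * `|t - k%:~R| <= cabs (e2pi t%:C - 1).
Proof.
move=> tk; set r := t - k%:~R in tk *.
have -> : e2pi t%:C = e2pi r%:C.
  have -> : t%:C = r%:C + (k%:~R : R[i]).
    by rewrite /r rmorphB /= rmorph_int subrK.
  by rewrite e2piD e2pi_int mulr1.
rewrite e2pi_sub1; have pi2 := pi_ge2 R.
rewrite ler_pM2l//.
have -> : `|sin (pi * r)| = `|sin (pi * `|r|)|.
  by case: (ger0P r) => // _; rewrite mulrN sinN normrN.
have r0 := normr_ge0 r.
apply: (le_trans _ (ler_norm _)); apply: (le_trans _ (sin_lower _)); first nra.
by apply/andP; split; nra.
Qed.

Lemma nearest_int t : exists k : int, `|t - k%:~R| <= 1 / 2.
Proof.
exists (Num.floor (t + 1 / 2)); rewrite ler_norml.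
have /andP[] := Num.Theory.floor_itv (t + 1 / 2).
by rewrite intrD; set f := (Num.floor _)%:~R; lra.
Qed.

Lemma e2pi_eq1 t : e2pi t%:C = 1 -> exists k : int, t = k%:~R.
Proof.
move=> e1; have [k tk] := nearest_int t; exists k.
have := e2pi_sub1_lower tk; rewrite e1 subrr cabs0 => H.
apply/eqP; rewrite -subr_eq0 -normr_eq0; apply/eqP.
by apply: le_anti; rewrite normr_ge0 andbT; lra.
Qed.

Lemma e2pi_lip s t : cabs (e2pi s%:C - e2pi t%:C) <= 2 * pi * `|s - t|.
Proof.
wlog st : s t / t <= s.
  move=> H; have [/H //|/ltW/H] := leP t s.
  by rewrite cabs_distC [`|t - s|]distrC.
rewrite ger0_norm ?subr_ge0//.
apply: (@mean_value_cabs _ (fun x => e2pi x%:C) (fun x => tau_i * e2pi x%:C)) => // x _.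
  exact: (cderiv_horizontal (cderiv_e2pi (x +i* 0))).
rewrite cabsM cabs_e2pi_real// mulr1 /tau_i {1}/cabs /= expr0n add0r sqrtr_sqr.
by rewrite ger0_norm// mulr_ge0// pi_ge0.
Qed.

End CharacterBounds.

(** * Uniform continuity and the Riemann-Lebesgue lemma *)

Section Inversion.
Context {R : realType}.
Implicit Types (u g F : R -> R[i]) (x y t e : R) (m : int) (n : nat).

(** Grouping k with - k lets partial sums telescope by induction on n. *)
Definition ssum (c : int -> R[i]) n : R[i] :=
  c 0 + \sum_(k < n) (c k.+1%:Z + c (- (k.+1%:Z))).

Lemma echar_intx m (k : int) : echar m ((k%:~R : R)%:C) = 1.
Proof. by rewrite /echar (rmorph_int (real_complex R)) -intrM e2pi_int. Qed.

Lemma periodic_int u x (k : int) : (forall x, u (x + 1) = u x) -> u (x + k%:~R) = u x.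
Proof.
move=> per; have pn n y : u (y + n%:R) = u y.
  by elim: n => [|n IH]; rewrite ?addr0// -natr1 addrA per.
case: k => n; first exact: pn.
by rewrite NegzE mulrNz -[LHS](pn n.+1) subrK.
Qed.

(** The bisection principle, used with rectangles of height 0. *)
Lemma uniformly_cont01 g e : ccont g -> 0 < e ->
  exists2 r : R, 0 < r & forall x t, 0 <= x <= 1 -> `|t| < r -> cabs (g (x + t) - g x) <= e.
Proof.
move=> cg e0.
pose Q a (_ : R) s := exists2 r : R, 0 < r & forall x t, a <= x <= a + s -> `|t| < r ->
  cabs (g (x + t) - g x) <= e.
suff [r r0 H] : Q 0 0 1 by exists r => // x t x01; apply: H; rewrite add0r.
apply: (@bisection R Q 0 0 1 0) => // [a c s s0 [r1 r10 H1] [r2 r20 H2] _ _|x y _ _].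
  exists (Num.min r1 r2) => [|x t /andP[ax xs]]; first by rewrite lt_min r10.
  rewrite lt_min => /andP[t1 t2].
  have [xm|xm] := leP x (a + s / 2); first by apply: H1 => //; rewrite ax.
  by apply: H2 => //; apply/andP; split; lra.
have e2 : 0 < e / 2 by rewrite divr_gt0.
have [r r0 H] := cg x _ e2.
exists (r / 2) => [|a c s /andP[s0 sr] /andP[ax xs] _]; first by rewrite divr_gt0.
exists (r / 2) => [|z t /andP[az zs] tr]; first by rewrite divr_gt0.
have zx : `|z - x| < r / 2 by rewrite ltr_norml; lra.
have A : cabs (g (z + t) - g x) <= e / 2.
  rewrite (_ : z + t = x + (z - x + t)); last by ring.
  apply: H; apply: (le_lt_trans (ler_normD _ _)); lra.
have B : cabs (g z - g x) <= e / 2.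
  by rewrite (_ : z = x + (z - x)); [apply: H; lra|ring].
have -> : g (z + t) - g z = (g (z + t) - g x) - (g z - g x) by ring.
by apply: (le_trans (cabsB _ _)); lra.
Qed.

Lemma fcoef_shift u m x : ccont u -> (forall x, u (x + 1) = u x) ->
  fcoef (fun t => u (t + x)) m = echar m x%:C * fcoef u m.
Proof.
move=> cu pu; rewrite /fcoef.
have cw : ccont (fun t => u t * echar (- m) t%:C) by apply: ccontM => //; exact: ccont_echar.
rewrite -(cint_periodic_shift x cw); last first.
  by move=> t; rewrite pu rmorphD /= echar1.
rewrite -cintZ; last by apply: (ccont_shift x cw).
apply: eq_cint => t /=; rewrite rmorphD /= echarD.
transitivity (echar m x%:C * echar (- m) x%:C * (u (t + x) * echar (- m) t%:C)); last by ring.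
by rewrite echarM subrr echar0m mul1r.
Qed.

(** A translation by half a period of the character changes the sign of the
    coefficient, so twice the coefficient is that of a difference g(x) - g(x + s)
    with s = 1 / (2 m). *)
Lemma riemann_lebesgue g e : ccont g -> (forall x, g (x + 1) = g x) -> 0 < e ->
  exists n0, forall m, (n0 <= absz m)%N -> cabs (fcoef g m) <= e.
Proof.
move=> cg pg e0; have [r r0 H] := uniformly_cont01 cg e0.
exists (Num.truncn (1 / r)).+1 => m mn.
have m0 : m != 0 by rewrite -absz_gt0 (leq_trans _ mn).
have m0R : (m%:~R : R) != 0 by rewrite intr_eq0.
pose s : R := (2 * m%:~R)^-1.
have sr : `|s| < r.
  rewrite /s normfV normrM ger0_norm// -intr_norm -natr_absz.
  have m1 : 1 / r < (absz m)%:R.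
    by apply: lt_le_trans (truncnS_gt _) _; rewrite ler_nat.
  have m2 : 0 < (absz m)%:R :> R by apply: le_lt_trans m1; rewrite divr_ge0// ltW.
  rewrite invf_plt ?posrE ?mulr_gt0//; apply: lt_le_trans.
    by rewrite -div1r; exact: m1.
  by lra.
have := fcoef_shift m s cg pg.
have -> : echar m s%:C = -1.
  rewrite /echar -(rmorph_int (real_complex R)) -rmorphM /= e2pi_realE.
  have -> : 2 * pi * (m%:~R * s) = pi by rewrite /s; field.
  by rewrite cospi sinpi; apply/eqP; rewrite eq_complex /= oppr0 !eqxx.
rewrite mulN1r => E.
have {E} : fcoef (fun t => g t - g (t + s)) m = 2 * fcoef g m.
  have cs : ccont (fun t => -1 * (g (t + s) * echar (- m) t%:C)).
    by apply: ccontZ; apply: ccontM; [exact: ccont_shift|exact: ccont_echar].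
  have c1 : ccont (fun t => g t * echar (- m) t%:C).
    by apply: ccontM; [exact: cg|exact: ccont_echar].
  transitivity (fcoef g m - fcoef (fun t => g (t + s)) m); last by rewrite E; ring.
  rewrite /fcoef -[X in _ = _ + X]mulN1r -cintZ; last by apply: ccontM; [exact: ccont_shift|exact: ccont_echar].
  by rewrite -cintD//; apply: eq_cint => t; ring.
move=> E; have : cabs (2 * fcoef g m) <= e * (1 - 0).
  rewrite -E; apply: cint_bound => //.
    apply: ccontM; last exact: ccont_echar.
    have := ccontD cg (ccontZ (-1) (ccont_shift s cg)).
    by move=> h x e' /(h x)[q q0 {}h]; exists q => // t /h; rewrite !mulN1r.
  move=> x x01; rewrite cabsM cabs_echar_real mulr1 cabs_distC.
  by have := H x s x01 sr.
by rewrite cabsM cabs_nat subr0 mulr1; have := cabs_ge0 (fcoef g m); lra.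
Qed.

End Inversion.

(** * Fourier inversion *)

Section Chernoff.
Context {R : realType}.
Implicit Types (u g F : R -> R[i]) (x y t e : R) (m : int) (n : nat).

Lemma ssumS (c : int -> R[i]) n :
  ssum c n.+1 = ssum c n + (c n.+1%:Z + c (- n.+1%:Z)).
Proof. by rewrite /ssum big_ord_recr /= addrA. Qed.

Lemma fcoef_cst (c : R[i]) m : fcoef (fun=> c) m = if m == 0 then c else 0.
Proof.
have [->|m0] := eqVneq m 0.
  have P : cprim (fun x : R => c * x%:C) (fun x => c * echar (- 0) x%:C).
    move=> x; rewrite oppr0 echar0m.
    exact: (cderiv_horizontal (cderivZ c (cderiv_id (x +i* 0)))).
  by rewrite /fcoef (cintE _ _ P) /=; ring.
have t0 : (tau_i : R[i]) != 0.
  by rewrite eq_complex /= negb_and orbC mulf_neq0// gt_eqF// pi_gt0.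
have mC : ((- m)%:~R : R[i]) != 0 by rewrite intr_eq0 oppr_eq0.
have P : cprim (fun x : R => c / ((- m)%:~R * tau_i) * echar (- m) x%:C) (fun x => c * echar (- m) x%:C).
  move=> x.
  have d1 := cderivZ ((- m)%:~R) (cderiv_id (x +i* 0)).
  have d2 := cderiv_comp d1 (cderiv_e2pi _).
  have := cderiv_horizontal (cderivZ (c / ((- m)%:~R * tau_i)) d2).
  rewrite /= -[x +i* 0]/(x%:C) -/(echar (- m) x%:C).
  have -> : c / ((- m)%:~R * tau_i) * ((- m)%:~R * 1 * (tau_i * echar (- m) x%:C)) = c * echar (- m) x%:C.
    by move: mC; move: ((- m)%:~R : R[i]) (echar _ _) => k E mC; field; rewrite mC t0.
  by [].
rewrite /fcoef (cintE _ _ P).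
have -> : echar (- m) (1 : R)%:C = 1 by rewrite -[RHS](echar_intx (R := R) (- m) 1).
by rewrite echar0 subrr.
Qed.

(** Differentiability at 0 makes (F - F 0) / (e2pi - 1) continuous at the
    integers, with value l / (2 pi i). *)
Lemma chernoff_quotient F (l : R[i]) : ccont F -> (forall x, F (x + 1) = F x) -> rderiv F 0 l ->
  exists g, [/\ ccont g, forall x, g (x + 1) = g x &
    forall x, F x - F 0 = g x * (e2pi x%:C - 1)].
Proof.
move=> cF pF dF; pose g x := if e2pi x%:C == 1 then l / tau_i else (F x - F 0) / (e2pi x%:C - 1).
have pi0 := pi_gt0 R.
have pe (x : R) : e2pi (x + 1)%:C = e2pi x%:C by rewrite rmorphD /= e2piD e2pi1 mulr1.
exists g; split=> [x e e0|x|x]; last 2 first.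
- by rewrite /g pe pF.
- rewrite /g; case: eqP => [/e2pi_eq1[k ->]|/eqP e1]; last by rewrite divfK// subr_eq0.
  by rewrite (rmorph_int (real_complex R)) e2pi_int subrr mulr0 -[k%:~R]add0r periodic_int// subrr.
have [/e2pi_eq1[k xk]|/eqP e1] := pselect (e2pi x%:C = 1).
  subst x.
  set T := cabs (tau_i : R[i]).
  have T0 : 0 < T by rewrite cabs_gt0 eq_complex /= negb_and orbC mulf_neq0// gt_eqF.
  have l0 := cabs_ge0 l.
  have e10 : 0 < e * (2 * T) / (T + cabs l) by apply: divr_gt0; [rewrite !mulr_gt0|lra].
  have [r1 r10 H1] := dF _ e10.
  have [r2 r20 H2] := cderiv_horizontal (cderiv_e2pi ((0 : R) +i* 0)) e10.
  exists (Num.min (1 / 2) (Num.min r1 r2)) => [|t]; first by rewrite !lt_min r10 r20 divr_gt0.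
  rewrite !lt_min => /andP[t12 /andP[/H1 {}H1 /H2 {}H2]].
  have ek (y : R) : e2pi (k%:~R + y)%:C = e2pi y%:C.
    by rewrite rmorphD /= rmorph_int e2piD e2pi_int mul1r.
  have -> : g k%:~R = l / tau_i by rewrite /g -[k%:~R]addr0 ek e2pi0 eqxx.
  rewrite /g ek; case: eqP => [_|/eqP et1]; first by rewrite subrr cabs0 ltW.
  rewrite [k%:~R + t]addrC periodic_int//.
  have t0 : t != 0 by apply: contra et1 => /eqP ->; rewrite e2pi0.
  have nt0 : 0 < `|t| by rewrite normr_gt0.
  have lo := @e2pi_sub1_lower R t 0; rewrite subr0 in lo; move: (lo (ltW t12)) => {}lo.
  rewrite !add0r in H1 H2.
  have tau0 : (tau_i : R[i]) != 0 by rewrite -cabs_gt0.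
  have -> : (F t - F 0) / (e2pi t%:C - 1) - l / tau_i =
     (tau_i * (F t - F 0 - t%:C * l) - l * (e2pi t%:C - 1 - t%:C * tau_i)) / (tau_i * (e2pi t%:C - 1)).
    by field; rewrite tau0 subr_eq0 et1.
  rewrite cabsM cabsV cabsM -/T ler_pdivrMr; last by rewrite mulr_gt0// cabs_gt0 subr_eq0.
  have H2' : cabs (e2pi t%:C - 1 - t%:C * tau_i) <= e * (2 * T) / (T + cabs l) * `|t|.
    by move: H2; rewrite -!complexr0 -[(0 : R) +i* 0]/(0 : R[i]) e2pi0 mulr1.
  apply: (le_trans (cabsB _ _)); rewrite !cabsM -/T.
  apply: (@le_trans _ _ (T * (e * (2 * T) / (T + cabs l) * `|t|) + cabs l * (e * (2 * T) / (T + cabs l) * `|t|))).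
    by apply: lerD; rewrite ler_wpM2l// ltW.
  rewrite -mulrDl.
  have -> : (T + cabs l) * (e * (2 * T) / (T + cabs l) * `|t|) = e * (T * (2 * `|t|)).
    by field; rewrite gt_eqF//; lra.
  by rewrite ler_pM2l// ler_pM2l.
set D := cabs (e2pi x%:C - 1).
have D0 : 0 < D by rewrite cabs_gt0 subr_eq0.
set N := cabs (F x - F 0).
have N0 : 0 <= N := cabs_ge0 _.
have ed : 0 < e * D / 4 by rewrite divr_gt0// mulr_gt0.
have [r r0 H] := cF x _ ed.
have q0 : 0 < e * D ^+ 2 / 4 / ((1 + N) * (2 * pi)).
  apply: divr_gt0; first by rewrite divr_gt0// mulr_gt0// exprn_gt0.
  by apply: mulr_gt0; [lra|rewrite mulr_gt0].
exists (Num.min r (Num.min (D / 2 / (2 * pi)) (e * D ^+ 2 / 4 / ((1 + N) * (2 * pi))))) => [|t].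
  by rewrite !lt_min r0 q0 !divr_gt0// mulr_gt0.
rewrite !lt_min => /andP[/H {}H /andP[tD tN]].
have dE : cabs (e2pi (x + t)%:C - e2pi x%:C) <= 2 * pi * `|t|.
  by have := e2pi_lip (x + t) x; rewrite addrAC subrr add0r.
move: tD; rewrite ltr_pdivlMr ?mulr_gt0// => tD.
move: tN; rewrite ltr_pdivlMr ?mulr_gt0//; last lra. move=> tN.
have D1 : D / 2 <= cabs (e2pi (x + t)%:C - 1).
  have : D <= cabs (e2pi (x + t)%:C - 1) + cabs (e2pi (x + t)%:C - e2pi x%:C).
    rewrite /D; have -> : e2pi x%:C - 1 = (e2pi (x + t)%:C - 1) - (e2pi (x + t)%:C - e2pi x%:C) by ring.
    exact: cabsB.
  by lra.
have e1' : e2pi (x + t)%:C - 1 != 0 by rewrite -cabs_gt0; lra.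
have e1s : e2pi x%:C - 1 != 0 by rewrite -cabs_gt0.
rewrite /g (negbTE e1); have -> : (e2pi (x + t)%:C == 1) = false by apply/negbTE; rewrite -subr_eq0.
have -> : (F (x + t) - F 0) / (e2pi (x + t)%:C - 1) - (F x - F 0) / (e2pi x%:C - 1) =
  ((F (x + t) - F x) * (e2pi x%:C - 1) - (F x - F 0) * (e2pi (x + t)%:C - e2pi x%:C)) /
  ((e2pi (x + t)%:C - 1) * (e2pi x%:C - 1)).
  by field; rewrite e1' e1s.
rewrite cabsM cabsV cabsM ler_pdivrMr; last by rewrite mulr_gt0 ?cabs_gt0.
apply: (le_trans (cabsB _ _)); rewrite !cabsM -/D -/N.
apply: (@le_trans _ _ (e * (D / 2 * D))); last first.
  by rewrite ler_pM2l// ler_pM2r.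
have A : cabs (F (x + t) - F x) * D <= e * D / 4 * D by rewrite ler_pM2r.
have B : N * cabs (e2pi (x + t)%:C - e2pi x%:C) <= (1 + N) * (2 * pi * `|t|).
  by apply: ler_pM => //; [exact: cabs_ge0|lra].
have -> : e * (D / 2 * D) = e * D / 4 * D + e * D ^+ 2 / 4 by field.
apply: lerD => //; apply: (le_trans B).
by rewrite mulrA mulrC; exact: ltW.
Qed.

(** In terms of the quotient g, the coefficient of F - F 0 of index m is the
    difference of the coefficients of g of indices m - 1 and m; the partial sums
    telescope and the two end terms tend to 0. *)
Lemma chernoff F (l : R[i]) e : ccont F -> (forall x, F (x + 1) = F x) -> rderiv F 0 l -> 0 < e ->
  exists n0, forall n, (n0 <= n)%N -> cabs (ssum (fcoef F) n - F 0) <= e.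
Proof.
move=> cF pF dF e0; have [g [cg pg Fg]] := chernoff_quotient cF pF dF.
have FE m : fcoef F m = (if m == 0 then F 0 else 0) + fcoef g (m - 1) - fcoef g m.
  rewrite -fcoef_cst /fcoef.
  have c1 k : ccont (fun x => g x * echar k x%:C) by apply: ccontM => //; exact: ccont_echar.
  have c2 : ccont (fun x => F 0 * echar (- m) x%:C) by apply: ccontZ; exact: ccont_echar.
  rewrite -[X in _ = _ + X]mulN1r -cintZ// -cintD// -cintD//; last 2 first.
  - exact: ccontD.
  - exact: ccontZ.
  apply: eq_cint => x; rewrite -{1}(subrK (F 0) (F x)) Fg.
  have -> : echar (- (m - 1)) x%:C = e2pi x%:C * echar (- m) x%:C.
    by rewrite opprB -echarM /echar mul1r.
  by ring.
have tele n : ssum (fcoef F) n - F 0 = fcoef g (- (n.+1%:Z)) - fcoef g n%:Z.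
  elim: n => [|n IH]; first by rewrite /ssum big_ord0 FE eqxx sub0r; ring.
  rewrite ssumS addrAC IH !FE /=.
  have -> : n.+1%:Z - 1 = n by rewrite -addn1 PoszD addrK.
  have -> : - n.+1%:Z - 1 = - n.+2%:Z by rewrite -[n.+2]addn1 PoszD opprD.
  by ring.
have [n0 H] := riemann_lebesgue cg pg (divr_gt0 e0 (ltr0n R 2)).
exists n0 => n n0n; rewrite tele; apply: (le_trans (cabsB _ _)).
have := H (- n.+1%:Z); rewrite abszN absz_nat => /(_ (leqW n0n)).
by have := H n%:Z; rewrite absz_nat => /(_ n0n); lra.
Qed.

Lemma ssum_tail (c : int -> R[i]) (K r : R) n j : 0 <= r < 1 ->
  (forall m, cabs (c m) <= K * r ^+ absz m) ->
  cabs (ssum c (n + j) - ssum c n) <= 2 * K * r ^+ n.+1 * (1 - r ^+ j) / (1 - r).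
Proof.
move=> /andP[r0 r1] cK; have r1' : 0 < 1 - r by lra.
elim: j => [|j IH]; first by rewrite addn0 !subrr cabs0 mulr0 mul0r.
rewrite addnS ssumS addrAC.
apply: (le_trans (cabsD _ _)).
have A : cabs (c (n + j).+1%:Z + c (- (n + j).+1%:Z)) <= 2 * K * r ^+ n.+1 * r ^+ j.
  have := cK (n + j).+1%:Z; have := cK (- (n + j).+1%:Z); rewrite abszN absz_nat.
  rewrite -addSn exprD; have := cabsD (c (n + j).+1%:Z) (c (- (n + j).+1%:Z)).
  by rewrite -addSn; lra.
apply: (le_trans (lerD IH A)).
have -> : 2 * K * r ^+ n.+1 * (1 - r ^+ j.+1) / (1 - r) =
  2 * K * r ^+ n.+1 * (1 - r ^+ j) / (1 - r) + 2 * K * r ^+ n.+1 * r ^+ j.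
  by rewrite [r ^+ j.+1]exprS; field; rewrite gt_eqF.
by [].
Qed.

(** The partial sums converge by Chernoff's argument applied to the translate of
    u by x, and the rate comes from the decay of the coefficients. *)
Lemma fourier_inversion u (K r : R) x n : (forall x, exists l, rderiv u x l) ->
  (forall x, u (x + 1) = u x) -> 0 <= r < 1 ->
  (forall m, cabs (fcoef u m) <= K * r ^+ absz m) ->
  cabs (u x - ssum (fun m => fcoef u m * echar m x%:C) n) <= 2 * K * r ^+ n.+1 / (1 - r).
Proof.
move=> du pu r01 uK; have cu := rderiv_ccont du.
have [r0 r1] := andP r01.
have K0 : 0 <= K by have := le_trans (cabs_ge0 _) (uK 0); rewrite expr0 mulr1.
apply/ler_addgt0Pl => e e0.
pose F t := u (t + x).
have [l dl] := du x.
have [] := @chernoff F l e _ _ _ e0.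
- exact: ccont_shift.
- by move=> t; rewrite /F addrAC pu.
- by apply: rderiv_shift; rewrite add0r.
move=> n0 /(_ (n + n0)%N (leq_addl _ _)); rewrite /F add0r => A.
have FE : fcoef F = (fun m => fcoef u m * echar m x%:C).
  by apply/funext => m; rewrite fcoef_shift// mulrC.
rewrite -/F FE in A.
have := @ssum_tail (fun m => fcoef u m * echar m x%:C) K r n n0 r01.
have h m : cabs (fcoef u m * echar m x%:C) <= K * r ^+ absz m by rewrite cabsM cabs_echar_real mulr1.
move=> /(_ h) B.
set S := ssum _ _ in A B *; set S' := ssum _ n in B *.
have -> : u x - S' = (S - S') - (S - u x) by ring.
apply: (le_trans (cabsB _ _)); rewrite [leRHS]addrC; apply: lerD => //.
apply: (le_trans B); rewrite ler_pdivrMr ?subr_gt0// divfK; last by rewrite subr_eq0 gt_eqF.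
rewrite ler_piMr ?mulr_ge0 ?exprn_ge0//.
by rewrite lerBlDl lerDr exprn_ge0.
Qed.

End Chernoff.

(** * Convergents of an irrational number *)

Section ContinuedFractions.
Context {R : realType}.
Implicit Types (x alpha : R) (n : nat).

(** Irrationality in the form that is stable under the Gauss map and that the
    small divisors need. *)
Definition not_fraction x := forall p q : int, q != 0 -> x * q%:~R != p%:~R.

Lemma irrational_not_fraction x : @irrational R x -> not_fraction x.
Proof.
move=> irr p q q0; apply/eqP => xpq; apply: irr.
exists (p%:~R / q%:~R : rat) => //.
rewrite fmorph_div /= !ratr_int -xpq mulfK// intr_eq0//.
Qed.

Lemma not_fraction_sub_neq0 x (k : int) : not_fraction x -> x - k%:~R != 0.
Proof. by move=> /(_ k 1 isT); rewrite mulr1 subr_eq0. Qed.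

Lemma not_fraction_step x (k : int) : not_fraction x -> not_fraction ((x - k%:~R)^-1).
Proof.
move=> nx p q q0; have x0 := not_fraction_sub_neq0 k nx; apply/eqP => E.
have {}E : q%:~R = p%:~R * (x - k%:~R) by rewrite -E mulrAC mulVf ?mul1r.
have p0 : p != 0.
  apply: contra q0 => /eqP p0; move: E; rewrite p0 mul0r => /eqP.
  by rewrite intr_eq0.
have := nx (q + p * k) p p0; rewrite intrD intrM E => /eqP; apply.
by ring.
Qed.

Lemma cf_rem_not_fraction alpha n : not_fraction alpha -> not_fraction (cf_rem alpha n).
Proof. by move=> na; elim: n => //= n IH; exact: not_fraction_step. Qed.

Lemma cf_rem_gt1 alpha n : not_fraction alpha -> 1 < cf_rem alpha n.+1.
Proof.
move=> /(cf_rem_not_fraction n) /(not_fraction_sub_neq0 (Num.floor (cf_rem alpha n))) /=.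
have /andP[] := Num.Theory.floor_itv (cf_rem alpha n).
rewrite intrD; set f := _%:~R; set x := cf_rem _ _ => fx xf x0.
have p : 0 < x - f by rewrite lt_def x0 subr_ge0.
by rewrite -[ltLHS]invr1 ltf_pV2 ?posrE//; lra.
Qed.

Lemma cf_digit_gt0 alpha n : not_fraction alpha -> 1 <= cf_digit alpha n.+1.
Proof.
move=> na; have := cf_rem_gt1 n na; rewrite /cf_digit => x1.
have /andP[_] := Num.Theory.floor_itv (cf_rem alpha n.+1).
by move=> /(lt_trans x1); rewrite ltr1z ltrDr.
Qed.

Lemma cf_remS alpha n : not_fraction alpha ->
  cf_rem alpha n = (cf_digit alpha n)%:~R + (cf_rem alpha n.+1)^-1.
Proof. by move=> na; rewrite /= invrK /cf_digit; ring. Qed.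

(** The determinant of consecutive convergents is 1 or - 1, and alpha is the image
    of the remainder x_(n+2) under the Moebius map with these convergents as
    columns. *)
Lemma cf_invariant alpha n : not_fraction alpha ->
  [/\ 0 < cf_den alpha n, 0 < cf_den alpha n.+1,
      (cf_num alpha n.+1 * cf_den alpha n - cf_num alpha n * cf_den alpha n.+1) ^+ 2 = 1
    & alpha * (cf_rem alpha n.+2 * (cf_den alpha n.+1)%:~R + (cf_den alpha n)%:~R)
      = cf_rem alpha n.+2 * (cf_num alpha n.+1)%:~R + (cf_num alpha n)%:~R].
Proof.
move=> na; elim: n => [|n [q0 q1 det rel]].
  have d1 := cf_digit_gt0 0 na.
  split => //.
    by rewrite /=; ring.
  have E0 := cf_remS 0 na; have E1 := cf_remS 1 na.
  have r1 := cf_rem_gt1 0 na; have r2 := cf_rem_gt1 1 na.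
  rewrite -[cf_den alpha 1]/(cf_digit alpha 1) -[cf_num alpha 1]/(cf_digit alpha 1 * cf_digit alpha 0 + 1).
  rewrite -[cf_den alpha 0]/1 -[cf_num alpha 0]/(cf_digit alpha 0).
  rewrite intrD intrM.
  have Ea : alpha = (cf_digit alpha 0)%:~R + (cf_rem alpha 1)^-1 := E0.
  move: Ea E1 r1 r2.
  move: (cf_rem alpha 1) (cf_rem alpha 2) ((cf_digit alpha 0)%:~R : R) ((cf_digit alpha 1)%:~R : R).
  move=> x1 x2 a0 a1 -> E1 r1 r2.
  have x10 : x1 != 0 by rewrite gt_eqF//; lra.
  have x20 : x2 != 0 by rewrite gt_eqF//; lra.
  have -> : a1 = x1 - x2^-1 by rewrite E1 addrK.
  by field; rewrite x10 x20.
have d2 := cf_digit_gt0 n.+1 na.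
have r3 := cf_rem_gt1 n.+2 na.
have E2 := cf_remS n.+2 na.
rewrite -[cf_den alpha n.+2]/(cf_digit alpha n.+2 * cf_den alpha n.+1 + cf_den alpha n).
rewrite -[cf_num alpha n.+2]/(cf_digit alpha n.+2 * cf_num alpha n.+1 + cf_num alpha n).
split => //.
- by rewrite addr_gt0// mulr_gt0// (lt_le_trans _ d2).
- by rewrite -det; ring.
rewrite !intrD !intrM.
move: rel E2 r3.
move: (cf_rem alpha n.+2) (cf_rem alpha n.+3) ((cf_digit alpha n.+2)%:~R : R).
move=> x2 x3 a2 rel E2 r3.
have x30 : x3 != 0 by rewrite gt_eqF//; lra.
rewrite E2 in rel.
have := congr1 (fun z => x3 * z) rel.
move: ((cf_den alpha n.+1)%:~R : R) ((cf_den alpha n)%:~R : R) ((cf_num alpha n.+1)%:~R : R) ((cf_num alpha n)%:~R : R).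
move=> Q1 Q0 P1 P0 H.
transitivity (x3 * (alpha * ((a2 + x3^-1) * Q1 + Q0))); first by field.
by rewrite H; field.
Qed.

(** For n > 0 the previous relations show that |alpha q - p| is the inverse of x q + q', where
    x > 1 and q' is the preceding denominator. *)
Lemma convergent_spec alpha n : not_fraction alpha ->
  [/\ 0 < cf_den alpha n, coprimez (cf_num alpha n) (cf_den alpha n) &
      `|alpha * (cf_den alpha n)%:~R - (cf_num alpha n)%:~R| * (cf_den alpha n)%:~R <= 1].
Proof.
move=> na; case: n => [|n].
  split => //; first by rewrite coprimezE coprimen1.
  rewrite -[cf_den alpha 0]/1 -[cf_num alpha 0]/(cf_digit alpha 0) !mulr1.
  have /andP[] := Num.Theory.floor_itv alpha; rewrite intrD /cf_digit /=.
  by set f := _%:~R; rewrite ler_norml; lra.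
have [q0 q1 det rel] := cf_invariant n na; split => //.
  apply/coprimezP.
  have /eqP := det; rewrite sqrf_eq1 => /orP[]/eqP E.
    by exists (cf_den alpha n, - cf_num alpha n); rewrite -[RHS]E mulrC mulNr.
  exists (- cf_den alpha n, cf_num alpha n).
  by rewrite -[RHS]opprK -E mulNr mulrC opprB addrC.
have r2 := cf_rem_gt1 n.+1 na.
move/(congr1 (fun k : int => k%:~R : R)): det; rewrite expr2 !intrM intrD intrN !intrM => det.
move: q0 q1; rewrite -(ltr0z R) -(ltr0z R).
move: rel r2 det.
move: ((cf_den alpha n.+1)%:~R : R) ((cf_den alpha n)%:~R : R) ((cf_num alpha n.+1)%:~R : R) ((cf_num alpha n)%:~R : R).
move: (cf_rem alpha n.+2) => x Q1 Q0 P1 P0 rel x1 det q0 q1.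
set D := x * Q1 + Q0 in rel.
have D0 : Q1 <= D by rewrite /D; nra.
have E : (alpha * Q1 - P1) * D = P0 * Q1 - P1 * Q0.
  by rewrite mulrBl mulrAC rel /D; ring.
have : `|(alpha * Q1 - P1) * D| = 1.
  rewrite E; apply/eqP; rewrite -(eqrXn2 (n := 2)) ?normr_ge0// expr1n -normrX.
  by rewrite (_ : _ ^+ 2 = 1) ?normr1// -[RHS]det; ring.
rewrite normrM (ger0_norm (x := D)); last by lra.
by move=> <-; rewrite ler_wpM2l.
Qed.

End ContinuedFractions.

(** * Small divisors *)

Section SmallDivisors.
Context {R : realType}.
Implicit Types (a alpha x t : R) (p : int) (q k n : nat).

(** For 0 < k < q the integer k p - j q is not 0, so k p / q is at distance at
    least 1 / q from the integers, and k a differs from it by at most 1 / (4 q). *)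
Lemma small_divisor a p q k : (0 < q)%N -> coprime (absz p) q ->
  `|a * q%:R - p%:~R| * q%:R <= 1 -> (0 < k)%N -> (4 * k <= q)%N ->
  1 / q%:R <= cabs (e2pi (k%:R * a)%:C - 1).
Proof.
move=> q0 cop aq k0 k4.
have [j kaj] := nearest_int (k%:R * a).
have qR : 0 < q%:R :> R by rewrite ltr0n.
have ne : k%:Z * p - j * q%:Z != 0.
  rewrite subr_eq0; apply/eqP => E.
  have : (q %| k)%N.
    rewrite -(@Gauss_dvdl q k (absz p)); last by rewrite coprime_sym.
    by have := congr1 absz E; rewrite !abszM !absz_nat => ->; exact: dvdn_mull.
  by move=> /dvdn_leq => /(_ k0); lia.
have ge1 : 1 <= `|k%:R * p%:~R - j%:~R * q%:R| :> R.
  have : 1 <= `|k%:Z * p - j * q%:Z| by rewrite -gtz0_ge1 normr_gt0.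
  by rewrite -(ler_int R) intr_norm rmorphB /= !rmorphM /=.
have tri : `|k%:R * p%:~R - j%:~R * q%:R| <= k%:R * `|a * q%:R - p%:~R| + q%:R * `|k%:R * a - j%:~R|.
  have -> : k%:R * p%:~R - j%:~R * q%:R = - (k%:R * (a * q%:R - p%:~R)) + q%:R * (k%:R * a - j%:~R) by ring.
  by apply: (le_trans (ler_normD _ _)); rewrite normrN !normrM (ger0_norm (ler0n _ k)) (ger0_norm (ler0n _ q)).
have k4R : 4 * k%:R <= q%:R :> R by rewrite -natrM ler_nat.
have kk : k%:R * `|a * q%:R - p%:~R| <= 1 / 4.
  have n0 := normr_ge0 (a * q%:R - p%:~R).
  rewrite (le_trans (y := q%:R / 4 * `|a * q%:R - p%:~R|))//.
    by rewrite ler_wpM2r//; lra.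
  by rewrite mulrAC mulrC; lra.
apply: le_trans (e2pi_sub1_lower kaj).
by rewrite ler_pdivrMr//; lra.
Qed.

(** None of the finitely many multiples of alpha considered is an integer. *)
Lemma char_lower alpha n : not_fraction alpha -> exists2 m : R, 0 < m &
  forall k, (0 < k <= n)%N -> m <= cabs (e2pi (k%:R * alpha)%:C - 1).
Proof.
move=> na; elim: n => [|n [m m0 H]]; first by exists 1 => // k; case: k.
exists (Num.min m (cabs (e2pi (n.+1%:R * alpha)%:C - 1))).
  rewrite lt_min m0 cabs_gt0 subr_eq0; apply/eqP => /e2pi_eq1[j E].
  by have := na j n.+1%:Z isT; rewrite -pmulrn mulrC E eqxx.
move=> k /andP[k0]; rewrite leq_eqVlt => /orP[/eqP ->|kn].
  by rewrite ge_min lexx orbT.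
by rewrite ge_min H// k0.
Qed.

Lemma geometric_sum_le t n : 0 <= t < 1 -> \sum_(k < n) t ^+ k.+1 <= 1 / (1 - t).
Proof.
move=> /andP[t0 t1].
suff : \sum_(k < n) t ^+ k.+1 <= (1 - t ^+ n) / (1 - t).
  move=> /le_trans; apply; rewrite ler_pM2r ?invr_gt0 ?subr_gt0//.
  by rewrite lerBlDl lerDr exprn_ge0.
elim: n => [|n IH]; first by rewrite big_ord0 subrr mul0r.
rewrite big_ord_recr /=; apply: (le_trans (lerD IH (lexx _))).
have -> : (1 - t ^+ n) / (1 - t) + t ^+ n.+1 = (1 - t ^+ n * (1 - t * (1 - t))) / (1 - t).
  by rewrite exprS; field; rewrite gt_eqF// subr_gt0.
rewrite ler_pM2r ?invr_gt0 ?subr_gt0// lerB// exprS mulrC ler_wpM2l ?exprn_ge0//; nra.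
Qed.

(** For k <= k0 the inverse divisors are bounded independently of q, as a is close
    to the irrational alpha; for k > k0 they are at most q, and a factor t ^ k0 of
    the weight makes this contribution a small multiple of q.  Half of the decay,
    t ^ k out of (t ^ 2) ^ k, is left for summing over k. *)
Lemma small_divisor_sum alpha (K t tau : R) : not_fraction alpha -> 0 <= K -> 0 < t < 1 -> 0 < tau ->
  exists Q : R, forall q p a, Q < q%:R -> (0 < q)%N -> coprime (absz p) q ->
    `|a * q%:R - p%:~R| * q%:R <= 1 -> `|a - alpha| * q%:R <= 2 ->
    \sum_(k < q %/ 4) K * (t ^+ 2) ^+ k.+1 / cabs (e2pi (k.+1%:R * a)%:C - 1) <= tau * q%:R.
Proof.
move=> na K0 /andP[t0 t1] tau0.
have t1' : 0 < 1 - t by lra.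
have pi0 := pi_gt0 R.
(* beyond k0 the weight beats the bound q on the inverse divisors *)
have [k0 Hk0] : exists k0 : nat, K * t ^+ k0 / (1 - t) <= tau / 2.
  have c0 : 0 < tau / 2 * (1 - t) / (K + 1) by rewrite divr_gt0 ?mulr_gt0 ?divr_gt0//; lra.
  have /cvgrPdist_lt/(_ _ c0)[n _ /(_ n (leqnn n))] : t ^+ n @[n --> \oo] --> (0 : R).
    by apply: cvg_expr; rewrite ger0_norm// ltW.
  rewrite sub0r normrN ger0_norm ?exprn_ge0 ?ltW// => Hn; exists n.
  rewrite ler_pdivrMr//.
  have tn : 0 <= t ^+ n by rewrite exprn_ge0// ltW.
  move: Hn; rewrite ltr_pdivlMr; last lra.
  by move=> Hn; rewrite mulrC; nra.
have [m m0 Hm] := char_lower k0 na.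
(* m / 2 is lost when alpha is replaced by a *)
pose C0 := 2 / m.
have C00 : 0 < C0 by rewrite divr_gt0.
exists (Num.max (2 * K * C0 / ((1 - t) * tau)) (2 * pi * k0%:R * 2 / (m / 2))) => q p a.
rewrite gt_max => /andP[Q1 Q2] q0 cop aq aalpha.
have qR : 0 < q%:R :> R by rewrite ltr0n.
have each k : (0 < k)%N -> (4 * k <= q)%N ->
    (cabs (e2pi (k%:R * a)%:C - 1))^-1 <= C0 + (if (k <= k0)%N then 0 else q%:R).
  move=> kp k4; have low := small_divisor q0 cop aq kp k4.
  case: leqP => kk0; last first.
    rewrite (le_trans (y := q%:R)) ?lerDr ?(ltW C00)//.
    by rewrite invf_ple ?posrE//; [rewrite -div1r|apply: lt_le_trans low; rewrite divr_gt0].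
  rewrite addr0.
  have mk : m <= cabs (e2pi (k%:R * alpha)%:C - 1) by apply: Hm; rewrite kp.
  have dk : cabs (e2pi (k%:R * alpha)%:C - e2pi (k%:R * a)%:C) <= m / 2.
    apply: (le_trans (e2pi_lip _ _)); rewrite -mulrBr normrM (ger0_norm (ler0n _ _)) distrC.
    have kk0R : k%:R <= k0%:R :> R by rewrite ler_nat.
    have n0 := normr_ge0 (a - alpha).
    move: Q2; rewrite ltr_pdivrMr ?divr_gt0// => Q2.
    rewrite -(ler_pM2r qR); apply: (@le_trans _ _ (2 * pi * k0%:R * 2)).
      by rewrite -!mulrA ler_pM2l// ler_pM2l//; apply: ler_pM; rewrite ?ler0n ?mulr_ge0 ?normr_ge0.
    by rewrite [X in _ <= X]mulrC ltW.
  have m2 : m / 2 <= cabs (e2pi (k%:R * a)%:C - 1).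
    have : m <= cabs (e2pi (k%:R * a)%:C - 1) + cabs (e2pi (k%:R * alpha)%:C - e2pi (k%:R * a)%:C).
      apply: (le_trans mk).
      have -> : e2pi (k%:R * alpha)%:C - 1 =
        (e2pi (k%:R * a)%:C - 1) + (e2pi (k%:R * alpha)%:C - e2pi (k%:R * a)%:C) by ring.
      exact: cabsD.
    lra.
  by rewrite invf_ple ?posrE// /C0 ?invf_div//; lra.
apply: (@le_trans _ _ (\sum_(k < q %/ 4) (K * (C0 + q%:R * t ^+ k0) * t ^+ k.+1))).
  apply: ler_sum => k _.
  have kq : (4 * k.+1 <= q)%N.
    by rewrite mulnC (leq_trans _ (leq_trunc_div q 4))// leq_mul2r ltn_ord orbT.
  have := each k.+1 isT kq => H.
  rewrite -!mulrA ler_wpM2l//.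
  have T0 : 0 < t ^+ k.+1 by rewrite exprn_gt0.
  rewrite -exprM mulnC exprM expr2 -mulrA mulrC ler_pM2r//.
  apply: (le_trans (ler_wpM2l (ltW T0) H)).
  have T1 : t ^+ k.+1 <= 1 by rewrite exprn_ile1 ?ltW.
  rewrite mulrDr; apply: lerD; first by rewrite ler_piMl// ltW.
  case: ifPn => kk0; first by rewrite mulr0 mulr_ge0// exprn_ge0// ltW.
  by rewrite mulrC ler_wpM2l// ler_wiXn2l ?ltW// ltnW// ltnNge.
rewrite -mulr_sumr.
have G := geometric_sum_le (q %/ 4) (t := t); rewrite (ltW t0) t1 in G; move: (G isT) => {}G.
have tk : 0 <= t ^+ k0 by rewrite exprn_ge0// ltW.
apply: (@le_trans _ _ (K * (C0 + q%:R * t ^+ k0) * (1 / (1 - t)))).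
  by rewrite ler_wpM2l// mulr_ge0// addr_ge0 ?(ltW C00)// mulr_ge0.
have -> : K * (C0 + q%:R * t ^+ k0) * (1 / (1 - t)) = K * C0 / (1 - t) + K * t ^+ k0 / (1 - t) * q%:R.
  by field; rewrite gt_eqF.
have A : K * t ^+ k0 / (1 - t) * q%:R <= tau / 2 * q%:R by rewrite ler_pM2r.
have B : K * C0 / (1 - t) <= tau / 2 * q%:R.
  by rewrite ler_pdivrMr//; move: Q1; rewrite ltr_pdivrMr ?mulr_gt0//; lra.
by lra.
Qed.

End SmallDivisors.

(** * The cohomological equation *)

Section Cohomology.
Context {R : realType}.
Implicit Types (a alpha x y h : R) (z : R[i]) (c : nat -> R[i]) (m : int) (n k : nat).

Lemma cabs_conjc z : cabs z^*%C = cabs z.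
Proof. by case: z => p q; rewrite /cabs /= sqrrN. Qed.

Lemma conjcM z w : (z * w)^*%C = z^*%C * w^*%C. Proof. exact: rmorphM. Qed.
Lemma conjcD z w : (z + w)^*%C = z^*%C + w^*%C. Proof. exact: rmorphD. Qed.
Lemma conjcB z w : (z - w)^*%C = z^*%C - w^*%C. Proof. exact: rmorphB. Qed.

Lemma conjc_sum n (F : 'I_n -> R[i]) : (\sum_(k < n) F k)^*%C = \sum_(k < n) (F k)^*%C.
Proof. exact: rmorph_sum. Qed.

Lemma cexp_conj (z : R[i]) : (cexp z)^*%C = cexp z^*%C.
Proof.
case: z => p q; rewrite /cexp /= cosN sinN.
by apply/eqP; rewrite eq_complex /=; apply/andP; split; apply/eqP; ring.
Qed.

Lemma e2pi_conj (z : R[i]) : (e2pi z)^*%C = e2pi (- z^*%C).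
Proof.
rewrite /e2pi cexp_conj; congr cexp; case: z => p q.
by apply/eqP; rewrite eq_complex /=; apply/andP; split; apply/eqP; ring.
Qed.

Lemma echar_conj m x : (echar m x%:C)^*%C = echar (- m) x%:C.
Proof.
rewrite /echar e2pi_conj rmorphM rmorph_int [X in _ * X]conjc_real -mulNr.
by rewrite mulrNz.
Qed.

Lemma rderiv_conj (u : R -> R[i]) x l : rderiv u x l -> rderiv (fun x => (u x)^*%C) x l^*%C.
Proof.
move=> du e /du[r r0 H]; exists r => // t /H.
have -> : (u (x + t))^*%C - (u x)^*%C - t%:C * l^*%C = (u (x + t) - u x - t%:C * l)^*%C.
  by rewrite !conjcB conjcM conjc_real.
by rewrite cabs_conjc.
Qed.

(** The conjugate of a primitive is a primitive of the conjugate. *)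
Lemma fcoef_conj (u : R -> R[i]) m : ccont u -> (forall x, (u x)^*%C = u x) ->
  fcoef u (- m) = (fcoef u m)^*%C.
Proof.
move=> cu ru.
have /cprim_exists[P PP] : ccont (fun x => u x * echar (- m) x%:C).
  by apply: ccontM => //; exact: ccont_echar.
have Q : cprim (fun x => (P x)^*%C) (fun x => u x * echar (- - m) x%:C).
  move=> x; have := rderiv_conj (PP x).
  by rewrite conjcM ru echar_conj.
by rewrite /fcoef (cintE _ _ PP) (cintE _ _ Q) rmorphB.
Qed.

Lemma real_conjc z : complex.Im z = 0 -> z^*%C = z.
Proof. by case: z => p q /= ->; rewrite oppr0. Qed.

Lemma conjc_real_Im z : z^*%C = z -> complex.Im z = 0.
Proof. by case: z => p q /= [] h; lra. Qed.

Lemma echar_natE n x : echar n%:Z x%:C = e2pi (n%:R * x)%:C.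
Proof. by rewrite /echar rmorphM rmorph_nat. Qed.

(** The trigonometric polynomial without constant term whose coefficient of index
    k + 1 is c k and which is real on the real line. *)
Definition real_trig (c : nat -> R[i]) n z : R[i] :=
  \sum_(k < n) (c k * echar k.+1%:Z z + (c k)^*%C * echar (- k.+1%:Z) z).

Lemma cderiv_real_trig c n z : exists l, cderiv (real_trig c n) z l.
Proof.
apply: cderiv_sum => k; have [l Hl] := cderiv_echar k.+1%:Z z.
have [l' Hl'] := cderiv_echar (- k.+1%:Z) z.
by eexists; apply: cderivD; apply: cderivZ; eassumption.
Qed.

Lemma real_trig_periodic c n z : real_trig c n (z + 1) = real_trig c n z.
Proof. by apply: eq_bigr => k _; rewrite !echar1. Qed.

Lemma real_trig_real c n x : complex.Im (real_trig c n x%:C) = 0.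
Proof.
apply: conjc_real_Im; rewrite /real_trig conjc_sum; apply: eq_bigr => k _.
by rewrite conjcD (conjcM (c k)) (conjcM (c k)^*%C) conjcK !echar_conj opprK addrC.
Qed.

Lemma real_trig_bound c n h z : `|complex.Im z| <= h ->
  cabs (real_trig c n z) <= \sum_(k < n) 2 * cabs (c k) * expR (2 * pi * h * k.+1%:R).
Proof.
move=> zh; apply: (le_trans (cabs_sum _ _ _)); apply: ler_sum => k _.
have pi0 := pi_gt0 R.
have B m : absz m = k.+1 -> cabs (echar m z) <= expR (2 * pi * h * k.+1%:R).
  move=> mk; rewrite cabs_echar ler_expR (le_trans (ler_norm _))//.
  rewrite normrN !normrM -intr_norm -natr_absz mk normr_nat (ger0_norm (ltW pi0)).
  by rewrite mulrAC ler_wpM2r// ler_wpM2l// mulr_ge0// ltW.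
apply: (le_trans (cabsD _ _)); rewrite (cabsM (c k)) (cabsM (c k)^*%C) cabs_conjc.
have -> : 2 * cabs (c k) * expR (2 * pi * h * k.+1%:R) =
  cabs (c k) * expR (2 * pi * h * k.+1%:R) + cabs (c k) * expR (2 * pi * h * k.+1%:R) by ring.
by apply: lerD; apply: ler_wpM2l; rewrite ?cabs_ge0//; apply: B; rewrite ?abszN.
Qed.

(** Translation by a multiplies the coefficient of index k by e (k a), hence
    dividing by e (k a) - 1 inverts the coboundary frequency by frequency. *)
Lemma real_trig_coboundary (u : R -> R[i]) a n x : ccont u -> (forall x, (u x)^*%C = u x) ->
  (forall k, (0 < k <= n)%N -> e2pi (k%:R * a)%:C != 1) ->
  let c k := fcoef u k.+1%:Z / (e2pi (k.+1%:R * a)%:C - 1) in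
  real_trig c n (x + a)%:C - real_trig c n x%:C =
  ssum (fun m => fcoef u m * echar m x%:C) n - fcoef u 0.
Proof.
move=> cu ru ne c; rewrite /ssum echar0m mulr1 addrAC subrr add0r /real_trig -sumrB.
apply: eq_bigr => k _.
have ce : c k * (echar k.+1%:Z a%:C - 1) = fcoef u k.+1%:Z.
  rewrite /c echar_natE divfK// subr_eq0.
  by apply: ne; rewrite ltn_ord.
have ce' : (c k)^*%C * (echar (- k.+1%:Z) a%:C - 1) = fcoef u (- k.+1%:Z).
  by rewrite fcoef_conj// -ce [RHS](conjcM (c k)) (conjcB (echar _ _)) echar_conj conjc1.
rewrite -ce -ce' rmorphD /= !echarD; ring.
Qed.

(** The frequencies up to q / 4 are removed by a coboundary.  The coefficients of
    rho decay like exp (- pi eps |k|), and the weight exp (2 pi (eps / 4) k) of the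
    smaller strip uses half of this, whence the base t = exp (- pi eps / 4) of the
    small divisor sum. *)
Lemma gauge_exists alpha (eps K tau : R) : not_fraction alpha -> 0 < eps -> 0 < K -> 0 < tau ->
  exists Q : R, forall (q : nat) (p : int) (a : R) (rho : R[i] -> R[i]),
    Q < q%:R -> (0 < q)%N -> coprime (absz p) q ->
    `|a * q%:R - p%:~R| * q%:R <= 1 -> `|a - alpha| * q%:R <= 2 ->
    holo eps rho -> strip_periodic eps rho -> (forall x, complex.Im (rho x%:C) = 0) ->
    (forall z, strip eps z -> cabs (rho z) <= K) ->
  exists (phi : R[i] -> R[i]) (rho0 : R),
    [/\ forall z, exists l, cderiv phi z l, forall z, phi (z + 1) = phi z,
        forall x, complex.Im (phi x%:C) = 0,
        forall z, `|complex.Im z| <= eps / 4 -> cabs (phi z) <= tau * q%:R &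
        forall x, cabs (rho x%:C - rho0%:C - (phi (x + a)%:C - phi x%:C)) <=
          2 * K / (1 - expR (- (pi * eps))) * expR (- (pi * eps / 4 * q%:R))].
Proof.
move=> na eps0 K0 tau0; have pi0 := pi_gt0 R.
pose t : R := expR (- (pi * eps / 4)).
have t0 : 0 < t by exact: expR_gt0.
have pe : 0 < pi * eps by rewrite mulr_gt0.
have t1 : t < 1 by rewrite -[ltRHS]expR0 ltr_expR; lra.
have t01 : 0 < t < 1 by rewrite t0.
have K20 : 0 <= 2 * K by lra.
have [Q HQ] := small_divisor_sum na K20 t01 tau0.
exists Q => q p a rho qQ q0 cop aq aalpha hrho prho rrho brho.
have S := HQ q p a qQ q0 cop aq aalpha.
pose u x := rho x%:C.
have e20 : 0 <= eps / 2 < eps by apply/andP; split; lra.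
have dec m := @fcoef_decay R rho eps K (eps / 2) m hrho prho brho e20.
have cu : ccont u by apply: (@line_ccont R rho eps 0); rewrite ?normr0.
have ru x : (u x)^*%C = u x by apply: real_conjc; exact: rrho.
pose r : R := expR (- (pi * eps)).
have r0 : 0 < r by exact: expR_gt0.
have r1 : r < 1 by rewrite -[ltRHS]expR0 ltr_expR; lra.
have dec' m : cabs (fcoef u m) <= K * r ^+ absz m.
  apply: (le_trans (dec m)); rewrite ler_pM2l// /r -expRM_natr ler_expR.
  by rewrite mulNr lerN2 le_eqVlt; apply/orP; left; apply/eqP; field.
pose n := (q %/ 4)%N.
have nq k : (k <= n)%N -> (4 * k <= q)%N.
  by move=> kn; rewrite mulnC (leq_trans _ (leq_trunc_div q 4))// leq_mul2r kn orbT.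
have ne k : (0 < k <= n)%N -> e2pi (k%:R * a)%:C != 1.
  move=> /andP[k0 /nq kn]; have := small_divisor q0 cop aq k0 kn.
  rewrite -subr_eq0 -cabs_gt0; apply: lt_le_trans.
  by rewrite divr_gt0// ltr0n.
pose c k := fcoef u k.+1%:Z / (e2pi (k.+1%:R * a)%:C - 1).
exists (real_trig c n), (complex.Re (fcoef u 0)); split.
- exact: cderiv_real_trig.
- exact: real_trig_periodic.
- exact: real_trig_real.
- move=> z zh; apply: (le_trans (real_trig_bound c n zh)); apply: le_trans S.
  apply: ler_sum => k _; rewrite /c cabsM cabsV.
  set D := cabs (e2pi _ - 1).
  have D0 : 0 <= D^-1 by rewrite invr_ge0 cabs_ge0.
  have := dec' k.+1%:Z; rewrite absz_nat => H.
  rewrite mulrA mulrAC ler_wpM2r// -!mulrA ler_pM2l//.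
  rewrite (le_trans (ler_wpM2r (expR_ge0 _) H))// -mulrA ler_pM2l//.
  rewrite /r /t -expRM_natr -expRD -exprM -expRM_natr ler_expR natrM.
  by rewrite le_eqVlt; apply/orP; left; apply/eqP; field.
- move=> x; rewrite real_trig_coboundary//.
  have -> : (complex.Re (fcoef u 0))%:C = fcoef u 0.
    have : (fcoef u 0)^*%C = fcoef u 0 by rewrite -fcoef_conj// oppr0.
    by move=> /conjc_real_Im; case: (fcoef u 0) => p' q' /= ->.
  have -> : rho x%:C - fcoef u 0 - (ssum (fun m => fcoef u m * echar m x%:C) n - fcoef u 0) =
    u x - ssum (fun m => fcoef u m * echar m x%:C) n by rewrite /u; ring.
  have du y : exists l, rderiv u y l.
    have [|l Hl] := hrho (y +i* 0); first by rewrite /strip /= normr0.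
    by exists l; apply: cderiv_horizontal.
  have pu y : u (y + 1) = u y by rewrite /u rmorphD /= prho// /strip /= normr0.
  have r01 : 0 <= r < 1 by rewrite (ltW r0).
  apply: (le_trans (fourier_inversion x n du pu r01 dec')).
  rewrite [leRHS]mulrAC ler_pM2r ?invr_gt0 ?subr_gt0// ler_pM2l ?mulr_gt0//.
  rewrite /r -expRM_natr ler_expR mulNr lerN2.
  have q4 : q%:R <= 4 * n.+1%:R :> R by rewrite -natrM ler_nat mulnC ltnW// ltn_ceil.
  have := ler_wpM2l (ltW pe) q4; lra.
Qed.

End Cohomology.

(** * Second order recurrences on the integers *)

Lemma intSD (i : nat) : i.+1%:Z + 1 = i.+2%:Z. Proof. lia. Qed.
Lemma intSB (i : nat) : i.+1%:Z - 1 = i%:Z. Proof. lia. Qed.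
Lemma intND (i : nat) : - i.+1%:Z + 1 = - i%:Z. Proof. lia. Qed.
Lemma intNB (i : nat) : - i.+1%:Z - 1 = - i.+2%:Z. Proof. lia. Qed.
Lemma int_offset (m k : int) : m = k + `|m - k|%N%:Z \/ m = k - `|m - k|%N%:Z.
Proof. lia. Qed.
Lemma int_below (M : nat) (m : int) : (`|m| <= M)%N ->
  exists2 j : nat, m = M%:Z - j%:Z & (j <= 2 * M)%N.
Proof. by move=> mM; exists `|M%:Z - m|%N; lia. Qed.

Section Recurrences.
Context {R : realType}.
Implicit Types (c r s x y : int -> R[i]) (m : int) (n : nat).

Definition recurrence c r s := forall m, s (m + 1) + s (m - 1) = c m * s m + r m.

Definition wronskian x y m : R[i] := x m * y (m + 1) - y m * x (m + 1).

(** For an exact common recurrence the Wronskian is constant; the remainders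
    enter bilinearly. *)
Lemma wronskian_step c r r' x y m : recurrence c r x -> recurrence c r' y ->
  wronskian x y m - wronskian x y (m - 1) = x m * r' m - y m * r m.
Proof.
move=> hx hy; rewrite /wronskian subrK.
have -> : y (m + 1) = c m * y m + r' m - y (m - 1) by rewrite -hy; ring.
have -> : x (m + 1) = c m * x m + r m - x (m - 1) by rewrite -hx; ring.
by ring.
Qed.

(** The variation is summed downwards from the index M, where the Wronskian will
    be small by decay, to an index that may be as low as - M. *)
Lemma wronskian_bound c r r' x y (B eps : R) (M : nat) m : recurrence c r x -> recurrence c r' y ->
  (forall m, cabs (x m) <= B) -> (forall m, cabs (y m) <= B) ->
  (forall m, cabs (r m) <= eps) -> (forall m, cabs (r' m) <= eps) ->
  (absz m <= M)%N ->
  cabs (wronskian x y m) <= cabs (wronskian x y M%:Z) + (2 * M%:R) * (2 * B * eps).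
Proof.
move=> hx hy xB yB re re' mM.
have B0 : 0 <= B by exact: le_trans (cabs_ge0 _) (xB 0).
have e0 : 0 <= eps by exact: le_trans (cabs_ge0 _) (re 0).
have step k : cabs (wronskian x y (k - 1)) <= cabs (wronskian x y k) + 2 * B * eps.
  have := wronskian_step k hx hy => E.
  have -> : wronskian x y (k - 1) = wronskian x y k - (x k * r' k - y k * r k) by rewrite -E; ring.
  apply: (le_trans (cabsB _ _)); rewrite lerD2l (le_trans (cabsB _ _))// !cabsM.
  have -> : 2 * B * eps = B * eps + B * eps by ring.
  by apply: lerD; apply: ler_pM; rewrite ?cabs_ge0.
have down j : cabs (wronskian x y (M%:Z - j%:Z)) <= cabs (wronskian x y M%:Z) + j%:R * (2 * B * eps).
  elim: j => [|j IH]; first by rewrite subr0 mul0r addr0.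
  have -> : M%:Z - j.+1%:Z = M%:Z - j%:Z - 1 by rewrite -addn1 PoszD opprD addrA.
  by apply: (le_trans (step _)); rewrite -natr1; lra.
have [j -> jM] := int_below mM.
apply: (le_trans (down j)); rewrite lerD2l ler_wpM2r ?mulr_ge0//.
by rewrite -natrM ler_nat.
Qed.

(** The induction carries two consecutive terms: the coefficient being at most
    A - 1, a factor A absorbs both of them. *)
Lemma forward_growth (s : nat -> R[i]) (A e0 e1 : R) n : 1 <= A -> 0 <= e0 -> 0 <= e1 ->
  cabs (s 0%N) <= e0 -> cabs (s 1%N) <= e0 ->
  (forall j, cabs (s j.+2) <= (A - 1) * cabs (s j.+1) + cabs (s j) + e1) ->
  cabs (s n) <= A ^+ n * (e0 + n%:R * e1).
Proof.
move=> A1 e00 e10 s0 s1 hs.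
suff [] : cabs (s n) <= A ^+ n * (e0 + n%:R * e1) /\
          cabs (s n.+1) <= A ^+ n.+1 * (e0 + n.+1%:R * e1) by [].
elim: n => [|n [IH1 IH2]].
  by rewrite expr0 mul0r addr0 mul1r expr1 mul1r; split => //; nra.
split => //; apply: (le_trans (hs n)).
have An : 1 <= A ^+ n by rewrite exprn_ege1.
move: IH1 IH2; rewrite [A ^+ n.+2]exprS [A ^+ n.+1]exprS -[n.+2%:R]natr1 -[n.+1%:R]natr1.
move: (A ^+ n) An (n%:R : R) (ler0n R n) => P P1 k k0 IH1 IH2.
have P2 : P <= A * P by nra.
have H1 : P * (e0 + k * e1) <= A * P * (e0 + (k + 1) * e1).
  by apply: ler_pM => //; [lra|rewrite addr_ge0// mulr_ge0|nra].
have H2 : (A - 1) * cabs (s n.+1) <= (A - 1) * (A * P * (e0 + (k + 1) * e1)).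
  by rewrite ler_wpM2l//; lra.
have H3 : e1 <= A * (A * P) * e1 by rewrite ler_peMl//; nra.
have -> : A * (A * P) * (e0 + (k + 1 + 1) * e1) = A * (A * P * (e0 + (k + 1) * e1)) + A * (A * P) * e1 by ring.
by lra.
Qed.

Lemma two_sided_growth c r s (A e0 e1 : R) m0 m (n : nat) : 1 <= A -> 0 <= e0 ->
  recurrence c r s -> (forall m, cabs (c m) <= A - 1) -> (forall m, cabs (r m) <= e1) ->
  cabs (s m0) <= e0 -> cabs (s (m0 + 1)) <= e0 -> cabs (s (m0 - 1)) <= e0 ->
  (absz (m - m0) <= n)%N ->
  cabs (s m) <= A ^+ n * (e0 + n%:R * e1).
Proof.
move=> A1 e00 hs cA re s0 sp sm mn.
have e10 : 0 <= e1 by exact: le_trans (cabs_ge0 _) (re 0).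
have up k : cabs (s (k + 1)) <= (A - 1) * cabs (s k) + cabs (s (k - 1)) + e1.
  have -> : s (k + 1) = c k * s k - s (k - 1) + r k by rewrite addrAC -hs addrK.
  apply: (le_trans (cabsD _ _)); apply: lerD => //.
  apply: (le_trans (cabsB _ _)); rewrite cabsM lerD2r ler_wpM2r ?cabs_ge0//.
have dn k : cabs (s (k - 1)) <= (A - 1) * cabs (s k) + cabs (s (k + 1)) + e1.
  have -> : s (k - 1) = c k * s k - s (k + 1) + r k by rewrite addrAC -hs addrC addKr.
  apply: (le_trans (cabsD _ _)); apply: lerD => //.
  apply: (le_trans (cabsB _ _)); rewrite cabsM lerD2r ler_wpM2r ?cabs_ge0//.
pose j := absz (m - m0).
have key : cabs (s m) <= A ^+ j * (e0 + j%:R * e1).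
  have [E|E] := int_offset m m0.
    rewrite [in cabs _]E; apply: (@forward_growth (fun i => s (m0 + i%:Z))) => //.
      by rewrite addr0.
    move=> i; have := up (m0 + i.+1%:Z).
    by rewrite -!addrA intSD intSB.
  rewrite [in cabs _]E; apply: (@forward_growth (fun i => s (m0 - i%:Z))) => //.
    by rewrite subr0.
  move=> i; have := dn (m0 - i.+1%:Z).
  by rewrite -!addrA intNB intND.
apply: (le_trans key); apply: ler_pM.
- by rewrite exprn_ge0//; lra.
- by rewrite addr_ge0// mulr_ge0.
- by rewrite ler_weXn2l.
- by rewrite lerD2l ler_wpM2r// ler_nat.
Qed.

End Recurrences.

(** * Columns of an almost conjugacy on the real line *)

Section Columns.
Context {R : realType}.
Implicit Types (v : int -> R[i]) (d n : nat) (k : int) (a x E : R) (rho phi : R -> R).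

(** The three clauses are the bound, the rows below the first, and the first row
    multiplied by its denominator v d.  The component of index d
    extends the column beyond its 2 d rows and makes the last clause symmetric in
    [- d, d]. *)
Definition column d v (xi a E : R) rho (B eta : R) (y : int -> R -> R[i]) : Prop :=
 [/\ forall k x, (absz k <= d)%N -> cabs (y k x) <= B * expR (xi * (absz k)%:R),
     forall k x, - d%:Z <= k -> k < d%:Z ->
       cabs (y (k + 1) x - y k (x + a) * e2pi (rho x)%:C) <= eta * expR (xi * (absz k)%:R)
   & forall x, cabs (ssum (fun k => v k * y k x) d
       + (e2pi x%:C + e2pi (- x%:C) - E%:C) * y 0 x) <= eta].

Lemma ssumZ (z : R[i]) (c : int -> R[i]) n : z * ssum c n = ssum (fun k => z * c k) n.
Proof. by rewrite /ssum mulrDr mulr_sumr; congr (_ + _); apply: eq_bigr => i _; rewrite mulrDr. Qed.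

Lemma ssumD (c c' : int -> R[i]) n : ssum c n + ssum c' n = ssum (fun k => c k + c' k) n.
Proof.
rewrite /ssum addrACA -big_split /=; congr (_ + _).
by apply: eq_bigr => i _; rewrite addrACA.
Qed.

Lemma eq_ssum (c c' : int -> R[i]) n : (forall k, (absz k <= n)%N -> c k = c' k) -> ssum c n = ssum c' n.
Proof.
move=> H; rewrite /ssum H//; congr (_ + _); apply: eq_bigr => i _.
by rewrite !H// ?abszN absz_nat.
Qed.

Lemma ssum_bound (c : int -> R[i]) (b : nat -> R) n : (forall k, (absz k <= n)%N -> cabs (c k) <= b (absz k)) ->
  cabs (ssum c n) <= b 0%N + \sum_(k < n) 2 * b k.+1.
Proof.
move=> H; apply: (le_trans (cabsD _ _)); apply: lerD; first exact: H.
apply: (le_trans (cabs_sum _ _ _)); apply: ler_sum => k _.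
apply: (le_trans (cabsD _ _)).
have := H k.+1%:Z; rewrite absz_nat => /(_ (ltn_ord k)).
have := H (- k.+1%:Z); rewrite abszN absz_nat => /(_ (ltn_ord k)).
lra.
Qed.

Lemma columnZD d v xi a E rho B eta y0 y1 (w0 w1 : R[i]) :
  column d v xi a E rho B eta y0 -> column d v xi a E rho B eta y1 ->
  cabs w0 <= 1 -> cabs w1 <= 1 ->
  column d v xi a E rho (2 * B) (2 * eta) (fun k x => w0 * y0 k x + w1 * y1 k x).
Proof.
move=> [b0 s0 e0] [b1 s1 e1] w01 w11.
have comb z0 z1 (M : R) : cabs z0 <= M -> cabs z1 <= M -> cabs (w0 * z0 + w1 * z1) <= 2 * M.
  move=> h0 h1; apply: (le_trans (cabsD _ _)); rewrite !cabsM.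
  have := cabs_ge0 z0; have := cabs_ge0 z1; nra.
split.
- by move=> k x kd; rewrite -mulrA; apply: comb; [exact: b0|exact: b1].
- move=> k x k0 k1; rewrite -mulrA.
  have -> : w0 * y0 (k + 1) x + w1 * y1 (k + 1) x - (w0 * y0 k (x + a) + w1 * y1 k (x + a)) * e2pi (rho x)%:C
    = w0 * (y0 (k + 1) x - y0 k (x + a) * e2pi (rho x)%:C) + w1 * (y1 (k + 1) x - y1 k (x + a) * e2pi (rho x)%:C) by ring.
  by apply: comb; [exact: s0|exact: s1].
- move=> x; set Z := e2pi x%:C + _ - _.
  have -> : ssum (fun k => v k * (w0 * y0 k x + w1 * y1 k x)) d + Z * (w0 * y0 0 x + w1 * y1 0 x) =
     w0 * (ssum (fun k => v k * y0 k x) d + Z * y0 0 x) + w1 * (ssum (fun k => v k * y1 k x) d + Z * y1 0 x).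
    rewrite (mulrDr w0) (mulrDr w1) !ssumZ addrACA ssumD; congr (_ + _); last by ring.
    by apply: eq_ssum => k _; ring.
  by apply: comb; [exact: e0|exact: e1].
Qed.

Section Orbit.
Variables (d : nat) (v : int -> R[i]) (xi a E : R) (rho phi : R -> R) (rho0 r B eta : R).
Variable y : int -> R -> R[i].
Hypothesis xi0 : 0 <= xi.
Hypothesis B0 : 0 <= B.
Hypothesis ycol : column d v xi a E rho B eta y.
Hypothesis coh : forall x, `|rho x - rho0 - (phi (x + a) - phi x)| <= r.

Let f x := y 0 x * e2pi (phi x)%:C.
Let g k x := y k x * e2pi (phi x)%:C * e2pi (- (k%:~R * rho0))%:C.
Let eta1 := eta + 2 * pi * B * r.

(** After multiplication by the unimodular factors of g, the translation from k to
    k + 1 loses the defect and the error r of the cohomological equation, the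
    latter against the size of y. *)
Lemma orbit_step k x : - d%:Z <= k -> k < d%:Z ->
  cabs (g (k + 1) x - g k (x + a)) <= expR (xi * (absz k)%:R) * eta1.
Proof.
move=> k0 k1; have [yb ys _] := ycol.
have kd : (absz k <= d)%N by lia.
have u1 (t : R) : cabs (e2pi t%:C) = 1 by exact: cabs_e2pi_real.
have -> : g (k + 1) x - g k (x + a) =
  (y (k + 1) x - y k (x + a) * e2pi (rho x)%:C
   + y k (x + a) * (e2pi (rho x)%:C - e2pi (rho0 + (phi (x + a) - phi x))%:C))
  * (e2pi (phi x)%:C * e2pi (- ((k + 1)%:~R * rho0))%:C).
  rewrite /g.
  have -> : y k (x + a) * e2pi (phi (x + a))%:C * e2pi (- (k%:~R * rho0))%:C =
     y k (x + a) * (e2pi (phi (x + a))%:C * e2pi (- (k%:~R * rho0))%:C) by ring.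
  have -> : e2pi (phi (x + a))%:C * e2pi (- (k%:~R * rho0))%:C =
     e2pi (rho0 + (phi (x + a) - phi x))%:C * (e2pi (phi x)%:C * e2pi (- ((k + 1)%:~R * rho0))%:C).
    rewrite -!e2piD -!rmorphD /=; congr (e2pi _%:C); rewrite intrD; ring.
  by ring.
rewrite cabsM (cabsM (e2pi _)) !u1 !mulr1.
apply: (le_trans (cabsD _ _)); rewrite (cabsM (y _ _)).
have h1 := ys k x k0 k1; have h2 := yb k (x + a) kd.
have h3 := e2pi_lip (rho x) (rho0 + (phi (x + a) - phi x)).
have h4 : `|rho x - (rho0 + (phi (x + a) - phi x))| <= r.
  by rewrite (_ : _ - _ = rho x - rho0 - (phi (x + a) - phi x)) ?coh//; ring.
have pi0 := pi_gt0 R.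
have h5 : cabs (e2pi (rho x)%:C - e2pi (rho0 + (phi (x + a) - phi x))%:C) <= 2 * pi * r.
  by apply: (le_trans h3); rewrite ler_wpM2l// mulr_ge0// ltW.
have := ler_pM (cabs_ge0 _) (cabs_ge0 _) h2 h5.
rewrite /eta1; lra.
Qed.

Hypothesis eta0 : 0 <= eta1.

Lemma orbit_forward n x : (n <= d)%N ->
  cabs (g n%:Z x - f (x + n%:R * a)) <= n%:R * expR (xi * n%:R) * eta1.
Proof.
elim: n x => [|n IH] x nd.
  by rewrite /g /f mulr0z !mul0r addr0 oppr0 e2pi0 mulr1 subrr cabs0.
have -> : g n.+1%:Z x - f (x + n.+1%:R * a) =
  (g (n%:Z + 1) x - g n%:Z (x + a)) + (g n%:Z (x + a) - f (x + a + n%:R * a)).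
  have -> : x + n.+1%:R * a = x + a + n%:R * a by rewrite -natr1; ring.
  have -> : n.+1%:Z = n%:Z + 1 by lia.
  by ring.
apply: (le_trans (cabsD _ _)).
have h1 := IH (x + a) (ltnW nd).
have h2 : cabs (g (n%:Z + 1) x - g n (x + a)) <= expR (xi * n%:R) * eta1.
  by apply: orbit_step; lia.
have ee : expR (xi * n%:R) <= expR (xi * n.+1%:R) by rewrite ler_expR ler_wpM2l// ler_nat.
rewrite -natr1 mulrDl mul1r mulrDl.
have : n%:R * expR (xi * n%:R) * eta1 <= n%:R * expR (xi * n.+1%:R) * eta1.
  by rewrite ler_wpM2r// ler_wpM2l.
have : expR (xi * n%:R) * eta1 <= expR (xi * n.+1%:R) * eta1 by rewrite ler_wpM2r.
rewrite natr1; lra.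
Qed.

Lemma orbit_backward n x : (n <= d)%N ->
  cabs (g (- n%:Z) x - f (x - n%:R * a)) <= n%:R * expR (xi * n%:R) * eta1.
Proof.
elim: n x => [|n IH] x nd.
  by rewrite /g /f oppr0 mulr0z !mul0r subr0 oppr0 e2pi0 mulr1 subrr cabs0.
have -> : g (- n.+1%:Z) x - f (x - n.+1%:R * a) =
  (g (- n%:Z) (x - a) - f (x - a - n%:R * a)) -
  (g (- n.+1%:Z + 1) (x - a) - g (- n.+1%:Z) (x - a + a)).
  have -> : x - n.+1%:R * a = x - a - n%:R * a by rewrite -natr1; ring.
  have -> : - n.+1%:Z + 1 = - n%:Z by lia.
  by rewrite subrK; ring.
apply: (le_trans (cabsB _ _)).
have h1 := IH (x - a) (ltnW nd).
have h2 : cabs (g (- n.+1%:Z + 1) (x - a) - g (- n.+1%:Z) (x - a + a)) <= expR (xi * n.+1%:R) * eta1.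
  by have := @orbit_step (- n.+1%:Z) (x - a); rewrite abszN absz_nat; apply; lia.
have ee : expR (xi * n%:R) <= expR (xi * n.+1%:R) by rewrite ler_expR ler_wpM2l// ler_nat.
rewrite -natr1 mulrDl mul1r mulrDl.
have : n%:R * expR (xi * n%:R) * eta1 <= n%:R * expR (xi * n.+1%:R) * eta1.
  by rewrite ler_wpM2r// ler_wpM2l.
rewrite natr1; lra.
Qed.

(** Each of the |k| steps from the index 0 to k loses at most exp (xi |k|) eta1. *)
Lemma orbit_bound k x : (absz k <= d)%N ->
  cabs (g k x - f (x + k%:~R * a)) <= (absz k)%:R * expR (xi * (absz k)%:R) * eta1.
Proof.
case: k => n kd; first exact: orbit_forward.
by have := orbit_backward x kd; rewrite NegzE mulrNz mulNr abszN absz_nat.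
Qed.

End Orbit.

End Columns.

(** * Sums of exponentially decaying families *)

Section Decaying.
Context {R : realType}.
Implicit Types (b x : R) (n : nat).

(** A quarter of the decay rate pays for the factor k of the orbit estimate. *)
Lemma nat_le_exp b n : 0 < b -> n%:R <= 4 / b * expR (b / 4 * n%:R).
Proof.
move=> b0; have := expR_ge1Dx (b / 4 * n%:R) => h.
rewrite (le_trans (y := 4 / b * (b / 4 * n%:R)))//; last first.
  by rewrite ler_wpM2l ?divr_ge0 ?(ltW b0)//; lra.
by rewrite le_eqVlt; apply/orP; left; apply/eqP; field; rewrite gt_eqF.
Qed.

Lemma exp_half_lt1 b : 0 < b -> 0 <= expR (- (b / 2)) < 1.
Proof. by move=> b0; rewrite expR_ge0 -[ltRHS]expR0 ltr_expR; lra. Qed.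

Definition trig_bound b : R := 1 + 2 * (1 / (1 - expR (- (b / 2)))).

Lemma decaying_ssum_bound b (c : int -> R[i]) n : 0 < b ->
  (forall k, (absz k <= n)%N -> cabs (c k) <= expR (- (b * (absz k)%:R))) ->
  cabs (ssum c n) <= trig_bound b.
Proof.
move=> b0 cb.
apply: (@le_trans _ _ (expR (- (b * 0%:R)) + \sum_(k < n) 2 * expR (- (b * k.+1%:R)))).
  exact: (@ssum_bound R c (fun n => expR (- (b * n%:R)))).
rewrite mulr0 oppr0 expR0 lerD2l -mulr_sumr ler_pM2l//.
apply: le_trans (geometric_sum_le n (exp_half_lt1 b0)).
apply: ler_sum => k _; rewrite -expRM_natr ler_expR mulNr lerN2 ler_wpM2r//.
by have := ltW b0; lra.
Qed.

Lemma trig_bound_ge1 b : 0 < b -> 1 <= trig_bound b.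
Proof.
move=> b0; have [h0 h1] := andP (exp_half_lt1 b0).
by rewrite /trig_bound lerDl mulr_ge0// divr_ge0// subr_ge0 ltW.
Qed.

End Decaying.

(** * The scalar difference equation *)

Section Residual.
Context {R : realType}.
Variables (d : nat) (v : int -> R[i]) (b xi a E : R) (rho phi : R -> R) (rho0 r B eta : R).
Variable y : int -> R -> R[i].
Hypothesis b0 : 0 < b.
Hypothesis vb : forall k, cabs (v k) <= expR (- (b * (absz k)%:R)).
Hypothesis xi0 : 0 <= xi.
Hypothesis xib : xi <= b / 4.
Hypothesis B0 : 0 <= B.
Hypothesis r0 : 0 <= r.
Hypothesis eta0 : 0 <= eta.
Hypothesis ycol : column d v xi a E rho B eta y.
Hypothesis coh : forall x, `|rho x - rho0 - (phi (x + a) - phi x)| <= r.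

Let f x := y 0 x * e2pi (phi x)%:C.
Let eta1 := eta + 2 * pi * B * r.

Let eta10 : 0 <= eta1.
Proof. by rewrite addr_ge0// !mulr_ge0// pi_ge0. Qed.

Let cc : R := 4 / b * 2 / (1 - expR (- (b / 2))).

(** Replacing the component of index k by f (x + k a) costs
    k exp (xi k) in the orbit estimate against exp (- b k) from v, which is
    summable independently of d because xi <= b / 4. *)
Lemma residual_bound x :
  cabs (ssum (fun k => v k * e2pi (k%:~R * rho0)%:C * f (x + k%:~R * a)) d
    + (e2pi x%:C + e2pi (- x%:C) - E%:C) * f x) <= (1 + cc) * eta1.
Proof.
pose g k x := y k x * e2pi (phi x)%:C * e2pi (- (k%:~R * rho0))%:C.
pose w k := v k * e2pi (k%:~R * rho0)%:C.
have wE k : w k * g k x = e2pi (phi x)%:C * (v k * y k x).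
  rewrite /w /g.
  transitivity ((e2pi (k%:~R * rho0)%:C * e2pi (- (k%:~R * rho0))%:C) * (e2pi (phi x)%:C * (v k * y k x))); first by ring.
  by rewrite -e2piD -rmorphD subrr e2pi0 mul1r.
set Z := e2pi x%:C + _ - _.
have -> : ssum (fun k => w k * f (x + k%:~R * a)) d + Z * f x =
   e2pi (phi x)%:C * (ssum (fun k => v k * y k x) d + Z * y 0 x)
   - ssum (fun k => w k * (g k x - f (x + k%:~R * a))) d.
  rewrite (mulrDr (e2pi _)) ssumZ.
  rewrite -[X in _ = _ - X](addrK (ssum (fun k => w k * f (x + k%:~R * a)) d)) ssumD.
  have -> : ssum (fun k => w k * (g k x - f (x + k%:~R * a)) + w k * f (x + k%:~R * a)) d =
    ssum (fun k => e2pi (phi x)%:C * (v k * y k x)) d.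
    by apply: eq_ssum => k _; rewrite -wE; ring.
  by rewrite /f; ring.
have [_ _ ye] := ycol.
have h1 : cabs (e2pi (phi x)%:C * (ssum (fun k => v k * y k x) d + Z * y 0 x)) <= eta1.
  rewrite cabsM cabs_e2pi_real// mul1r (le_trans (ye x))// lerDl.
  by rewrite !mulr_ge0// pi_ge0.
pose beta n := expR (- (b * n%:R)) * (n%:R * expR (xi * n%:R) * eta1).
have h2 : cabs (ssum (fun k => w k * (g k x - f (x + k%:~R * a))) d) <= cc * eta1.
  apply: (@le_trans _ _ (beta 0%N + \sum_(k < d) 2 * beta k.+1)).
    apply: ssum_bound => k kd; rewrite /w cabsM (cabsM (v k)) [X in _ * X * _]cabs_e2pi_real// mulr1.
    apply: ler_pM; rewrite ?cabs_ge0//.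
    exact: (@orbit_bound R d v xi a E rho phi rho0 r B eta y).
  rewrite {1}/beta !mul0r mulr0 add0r.
  apply: (@le_trans _ _ (\sum_(k < d) (4 / b * 2 * eta1 * expR (- (b / 2)) ^+ k.+1))).
    apply: ler_sum => k _; rewrite /beta.
    set n := k.+1; have n0 : 0 <= n%:R :> R by [].
    have step : expR (- (b * n%:R)) * (n%:R * expR (xi * n%:R)) <= 4 / b * expR (- (b / 2)) ^+ n.
      apply: (@le_trans _ _ (expR (- (b * n%:R)) * (4 / b * expR (b / 4 * n%:R) * expR (b / 4 * n%:R)))).
        rewrite ler_wpM2l ?expR_ge0//; apply: ler_pM; rewrite ?expR_ge0//.
          exact: nat_le_exp.
        by rewrite ler_expR ler_wpM2r.
      have -> : expR (- (b * n%:R)) * (4 / b * expR (b / 4 * n%:R) * expR (b / 4 * n%:R)) =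
        4 / b * (expR (- (b * n%:R)) * (expR (b / 4 * n%:R) * expR (b / 4 * n%:R))) by ring.
      rewrite -!expRD -expRM_natr ler_wpM2l ?divr_ge0 ?(ltW b0)// ler_expR.
      by rewrite le_eqVlt; apply/orP; left; apply/eqP; field.
    have := ler_wpM2r eta10 step; lra.
  rewrite -mulr_sumr /cc.
  have -> : 4 / b * 2 / (1 - expR (- (b / 2))) * eta1 = 4 / b * 2 * eta1 * (1 / (1 - expR (- (b / 2)))).
    by ring.
  rewrite ler_wpM2l//; last by apply: geometric_sum_le; exact: exp_half_lt1.
  by rewrite !mulr_ge0// invr_ge0 ltW.
by apply: (le_trans (cabsB _ _)); rewrite [leRHS]mulrDl mul1r; apply: lerD.
Qed.

End Residual.

(** * The difference operator on the Fourier side *)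

Section FourierOperator.
Context {R : realType}.
Implicit Types (u w : R -> R[i]) (m k : int).

Lemma fcoefZ (c : R[i]) u m : ccont u -> fcoef (fun x => c * u x) m = c * fcoef u m.
Proof.
move=> cu; rewrite /fcoef -cintZ; last by apply: ccontM => //; exact: ccont_echar.
by apply: eq_cint => x; rewrite mulrA.
Qed.

Lemma fcoefD u w m : ccont u -> ccont w -> fcoef (fun x => u x + w x) m = fcoef u m + fcoef w m.
Proof.
move=> cu cw; rewrite /fcoef -cintD; last 2 first.
- by apply: ccontM => //; exact: ccont_echar.
- by apply: ccontM => //; exact: ccont_echar.
by apply: eq_cint => x; rewrite mulrDl.
Qed.

Lemma fcoef_bound u (M : R) m : ccont u -> (forall x, cabs (u x) <= M) -> cabs (fcoef u m) <= M.
Proof.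
move=> cu uM; rewrite -[leRHS]mulr1 -[X in _ * X]subr0; apply: cint_bound => //.
  by apply: ccontM => //; exact: ccont_echar.
by move=> x _; rewrite cabsM cabs_echar_real mulr1.
Qed.

Lemma eq_fcoef u w m : u =1 w -> fcoef u m = fcoef w m.
Proof. by move=> /funext ->. Qed.

Lemma fcoef_mod u k m : fcoef (fun x => echar k x%:C * u x) m = fcoef u (m - k).
Proof.
apply: eq_cint => x.
by rewrite opprB -echarM [RHS]mulrCA mulrA.
Qed.

Lemma ccont_ssum (c : int -> R -> R[i]) n : (forall k, ccont (c k)) -> ccont (fun x => ssum (fun k => c k x) n).
Proof.
move=> cc; rewrite /ssum; apply: ccontD => //; apply: ccont_sum => i; exact: ccontD.
Qed.

Lemma fcoef_ssum (c : int -> R -> R[i]) n m : (forall k, ccont (c k)) ->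
  fcoef (fun x => ssum (fun k => c k x) n) m = ssum (fun k => fcoef (c k) m) n.
Proof.
move=> cc; elim: n => [|n IH].
  rewrite [RHS]/ssum big_ord0 addr0; apply: eq_fcoef => x.
  by rewrite /ssum big_ord0 addr0.
rewrite ssumS -IH -!fcoefD//; last 2 first.
- exact: ccont_ssum.
- exact: ccontD.
by apply: eq_fcoef => x; rewrite ssumS.
Qed.

Lemma fcoef_operator (c : int -> R[i]) (a E : R) u n m : ccont u -> (forall x, u (x + 1) = u x) ->
  fcoef (fun x => ssum (fun k => c k * u (x + k%:~R * a)) n
    + (e2pi x%:C + e2pi (- x%:C) - E%:C) * u x) m =
  ssum (fun k => c k * echar m (k%:~R * a)%:C) n * fcoef u m
  + fcoef u (m - 1) + fcoef u (m + 1) - E%:C * fcoef u m.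
Proof.
move=> cu pu.
have cs k : ccont (fun x => c k * u (x + k%:~R * a)) by apply: ccontZ; exact: ccont_shift.
have ce k : ccont (fun x => echar k x%:C * u x) by apply: ccontM => //; exact: ccont_echar.
have cE : ccont (fun x => - E%:C * u x) by exact: ccontZ.
have -> : (fun x => ssum (fun k => c k * u (x + k%:~R * a)) n
    + (e2pi x%:C + e2pi (- x%:C) - E%:C) * u x) =
  (fun x => ssum (fun k => c k * u (x + k%:~R * a)) n + echar 1 x%:C * u x + echar (- 1) x%:C * u x + - E%:C * u x).
  apply/funext => x; rewrite /echar mul1r mulrNz mulN1r; ring.
rewrite fcoefD//; last by apply: ccontD => //; apply: ccontD => //; exact: ccont_ssum.
rewrite fcoefD//; last by apply: ccontD => //; exact: ccont_ssum.
rewrite fcoefD//; last exact: ccont_ssum.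
rewrite fcoef_ssum// !fcoef_mod fcoefZ// opprK.
congr (_ + _ + _ + _); last by rewrite mulNr.
rewrite mulrC ssumZ; apply: eq_ssum => k _.
by rewrite fcoefZ ?fcoef_shift//; [ring|exact: ccont_shift].
Qed.

End FourierOperator.

(** * The symplectic form on columns *)

Lemma int_range_pos (d k : nat) : (k < d)%N -> - d%:Z <= k%:Z /\ k%:Z < d%:Z.
Proof. lia. Qed.
Lemma int_range_neg (d k : nat) : (k < d)%N -> - d%:Z <= - k.+1%:Z /\ - k.+1%:Z < d%:Z.
Proof. lia. Qed.

Section Symplectic.
Context {R : realType}.
Implicit Types (v p q : int -> R[i]) (d : nat).

(** The form u^* S w in terms of components: S pairs k >= 0 with - l - 1 < 0, and
    its entry there is, up to sign and conjugation, v of the difference of the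
    indices. *)
Definition symp_form v d p q : R[i] :=
  \sum_(l < d) \sum_(k < d)
    ((p (- l.+1%:Z))^*%C * v (k%:Z + l.+1%:Z) * q k%:Z
     - (p k%:Z)^*%C * (v (k%:Z + l.+1%:Z))^*%C * q (- l.+1%:Z)).

Lemma symp_form_lin v d p q0 q1 w0 w1 :
  symp_form v d p (fun k => w0 * q0 k + w1 * q1 k) = w0 * symp_form v d p q0 + w1 * symp_form v d p q1.
Proof.
rewrite /symp_form !mulr_sumr -big_split /=; apply: eq_bigr => l _.
rewrite !mulr_sumr -big_split /=; apply: eq_bigr => k _; ring.
Qed.

(** The paired indices have opposite signs, so that |v (k + l + 1)| decays in both
    k and l at rate b, and p and q consume at most half of this in each index. *)
Lemma symp_form_bound v d p q (b B S : R) : 0 < b ->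
  (forall k, cabs (v k) <= expR (- (b * (absz k)%:R))) ->
  (forall k, - d%:Z <= k -> k < d%:Z -> cabs (p k) <= B * expR (b / 4 * (absz k)%:R)) ->
  (forall k, - d%:Z <= k -> k < d%:Z -> cabs (q k) <= S * expR (b / 2 * (absz k)%:R)) ->
  (0 < d)%N -> cabs (symp_form v d p q) <=
    2 / (expR (- (b / 2)) * (1 - expR (- (b / 2))) ^+ 2) * (B * S).
Proof.
move=> b0 vb pB qS dp.
set r := expR (- (b / 2)).
have [r0 r1] := andP (exp_half_lt1 b0).
have rp : 0 < r by exact: expR_gt0.
have rE n : expR (- (b / 2) * n%:R) = r ^+ n by rewrite expRM_natr.
have [B0 S0] : 0 <= B /\ 0 <= S.
  have d1 : - d%:Z <= 0 by rewrite oppr_le0.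
  have d2 : 0 < d%:Z by rewrite ltz_nat.
  have := le_trans (cabs_ge0 _) (pB 0 d1 d2); have := le_trans (cabs_ge0 _) (qS 0 d1 d2).
  by rewrite !mulr0 expR0 !mulr1.
have term (l k : 'I_d) : cabs ((p (- l.+1%:Z))^*%C * v (k%:Z + l.+1%:Z) * q k%:Z
     - (p k%:Z)^*%C * (v (k%:Z + l.+1%:Z))^*%C * q (- l.+1%:Z)) <= 2 / r * (B * S) * (r ^+ l.+1 * r ^+ k.+1).
  have [k1 k2] := int_range_pos (ltn_ord k); have [l1 l2] := int_range_neg (ltn_ord l).
  have pk := pB _ k1 k2; have qk := qS _ k1 k2.
  have pl := pB _ l1 l2; have ql := qS _ l1 l2.
  have vkl := vb (k%:Z + l.+1%:Z).
  rewrite absz_nat in pk qk; rewrite abszN absz_nat in pl ql.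
  rewrite -PoszD absz_nat natrD in vkl.
  have l0 : 0 <= l.+1%:R :> R by []. have k0 : 0 <= k%:R :> R by [].
  have rr : r ^+ l.+1 * r ^+ k = expR (- (b / 2) * (l.+1%:R + k%:R)) by rewrite -exprD -rE natrD.
  have T (s1 s2 : R) : 0 <= s1 <= b / 2 -> 0 <= s2 <= b / 2 ->
     B * expR (s1 * l.+1%:R) * expR (- (b * (k%:R + l.+1%:R))) * (S * expR (s2 * k%:R)) <= B * S * (r ^+ l.+1 * r ^+ k).
    move=> /andP[s10 s1b] /andP[s20 s2b].
    have -> : B * expR (s1 * l.+1%:R) * expR (- (b * (k%:R + l.+1%:R))) * (S * expR (s2 * k%:R)) =
      B * S * (expR (s1 * l.+1%:R) * expR (- (b * (k%:R + l.+1%:R))) * expR (s2 * k%:R)) by ring.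
    rewrite ler_wpM2l ?mulr_ge0// rr -!expRD ler_expR.
    have := ler_wpM2r l0 s1b; have := ler_wpM2r k0 s2b; lra.
  have s4 : 0 <= b / 4 <= b / 2 by apply/andP; split; lra.
  have s2 : 0 <= b / 2 <= b / 2 by apply/andP; split; lra.
  rewrite -PoszD in vkl *; rewrite PoszD in vkl *.
  apply: (le_trans (cabsB _ _)).
  have -> : 2 / r * (B * S) * (r ^+ l.+1 * r ^+ k.+1) =
     B * S * (r ^+ l.+1 * r ^+ k) + B * S * (r ^+ l.+1 * r ^+ k).
    by rewrite [r ^+ k.+1]exprS; field; rewrite gt_eqF.
  apply: lerD.
    apply: le_trans (T _ _ s4 s2); rewrite !cabsM cabs_conjc.
    by apply: ler_pM; rewrite ?mulr_ge0 ?cabs_ge0//; apply: ler_pM; rewrite ?cabs_ge0.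
  apply: le_trans (T _ _ s2 s4); rewrite !cabsM !cabs_conjc.
  have -> : B * expR (b / 2 * l.+1%:R) * expR (- (b * (k%:R + l.+1%:R))) * (S * expR (b / 4 * k%:R)) =
    B * expR (b / 4 * k%:R) * expR (- (b * (k%:R + l.+1%:R))) * (S * expR (b / 2 * l.+1%:R)) by ring.
  by apply: ler_pM; rewrite ?mulr_ge0 ?cabs_ge0//; apply: ler_pM; rewrite ?cabs_ge0.
apply: (le_trans (cabs_sum _ _ _)).
apply: (@le_trans _ _ (\sum_(l < d) \sum_(k < d) 2 / r * (B * S) * (r ^+ l.+1 * r ^+ k.+1))).
  apply: ler_sum => l _; apply: (le_trans (cabs_sum _ _ _)); apply: ler_sum => k _; exact: term.
under eq_bigr do rewrite -mulr_sumr -mulr_sumr.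
rewrite -mulr_sumr -mulr_suml.
have G := @geometric_sum_le R r d (exp_half_lt1 b0).
have G0 : 0 <= \sum_(k < d) r ^+ k.+1 by apply: sumr_ge0 => k _; rewrite exprn_ge0.
have -> : 2 / (r * (1 - r) ^+ 2) * (B * S) = 2 / r * (B * S) * (1 / (1 - r) * (1 / (1 - r))).
  by field; rewrite gt_eqF ?subr_gt0// gt_eqF.
by rewrite ler_wpM2l ?mulr_ge0 ?invr_ge0//; apply: ler_pM.
Qed.

End Symplectic.

(** * Two columns are almost proportional *)

Lemma intBS_le (N M : nat) (m : int) : (`|m| <= N)%N -> (N.+1 <= M)%N ->
  (`|m| <= M)%N /\ (`|m - 1| <= M)%N.
Proof. lia. Qed.
Lemma int_dist_le (N : nat) (m k : int) : (`|m| <= N)%N -> (`|k| <= N)%N ->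
  (`|m - k| <= 2 * N)%N.
Proof. lia. Qed.

Lemma int_interval_argmax (R : realDomainType) (h : int -> R) (N : nat) :
  exists2 m0 : int, (`|m0| <= N)%N & forall m : int, (`|m| <= N)%N -> h m <= h m0.
Proof.
elim: N => [|N [m0 m0N H]].
  by exists 0 => // m; rewrite leqn0 absz_eq0 => /eqP ->.
have [k kN Hk] : exists2 k : int, (`|k| <= N.+1)%N &
    [/\ h m0 <= h k, h N.+1%:Z <= h k & h (- N.+1%:Z) <= h k].
  have [h1|/ltW h1] := leP (h m0) (h N.+1%:Z).
    have [h2|/ltW h2] := leP (h N.+1%:Z) (h (- N.+1%:Z)).
      by exists (- N.+1%:Z); [rewrite abszN absz_nat|split => //; exact: le_trans h2].
    by exists (N.+1%:Z); [rewrite absz_nat|split].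
  have [h2|/ltW h2] := leP (h m0) (h (- N.+1%:Z)).
    by exists (- N.+1%:Z); [rewrite abszN absz_nat|split => //; exact: le_trans h2].
  by exists m0; [exact: leqW|split].
exists k => // m; rewrite leq_eqVlt => /orP[/eqP E|/H mh].
  have [->|->] : m = N.+1%:Z \/ m = - N.+1%:Z by move: E; clear; lia.
    by case: Hk.
  by case: Hk.
by apply: le_trans mh _; case: Hk.
Qed.

Section Core.
Context {R : realType}.
Variables (d : nat) (v : int -> R[i]) (b xi a E E0 : R) (rho phi : R -> R) (rho0 r B eta B1 t : R).
Variables y0 y1 : int -> R -> R[i].
Hypothesis d0 : (0 < d)%N.
Hypothesis b0 : 0 < b.
Hypothesis vb : forall k, cabs (v k) <= expR (- (b * (absz k)%:R)).
Hypothesis xi0 : 0 <= xi.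
Hypothesis xib : xi <= b / 4.
Hypothesis EE : `|E| <= E0.
Hypothesis B0 : 0 <= B.
Hypothesis r0 : 0 <= r.
Hypothesis eta0 : 0 <= eta.
Hypothesis coh : forall x, `|rho x - rho0 - (phi (x + a) - phi x)| <= r.
Hypothesis ycol0 : column d v xi a E rho B eta y0.
Hypothesis ycol1 : column d v xi a E rho B eta y1.
Hypothesis t01 : 0 <= t < 1.

(** The function f = u_0 e(phi) whose Fourier coefficients solve the recurrence. *)
Definition gauged (y : int -> R -> R[i]) x : R[i] := y 0 x * e2pi (phi x)%:C.

Hypothesis der0 : forall x, exists l, rderiv (gauged y0) x l.
Hypothesis der1 : forall x, exists l, rderiv (gauged y1) x l.
Hypothesis per0 : forall x, gauged y0 (x + 1) = gauged y0 x.
Hypothesis per1 : forall x, gauged y1 (x + 1) = gauged y1 x.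
Hypothesis dec0 : forall m, cabs (fcoef (gauged y0) m) <= B1 * t ^+ absz m.
Hypothesis dec1 : forall m, cabs (fcoef (gauged y1) m) <= B1 * t ^+ absz m.
Hypothesis symp00 : symp_form v d (y0 ^~ 0) (y0 ^~ 0) = 0.
Hypothesis symp11 : symp_form v d (y1 ^~ 0) (y1 ^~ 0) = 0.
Hypothesis symp01 : cabs (symp_form v d (y0 ^~ 0) (y1 ^~ 0)) = 1.
Hypothesis symp10 : cabs (symp_form v d (y1 ^~ 0) (y0 ^~ 0)) = 1.

Definition step_error : R := eta + 2 * pi * B * r.
Definition symp_const : R := 2 / (expR (- (b / 2)) * (1 - expR (- (b / 2))) ^+ 2).
Definition residual_const : R := 1 + 4 / b * 2 / (1 - expR (- (b / 2))).
Definition growth_const : R := E0 + trig_bound b + 1.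

Definition wronskian_error (M : nat) : R :=
  2 * B1 ^+ 2 * t ^+ M + 2 * M%:R * (2 * B * (residual_const * step_error)).

Definition dependence_error (N M : nat) (F : R) : R :=
  growth_const ^+ (2 * N) * (wronskian_error M / F
    + (2 * N)%:R * (2 * (residual_const * step_error))).

Let f0 := gauged y0.
Let f1 := gauged y1.

Let step_error0 : 0 <= step_error.
Proof. by rewrite addr_ge0// !mulr_ge0// pi_ge0. Qed.

(** By linearity the form pairs w0 y0 + w1 y1 with y0 and y1 to numbers of modulus
    |w1| and |w0|, one of which is at least 1; on the other hand the combination is
    small if its gauged component of index 0 is. *)
Lemma combination_lower_bound (w0 w1 : R[i]) sigma : cabs w0 <= 1 -> cabs w1 <= 1 ->
  1 <= Num.max (cabs w0) (cabs w1) ->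
  (forall x, cabs (w0 * f0 x + w1 * f1 x) <= sigma) ->
  1 <= symp_const * (B * (sigma + 8 / b * step_error)).
Proof.
move=> w01 w11 wmax fs.
have ycol := columnZD ycol0 ycol1 w01 w11.
pose yw k x := w0 * y0 k x + w1 * y1 k x.
have fw x : yw 0 x * e2pi (phi x)%:C = w0 * f0 x + w1 * f1 x by rewrite /yw /f0 /f1 /gauged; ring.
have s0 : 0 <= sigma by exact: le_trans (cabs_ge0 _) (fs 0).
have e2E : 2 * eta + 2 * pi * (2 * B) * r = 2 * step_error by rewrite /step_error; ring.
have e20 : 0 <= 2 * eta + 2 * pi * (2 * B) * r by rewrite e2E mulr_ge0.
have qS k : - d%:Z <= k -> k < d%:Z ->
    cabs (yw k 0) <= (sigma + 8 / b * step_error) * expR (b / 2 * (absz k)%:R).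
  move=> k1 k2; have kd : (absz k <= d)%N by move: k1 k2; clear; lia.
  have := @orbit_bound R d v xi a E rho phi rho0 r (2 * B) (2 * eta) yw xi0 (mulr_ge0 (ler0n _ 2) B0) ycol coh e20 k 0 kd.
  rewrite e2E fw; set G := _ * _ * e2pi _ => H.
  have -> : cabs (yw k 0) = cabs G by rewrite /G cabsM (cabsM (yw k 0)) !cabs_e2pi_real// !mulr1.
  rewrite -(subrK (w0 * f0 (0 + k%:~R * a) + w1 * f1 (0 + k%:~R * a)) G).
  apply: (le_trans (cabsD _ _)); apply: (le_trans (lerD H (fs _))).
  set n := (absz k)%:R : R; have n0 : 0 <= n by [].
  have e1 : 1 <= expR (b / 2 * n).
    by rewrite -[leLHS]expR0 ler_expR !mulr_ge0// ?invr_ge0// ltW.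
  have e2 : n * expR (xi * n) <= 4 / b * expR (b / 2 * n).
    apply: (@le_trans _ _ (4 / b * expR (b / 4 * n) * expR (b / 4 * n))).
      by apply: ler_pM; rewrite ?expR_ge0// ?nat_le_exp// ler_expR ler_wpM2r.
    rewrite -mulrA -expRD ler_wpM2l ?divr_ge0 ?(ltW b0)// ler_expR.
    by rewrite le_eqVlt; apply/orP; left; apply/eqP; field.
  have := ler_wpM2r (mulr_ge0 (ler0n _ 2) step_error0) e2.
  have : sigma <= sigma * expR (b / 2 * n) by rewrite ler_peMr.
  have -> : 8 / b = 4 / b + 4 / b by ring.
  by lra.
have pB y : column d v xi a E rho B eta y -> forall k, - d%:Z <= k -> k < d%:Z ->
    cabs (y k 0) <= B * expR (b / 4 * (absz k)%:R).
  move=> [yb _ _] k k1 k2; have kd : (absz k <= d)%N by move: k1 k2; clear; lia.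
  by rewrite (le_trans (yb k 0 kd))// ler_wpM2l// ler_expR ler_wpM2r.
have bound y (yc : column d v xi a E rho B eta y) :=
  @symp_form_bound R v d (y ^~ 0) (yw ^~ 0) b B _ b0 vb (pB y yc) qS d0.
have s0E : cabs (symp_form v d (y0 ^~ 0) (yw ^~ 0)) = cabs w1.
  by rewrite (symp_form_lin v d _ (y0 ^~ 0) (y1 ^~ 0)) symp00 mulr0 add0r cabsM symp01 mulr1.
have s1E : cabs (symp_form v d (y1 ^~ 0) (yw ^~ 0)) = cabs w0.
  by rewrite (symp_form_lin v d _ (y0 ^~ 0) (y1 ^~ 0)) symp11 mulr0 addr0 cabsM symp10 mulr1.
have := bound y0 ycol0; have := bound y1 ycol1; rewrite s0E s1E -/symp_const.
by move: wmax; rewrite le_max => /orP[] h1 h2 h3; [exact: le_trans h1 h2|exact: le_trans h1 h3].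
Qed.

(** Fourier inversion: the coefficients up to N are bounded by hypothesis, the
    others by decay. *)
Lemma combination_sup (w0 w1 : R[i]) (N : nat) s : cabs w0 <= 1 -> cabs w1 <= 1 ->
  (forall m, (absz m <= N)%N -> cabs (w0 * fcoef f0 m + w1 * fcoef f1 m) <= s) ->
  forall x, cabs (w0 * f0 x + w1 * f1 x) <= (2 * N%:R + 1) * s + 4 * B1 * t ^+ N.+1 / (1 - t).
Proof.
move=> w01 w11 hs x.
have c0 : ccont f0 by exact: rderiv_ccont der0.
have c1 : ccont f1 by exact: rderiv_ccont der1.
pose u x := w0 * f0 x + w1 * f1 x.
have uE m : fcoef u m = w0 * fcoef f0 m + w1 * fcoef f1 m.
  by rewrite fcoefD ?fcoefZ//; exact: ccontZ.
have du y : exists l, rderiv u y l.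
  have [l0 h0] := der0 y; have [l1 h1] := der1 y.
  by eexists; apply: rderivD; apply: rderivZ; eassumption.
have pu y : u (y + 1) = u y by rewrite /u /f0 /f1 per0 per1.
have ud m : cabs (fcoef u m) <= 2 * B1 * t ^+ absz m.
  rewrite uE; apply: (le_trans (cabsD _ _)); rewrite (cabsM w0) (cabsM w1).
  have := dec0 m; have := dec1 m.
  have := cabs_ge0 (fcoef f0 m); have := cabs_ge0 (fcoef f1 m).
  by rewrite -/f0 -/f1; nra.
have := fourier_inversion x N du pu t01 ud.
set S := ssum _ N => H.
have SB : cabs S <= (2 * N%:R + 1) * s.
  apply: (@le_trans _ _ (s + \sum_(k < N) 2 * s)).
    apply: (@ssum_bound R _ (fun=> s)) => k kN.
    by rewrite cabsM cabs_echar_real mulr1 uE; exact: hs.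
  by rewrite sumr_const card_ord -mulr_natr; lra.
rewrite -/(u x) -(subrK S (u x)); apply: (le_trans (cabsD _ _)).
by rewrite addrC; apply: lerD => //; apply: (le_trans H); rewrite !mulrA -[2 * 2]natrM.
Qed.

Let V m : R[i] := ssum (fun k => v k * e2pi (k%:~R * rho0)%:C * echar m (k%:~R * a)%:C) d.
Let c m : R[i] := E%:C - V m.

(** The potential V is bounded independently of d and m, since v decays. *)
Lemma growth_bound m : cabs (c m) <= growth_const - 1.
Proof.
have Vm : cabs (V m) <= trig_bound b.
  apply: decaying_ssum_bound => // k kd.
  by rewrite cabsM (cabsM (v k)) cabs_echar_real cabs_e2pi_real// !mulr1.
apply: (le_trans (cabsB E%:C (V m))); rewrite cabs_real /growth_const addrK.
exact: lerD.
Qed.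

Let res (y : int -> R -> R[i]) x : R[i] :=
  ssum (fun k => v k * e2pi (k%:~R * rho0)%:C * gauged y (x + k%:~R * a)) d
    + (e2pi x%:C + e2pi (- x%:C) - E%:C) * gauged y x.

Lemma gauged_recurrence y : column d v xi a E rho B eta y ->
  (forall x, exists l, rderiv (gauged y) x l) -> (forall x, gauged y (x + 1) = gauged y x) ->
  recurrence c (fcoef (res y)) (fcoef (gauged y)) /\
  (forall m, cabs (fcoef (res y) m) <= residual_const * step_error) /\
  (forall m, cabs (fcoef (gauged y) m) <= B).
Proof.
move=> yc dy py; have cy := rderiv_ccont dy; split; [|split].
- move=> m; rewrite fcoef_operator// /c /V; set W := ssum _ _; ring.
- move=> m; apply: fcoef_bound; last first.
    by move=> x; exact: (@residual_bound R d v b xi a E rho phi rho0 r B eta y).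
  apply: ccontD.
    by apply: ccont_ssum => k; apply: ccontZ; exact: ccont_shift.
  apply: ccontM => //.
  have e1 : ccont (fun x : R => echar 1 x%:C) by exact: ccont_echar.
  have e2 : ccont (fun x : R => echar (-1) x%:C) by exact: ccont_echar.
  have := ccontD (ccontD e1 e2) (ccont_cst (- E%:C)).
  congr ccont; apply/funext => x; rewrite /echar mul1r mulrNz mulN1r.
  by [].
- move=> m; apply: fcoef_bound => // x.
  have [yb _ _] := yc; rewrite /gauged cabsM cabs_e2pi_real// mulr1.
  by have := yb 0 x (leq0n _); rewrite mulr0 expR0 mulr1.
Qed.

(** With w0 = F1(m0) / F0(m0) and w1 = - 1 the combination of the coefficients
    F0, F1 vanishes at m0, and at m0 + 1 and m0 - 1 it is a Wronskian divided by
    F0(m0).  It solves the recurrence, whose growth over at most 2 N steps bounds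
    it on [- N, N]. *)
Lemma near_dependence N M m0 : (N.+1 <= M)%N -> (absz m0 <= N)%N ->
  cabs (fcoef f1 m0) <= cabs (fcoef f0 m0) -> 0 < cabs (fcoef f0 m0) ->
  1 <= symp_const * (B * ((2 * N%:R + 1) * dependence_error N M (cabs (fcoef f0 m0)) + 4 * B1 * t ^+ N.+1 / (1 - t) + 8 / b * step_error)).
Proof.
move=> NM m0N le10 F0; pose omega := wronskian_error M.
pose s := dependence_error N M (cabs (fcoef f0 m0)).
have [h0 [r0b b0b]] := gauged_recurrence ycol0 der0 per0.
have [h1 [r1b b1b]] := gauged_recurrence ycol1 der1 per1.
rewrite -/f0 in h0 b0b; rewrite -/f1 in h1 b1b.
pose F := cabs (fcoef f0 m0).
have ne : fcoef f0 m0 != 0 by rewrite -cabs_gt0.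
have [t0 t1] := andP t01.
have res0 : 0 <= residual_const * step_error by exact: le_trans (cabs_ge0 _) (r0b 0).
have B10 : 0 <= B1 by have := le_trans (cabs_ge0 _) (dec0 0); rewrite expr0 mulr1.
(* one factor of the decay at M is enough *)
have WM : cabs (wronskian (fcoef f0) (fcoef f1) M%:Z) <= 2 * B1 ^+ 2 * t ^+ M.
  have tM1 : t ^+ M.+1 <= 1 by rewrite exprn_ile1// ltW.
  have tM : 0 <= t ^+ M by rewrite exprn_ge0.
  have d00 := dec0 M%:Z; have d10 := dec1 M%:Z.
  have d01 := dec0 (M%:Z + 1); have d11 := dec1 (M%:Z + 1).
  rewrite -PoszD addn1 !absz_nat -/f0 -/f1 in d00 d10 d01 d11.
  have small z (w : R[i]) : cabs z <= B1 * t ^+ M -> cabs w <= B1 * t ^+ M.+1 ->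
     cabs z * cabs w <= B1 ^+ 2 * t ^+ M.
    move=> hz hw; apply: (@le_trans _ _ ((B1 * t ^+ M) * B1)); last first.
      by rewrite expr2; lra.
    apply: ler_pM; rewrite ?cabs_ge0// (le_trans hw)// ler_piMr//.
  rewrite /wronskian -PoszD addn1; apply: (le_trans (cabsB _ _)); rewrite !cabsM.
  by have := small _ _ d00 d11; have := small _ _ d10 d01; lra.
have Wm m : (absz m <= M)%N -> cabs (wronskian (fcoef f0) (fcoef f1) m) <= omega.
  move=> mM; apply: (le_trans (wronskian_bound h0 h1 b0b b1b r0b r1b mM)).
  by rewrite /omega lerD2r.
have [m0M m1M] := intBS_le m0N NM.
pose w0 := fcoef f1 m0 / fcoef f0 m0.
pose w1 : R[i] := -1.
have w01 : cabs w0 <= 1 by rewrite cabsM cabsV ler_pdivrMr ?mul1r// .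
have w11 : cabs w1 = 1 by rewrite cabsN cabs1.
have w11' : cabs w1 <= 1 by rewrite w11.
have wmax : 1 <= Num.max (cabs w0) (cabs w1) by rewrite le_max w11 lexx orbT.
pose z m := w0 * fcoef f0 m + w1 * fcoef f1 m.
have om0 : 0 <= omega by exact: le_trans (cabs_ge0 _) (Wm m0 m0M).
have z0 : cabs (z m0) <= omega / F.
  rewrite /z /w0 divfK// /w1 mulN1r subrr cabs0 divr_ge0// ltW//.
have zp : cabs (z (m0 + 1)) <= omega / F.
  have -> : z (m0 + 1) = - (wronskian (fcoef f0) (fcoef f1) m0 / fcoef f0 m0).
    by rewrite /z /w0 /w1 /wronskian; field.
  by rewrite cabsN cabsM cabsV ler_pM2r ?invr_gt0// Wm.
have zm : cabs (z (m0 - 1)) <= omega / F.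
  have -> : z (m0 - 1) = wronskian (fcoef f0) (fcoef f1) (m0 - 1) / fcoef f0 m0.
    by rewrite /z /w0 /w1 /wronskian subrK; field.
  by rewrite cabsM cabsV ler_pM2r ?invr_gt0// Wm.
have zrec : recurrence c (fun m => w0 * fcoef (res y0) m + w1 * fcoef (res y1) m) z.
  move=> m; rewrite /z.
  have -> : w0 * fcoef f0 (m + 1) + w1 * fcoef f1 (m + 1) + (w0 * fcoef f0 (m - 1) + w1 * fcoef f1 (m - 1)) =
    w0 * (fcoef f0 (m + 1) + fcoef f0 (m - 1)) + w1 * (fcoef f1 (m + 1) + fcoef f1 (m - 1)) by ring.
  by rewrite h0 h1; ring.
have zres m : cabs (w0 * fcoef (res y0) m + w1 * fcoef (res y1) m) <= 2 * (residual_const * step_error).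
  apply: (le_trans (cabsD _ _)); rewrite (cabsM w0) (cabsM w1) w11 mul1r.
  have := r0b m; have := r1b m; have := cabs_ge0 (fcoef (res y0) m); nra.
have A1 : 1 <= growth_const.
  by have := growth_bound 0; have := cabs_ge0 (c 0); lra.
have zs m : (absz m <= N)%N -> cabs (z m) <= s.
  move=> mN; apply: (two_sided_growth A1 _ zrec growth_bound zres z0 zp zm).
    by rewrite divr_ge0// ltW.
  exact: int_dist_le.
have sup := combination_sup w01 w11' zs.
exact: (combination_lower_bound w01 w11' wmax sup).
Qed.

(** The first column alone, w = (1, 0), is not small. *)
Lemma coefficient_lower_bound N F : (forall m, (absz m <= N)%N -> cabs (fcoef f0 m) <= F) ->
  1 <= symp_const * (B * ((2 * N%:R + 1) * F + 4 * B1 * t ^+ N.+1 / (1 - t) + 8 / b * step_error)).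
Proof.
move=> f0F; have w01 : cabs (1 : R[i]) <= 1 by rewrite cabs1.
have w11 : cabs (0 : R[i]) <= 1 by rewrite cabs0.
apply: (combination_lower_bound w01 w11); first by rewrite le_max cabs1 lexx.
by apply: combination_sup => // m mN; rewrite mul1r mul0r addr0 f0F.
Qed.

End Core.

(** * Comparison of the scales *)

Section CoreInequality.
Context {R : realType}.

(** The first inequality bounds the largest coefficient F from below; the second
    one is what proportionality up to an error yields.  The index m0 may belong to
    either column, and the hypotheses are symmetric in the two. *)
Theorem core_inequality (d : nat) (v : int -> R[i]) (b xi a E E0 : R) (rho phi : R -> R)
    (rho0 r B eta B1 t : R) (y0 y1 : int -> R -> R[i]) (N M : nat) :
  (0 < d)%N -> 0 < b -> (forall k, cabs (v k) <= expR (- (b * (absz k)%:R))) ->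
  0 <= xi -> xi <= b / 4 -> `|E| <= E0 -> 0 <= B -> 0 <= r -> 0 <= eta ->
  (forall x, `|rho x - rho0 - (phi (x + a) - phi x)| <= r) ->
  column d v xi a E rho B eta y0 -> column d v xi a E rho B eta y1 -> 0 <= t < 1 ->
  (forall x, exists l, rderiv (gauged phi y0) x l) ->
  (forall x, exists l, rderiv (gauged phi y1) x l) ->
  (forall x, gauged phi y0 (x + 1) = gauged phi y0 x) ->
  (forall x, gauged phi y1 (x + 1) = gauged phi y1 x) ->
  (forall m, cabs (fcoef (gauged phi y0) m) <= B1 * t ^+ absz m) ->
  (forall m, cabs (fcoef (gauged phi y1) m) <= B1 * t ^+ absz m) ->
  symp_form v d (y0 ^~ 0) (y0 ^~ 0) = 0 -> symp_form v d (y1 ^~ 0) (y1 ^~ 0) = 0 ->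
  cabs (symp_form v d (y0 ^~ 0) (y1 ^~ 0)) = 1 ->
  cabs (symp_form v d (y1 ^~ 0) (y0 ^~ 0)) = 1 ->
  (N.+1 <= M)%N ->
  exists F, [/\ 0 <= F,
    1 <= symp_const b * (B * ((2 * N%:R + 1) * F + 4 * B1 * t ^+ N.+1 / (1 - t)
                              + 8 / b * step_error r B eta)) &
    0 < F -> 1 <= symp_const b * (B * ((2 * N%:R + 1) * dependence_error b E0 r B eta B1 t N M F
                              + 4 * B1 * t ^+ N.+1 / (1 - t) + 8 / b * step_error r B eta))].
Proof.
move=> d0 b0 vb xi0 xib EE B0 r0 eta0 coh c0 c1 t01 der0 der1 per0 per1 dec0 dec1 s00 s11 s01 s10 NM.
pose h m := Num.max (cabs (fcoef (gauged phi y0) m)) (cabs (fcoef (gauged phi y1) m)).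
have [m0 m0N hm] := int_interval_argmax h N.
exists (h m0); split.
- by rewrite le_max cabs_ge0.
- apply: (@coefficient_lower_bound R d v b xi a E rho phi rho0 r B eta B1 t y0 y1) => // m mN.
  by rewrite (le_trans _ (hm m mN))// le_max lexx.
- rewrite /h.
  case: (leP (cabs (fcoef (gauged phi y0) m0)) (cabs (fcoef (gauged phi y1) m0))) => [le01|lt10] F0.
    by apply: (near_dependence d0 b0 vb xi0 xib EE B0 r0 eta0 coh c1 c0 t01 der1 der0 per1 per0
      dec1 dec0 s11 s00 s10 s01 NM m0N le01 F0).
  by apply: (near_dependence d0 b0 vb xi0 xib EE B0 r0 eta0 coh c0 c1 t01 der0 der1 per0 per1
    dec0 dec1 s00 s11 s01 s10 NM m0N (ltW lt10) F0).
Qed.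

(** Here X stands for e^(s q) and absorbs all polynomial factors and constants,
    Y for the size of the defect, Z for the decay over N steps and G for the growth
    of the recurrence over 2 N steps.  The first inequality gives
    F >= 1 / (2 X ^ 3), and the second one then fails. *)
Lemma core_numeric (Cs B B1 F T b8 st Cr wM gN X Y Z G n m : R) :
  4 <= X -> 0 <= Y -> 0 <= Z -> 1 <= G ->
  0 <= Cs <= X -> 0 <= B <= X -> 0 <= B1 <= X ^+ 2 -> 0 <= T <= X * Z -> 0 <= b8 <= X ->
  0 <= st <= X ^+ 2 * Y -> 0 <= Cr <= X -> 0 <= wM <= Y -> 0 <= gN <= G ->
  0 <= n -> 0 <= m -> 2 * (2 * n) + 1 <= X -> 2 * m <= X -> 0 <= F ->
  X ^+ 16 * G * Y <= 1 -> X ^+ 7 * Z <= 1 ->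
  1 <= Cs * (B * ((2 * n + 1) * F + 4 * B1 * T + b8 * st)) ->
  ~ (0 < F -> 1 <= Cs * (B * ((2 * n + 1) * (gN * ((2 * B1 ^+ 2 * wM + 2 * m * (2 * B * (Cr * st))) / F
      + (2 * n) * (2 * (Cr * st)))) + 4 * B1 * T + b8 * st))).
Proof.
move=> X4 Y0 Z0 G1 /andP[Cs0 CsX] /andP[B0 BX] /andP[B10 B1X] /andP[T0 TX] /andP[b80 b8X]
  /andP[st0 stX] /andP[Cr0 CrX] /andP[wM0 wMY] /andP[gN0 gNG] n0 m0 nX mX F0 sY sZ i1 i2.
have X0 : 0 <= X by lra.
have X1 : 1 <= X by lra.
have Xn k : 0 <= X ^+ k by rewrite exprn_ge0.
have Xn1 k : 1 <= X ^+ k by rewrite exprn_ege1.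
have sZ4 : X ^+ 6 * Z <= 1 / 4.
  have : X * (X ^+ 6 * Z) <= 1 by rewrite (_ : _ * _ = X ^+ 7 * Z)//; ring.
  have : 0 <= X ^+ 6 * Z by rewrite mulr_ge0.
  nra.
have GY0 : 0 <= G * Y by rewrite mulr_ge0//; lra.
have sY4 : X ^+ 15 * (G * Y) <= 1 / 4.
  have : X * (X ^+ 15 * (G * Y)) <= 1 by rewrite (_ : _ * _ = X ^+ 16 * G * Y)//; ring.
  have : 0 <= X ^+ 15 * (G * Y) by rewrite mulr_ge0.
  nra.
have YG : Y <= G * Y by rewrite ler_peMl.
have sY5 k : (k <= 15)%N -> X ^+ k * Y <= 1 / 4.
  move=> k15; apply: le_trans sY4; apply: ler_pM => //.
  by rewrite ler_weXn2l.
have tail : Cs * (B * (4 * B1 * T + b8 * st)) <= 1 / 2.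
  apply: (@le_trans _ _ (X * (X * (X * X ^+ 2 * (X * Z) + X * (X ^+ 2 * Y))))).
    apply: ler_pM => //; first by rewrite !(mulr_ge0, addr_ge0).
    apply: ler_pM => //; first by rewrite !(mulr_ge0, addr_ge0).
    apply: lerD; last exact: ler_pM.
    by apply: ler_pM; rewrite ?mulr_ge0//; exact: ler_pM.
  have -> : X * (X * (X * X ^+ 2 * (X * Z) + X * (X ^+ 2 * Y))) = X ^+ 6 * Z + X ^+ 5 * Y by ring.
  have := sY5 5%N isT; lra.
have n2X : 2 * n + 1 <= X by lra.
have bigF : 1 / 2 <= X ^+ 3 * F.
  have : Cs * (B * ((2 * n + 1) * F)) <= X * (X * (X * F)).
    apply: ler_pM => //; first by rewrite !(mulr_ge0, addr_ge0).
    apply: ler_pM => //; first by rewrite !(mulr_ge0, addr_ge0).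
    by apply: ler_pM => //; rewrite addr_ge0 ?mulr_ge0.
  have -> : X * (X * (X * F)) = X ^+ 3 * F by ring.
  have : 1 <= Cs * (B * ((2 * n + 1) * F)) + Cs * (B * (4 * B1 * T + b8 * st)).
    by apply: (le_trans i1); rewrite le_eqVlt; apply/orP; left; apply/eqP; ring.
  lra.
have Fp : 0 < F.
  rewrite lt_def F0 andbT; apply: contraTneq bigF => ->.
  by rewrite mulr0 -ltNge; lra.
have iF : F^-1 <= X ^+ 4.
  rewrite -(ler_pM2l Fp) mulfV ?gt_eqF//.
  have -> : F * X ^+ 4 = X * (X ^+ 3 * F) by ring.
  nra.
have iF0 : 0 <= F^-1 by rewrite invr_ge0.
have {i2} := i2 Fp.
set D := gN * _; move=> i2.
have Cst : 0 <= Cr * st by rewrite mulr_ge0.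
have CstX : Cr * st <= X ^+ 3 * Y.
  by rewrite [X ^+ 3]exprS -mulrA; exact: ler_pM.
have wr0 : 0 <= 2 * B1 ^+ 2 * wM + 2 * m * (2 * B * (Cr * st)).
  by rewrite addr_ge0// !mulr_ge0// exprn_ge0.
have wr : 2 * B1 ^+ 2 * wM + 2 * m * (2 * B * (Cr * st)) <= X ^+ 7 * Y.
  have p1 : 2 * B1 ^+ 2 * wM <= X ^+ 5 * Y.
    apply: ler_pM => //; first by rewrite mulr_ge0// exprn_ge0.
    rewrite [X ^+ 5]exprS; apply: ler_pM => //; [by rewrite exprn_ge0|lra|].
    have -> : X ^+ 4 = (X ^+ 2) ^+ 2 by ring.
    by rewrite ler_pXn2r// nnegrE.
  have p2 : 2 * m * (2 * B * (Cr * st)) <= X ^+ 6 * Y.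
    have -> : X ^+ 6 * Y = X * (X ^+ 2 * (X ^+ 3 * Y)) by ring.
    apply: ler_pM; rewrite ?mulr_ge0//; apply: ler_pM; rewrite ?mulr_ge0//.
    by rewrite expr2; apply: ler_pM => //; lra.
  have p3 : X ^+ 5 * Y <= X ^+ 6 * Y by rewrite ler_wpM2r// ler_weXn2l.
  have -> : X ^+ 7 * Y = X * (X ^+ 6 * Y) by ring.
  have : 0 <= X ^+ 6 * Y by rewrite mulr_ge0.
  nra.
have DX : D <= G * (X ^+ 12 * Y).
  apply: ler_pM => //.
    by rewrite addr_ge0 ?mulr_ge0.
  have q1 : (2 * B1 ^+ 2 * wM + 2 * m * (2 * B * (Cr * st))) / F <= X ^+ 11 * Y.
    have -> : X ^+ 11 * Y = X ^+ 7 * Y * X ^+ 4 by ring.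
    exact: ler_pM.
  have q2 : 2 * n * (2 * (Cr * st)) <= X ^+ 11 * Y.
    have -> : 2 * n * (2 * (Cr * st)) = 2 * (2 * n) * (Cr * st) by ring.
    apply: (@le_trans _ _ (X * (X ^+ 3 * Y))); first by apply: ler_pM; rewrite ?mulr_ge0//; lra.
    by rewrite mulrA -exprS ler_wpM2r// ler_weXn2l.
  have -> : X ^+ 12 * Y = X * (X ^+ 11 * Y) by ring.
  have : 0 <= X ^+ 11 * Y by rewrite mulr_ge0.
  nra.
have D0 : 0 <= D by rewrite mulr_ge0// addr_ge0 ?mulr_ge0.
have : Cs * (B * ((2 * n + 1) * D)) <= X * (X * (X * (G * (X ^+ 12 * Y)))).
  apply: ler_pM => //; first by rewrite !(mulr_ge0, addr_ge0).
  apply: ler_pM => //; first by rewrite !(mulr_ge0, addr_ge0).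
  by apply: ler_pM => //; rewrite addr_ge0 ?mulr_ge0.
have -> : X * (X * (X * (G * (X ^+ 12 * Y)))) = X ^+ 15 * (G * Y) by ring.
have : 1 <= Cs * (B * ((2 * n + 1) * D)) + Cs * (B * (4 * B1 * T + b8 * st)).
  by apply: (le_trans i2); rewrite le_eqVlt; apply/orP; left; apply/eqP; ring.
lra.
Qed.

(** The exponential is bounded below by (1 + s q / 2) ^ 2. *)
Lemma linear_le_exp (s C : R) : 0 < s -> 0 <= C ->
  exists Q : R, forall q : nat, Q < q%:R -> C * (q%:R + 1) <= expR (s * q%:R).
Proof.
move=> s0 C0; exists (4 * (C + 1) / s ^+ 2 + 1) => q; set x := q%:R : R => Qx.
have s2 : 0 < s ^+ 2 by rewrite exprn_gt0.
have c0 : 0 <= 4 * (C + 1) / s ^+ 2 by rewrite divr_ge0 ?(ltW s2)// mulr_ge0// addr_ge0.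
have x1 : 1 < x by lra.
have e : expR (s * x) = expR (s * x / 2) * expR (s * x / 2) by rewrite -expRD; congr expR; field.
have h : 1 + s * x / 2 <= expR (s * x / 2) := expR_ge1Dx _.
have sx : 0 < s * x by apply: mulr_gt0 => //; lra.
have : 4 * (C + 1) <= s ^+ 2 * (x - 1).
  by rewrite -ler_pdivrMl// mulrC; lra.
rewrite e => k.
apply: (@le_trans _ _ ((1 + s * x / 2) * (1 + s * x / 2))); last by apply: ler_pM => //; lra.
have k2 : 4 * (C + 1) * x <= s ^+ 2 * (x - 1) * x by rewrite ler_wpM2r//; lra.
rewrite expr2 in k2; nra.
Qed.

End CoreInequality.

(** * Pointwise content of the norms *)

Section NormBounds.
Context {R : realType}.
Implicit Types (eps xi M : R) (d : nat) (z : R[i]).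

Lemma strip_real eps x : 0 < eps -> strip eps (x%:C : R[i]).
Proof. by move=> e0; rewrite /strip /= normr0. Qed.

Lemma strip_sup_le eps (g : R[i] -> R) M z : (strip_sup eps g <= M%:E)%E -> strip eps z -> g z <= M.
Proof.
move=> gM zs; rewrite -lee_fin; apply: le_trans gM.
by apply: ereal_sup_ubound; exists z.
Qed.

Lemma strip_sup_ge0 eps (g : R[i] -> R) : 0 < eps -> (forall z, 0 <= g z) -> (0 <= strip_sup eps g)%E.
Proof.
move=> e0 g0; apply: (@le_trans _ _ (g 0)%:E); first by rewrite lee_fin.
by apply: ereal_sup_ubound; exists 0 => //; rewrite /strip /= normr0.
Qed.

Lemma cabs_le_row_l2 m n (A : 'M[R[i]]_(m, n)) i j : cabs (A i j) <= row_l2 A i.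
Proof.
rewrite -[leLHS]ger0_norm ?cabs_ge0// -sqrtr_sqr ler_sqrt; last first.
  by apply: sumr_ge0 => k _; rewrite sqr_ge0.
rewrite (bigD1 j)//= lerDl; apply: sumr_ge0 => k _; exact: sqr_ge0.
Qed.

Lemma weighted_norm_le xi eps d n (F : R[i] -> 'M[R[i]]_(d + d, n)) M i j z : 0 < eps ->
  (weighted_norm xi eps F <= M%:E)%E -> strip eps z ->
  cabs (F z i j) <= M * expR (xi * (absz (comp_index i))%:R).
Proof.
move=> e0 FM zs; apply: (le_trans (cabs_le_row_l2 _ _ _)).
pose T (i : 'I_(d + d)) := ((expR (- xi * (absz (comp_index i))%:R))%:E
     * strip_sup eps (fun z => row_l2 (F z) i))%E.
have T0 k : (0 <= T k)%E.
  apply: mule_ge0; first by rewrite lee_fin expR_ge0.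
  by apply: strip_sup_ge0 => // w; exact: sqrtr_ge0.
have : (T i <= M%:E)%E.
  apply: le_trans FM; rewrite /weighted_norm (bigD1 i)//= leeDl//.
  by apply: sume_ge0 => k _; exact: T0.
move=> TM; have : ((expR (- xi * (absz (comp_index i))%:R) * row_l2 (F z) i)%:E <= M%:E)%E.
  apply: le_trans TM; rewrite EFinM; apply: lee_wpmul2l; first by rewrite lee_fin expR_ge0.
  by apply: ereal_sup_ubound; exists z.
by rewrite lee_fin mulNr expRN mulrC ler_pdivrMr ?expR_gt0.
Qed.

Lemma Comega_holo eps f : Comega eps f -> @holo R eps f.
Proof.
move=> [_ df _] z /df /derivable_expansion[l [_ H]]; exists l => e e0.
have eC : 0 < e%:C :> R[i] by rewrite ltcR.
have [r r0 Hr] := H _ eC.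
have rE : r = (complex.Re r)%:C.
  by rewrite RRe_real// realE ltW.
exists (complex.Re r); first by rewrite -ltcR -rE.
move=> w wr; rewrite -lecR rmorphM -!cabsE; apply: Hr.
by rewrite cabsE rE ltcR.
Qed.

Lemma Comega_periodic eps (f : R[i] -> R[i]) : Comega eps f -> strip_periodic eps f.
Proof. by case. Qed.

(** The component of index k sits in row d - 1 - k; the value 0 is a default
    outside of the range of indices. *)
Definition entry d n (A : 'M[R[i]]_(d + d, n)) (j : 'I_n) (k : int) : R[i] :=
  if insub (absz (d%:Z - 1 - k)%R) is Some i then A i j else 0.

End NormBounds.

(** * Rows of the transfer matrix and of the symplectic matrix *)

Lemma comp_index_inv (d i : nat) : absz (d%:Z - 1 - (d%:Z - 1 - i%:Z))%R = i.
Proof. lia. Qed.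
Lemma comp_index_surj (d : nat) (k : int) : - d%:Z <= k -> k < d%:Z ->
  exists2 n : nat, (n < d + d)%N & d%:Z - 1 - n%:Z = k.
Proof. by move=> h1 h2; exists (absz (d%:Z - 1 - k)%R); lia. Qed.
Lemma comp_index_pred (d : nat) (i l : nat) : i = l.+1 ->
  d%:Z - 1 - l%:Z = d%:Z - 1 - i%:Z + 1.
Proof. lia. Qed.
Lemma rev_comp (d i : nat) : (i < d)%N -> d%:Z - 1 - (d - i.+1)%N%:Z = i%:Z.
Proof. lia. Qed.
Lemma low_comp (d i : nat) : d%:Z - 1 - (d + i)%N%:Z = - i.+1%:Z.
Proof. lia. Qed.
Lemma rev_neg (d i : nat) : (i < d)%N -> (d - i.+1)%N%:Z - d%:Z = - i.+1%:Z.
Proof. lia. Qed.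
Lemma shift_pos (d i : nat) : (d + i)%N%:Z - d%:Z = i%:Z.
Proof. lia. Qed.

Lemma trunc_le (d p q : nat) : (d%:Z - 1 - q%:Z + p.+1%:Z <= d%:Z) = (p <= q)%N.
Proof. lia. Qed.
Lemma trunc_eq (d p q : nat) : d%:Z - (q%:Z - p%:Z) = d%:Z - 1 - q%:Z + p.+1%:Z.
Proof. lia. Qed.

Section Rows.
Context {R : realType}.
Implicit Types (d : nat) (G v : int -> R[i]) (z : R[i]).

Lemma entryE d n (A : 'M[R[i]]_(d + d, n)) j (i : 'I_(d + d)) : entry A j (comp_index i) = A i j.
Proof. by rewrite /entry /comp_index comp_index_inv valK. Qed.

Lemma exists_row d k : - d%:Z <= k -> k < d%:Z -> exists i : 'I_(d + d), comp_index i = k.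
Proof. by move=> h1 h2; have [n nd E] := comp_index_surj h1 h2; exists (Ordinal nd). Qed.

Lemma sum_nonneg_ssum G d :
  \sum_(i < d) G i%:Z + G d%:Z = G 0 + \sum_(i < d) G i.+1%:Z.
Proof.
by rewrite -(big_ord_recr d (fun i : 'I_d.+1 => G i%:Z)) big_ord_recl.
Qed.

(** The rows give the indices from d - 1 down to - d; the term of index d completes
    the symmetric sum. *)
Lemma sum_rows_ssum G d : \sum_(i < d + d) G (comp_index i) + G d%:Z = ssum G d.
Proof.
rewrite big_split_ord /= (reindex_inj rev_ord_inj) /= addrAC.
rewrite (eq_bigr (fun i : 'I_d => G i%:Z)); last first.
  by move=> i _; rewrite /comp_index /= rev_comp.
rewrite sum_nonneg_ssum -addrA -big_split /=; congr (_ + _).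
by apply: eq_bigr => i _; rewrite /comp_index /= low_comp.
Qed.

Lemma sum_window_ssum G d : \sum_(j < d.*2.+1) G (j%:Z - d%:Z) = ssum G d.
Proof.
rewrite -addnn -addnS big_split_ord /= (reindex_inj rev_ord_inj) /= big_ord_recl addrC.
rewrite shift_pos -addrA -big_split /=; congr (_ + _); apply: eq_bigr => i _.
by rewrite shift_pos /= rev_neg.
Qed.

Lemma transfer_row_shift v d E z n (A : 'M[R[i]]_(d + d, n)) (i : 'I_(d + d)) j :
  (i : nat) != 0%N -> (transfer_mx v d E z *m A) i j = entry A j (comp_index i + 1).
Proof.
case: i => -[//|l] li _; have ld : (l < d + d)%N by exact: ltnW.
have -> : comp_index (Ordinal li) + 1 = comp_index (Ordinal ld).
  by rewrite /comp_index /= (@comp_index_pred d l.+1 l).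
rewrite entryE mxE (bigD1 (Ordinal ld))//= mxE /= eqxx mul1r big1 ?addr0// => k kl.
rewrite mxE /= eqSS; case: eqP => [E1|]; last by rewrite mul0r.
by move: kl; rewrite -(inj_eq val_inj) /= -E1 eqxx.
Qed.

Lemma transfer_row_first v d E z n (A : 'M[R[i]]_(d + d, n)) (i : 'I_(d + d)) j :
  (i : nat) = 0%N -> (0 < d)%N -> v d%:Z != 0 ->
  v d%:Z * (transfer_mx v d E z *m A) i j =
  (E%:C - (e2pi z + e2pi (- z))) * entry A j 0
  - \sum_(l < d + d) v (comp_index l) * entry A j (comp_index l).
Proof.
move=> i0 d0 vd; rewrite mxE mulr_sumr.
have dd : (d.-1 < d + d)%N by rewrite prednK ?leq_addr// (leq_trans _ (leq_addr _ _))// ltn_predL.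
have c0 : comp_index (Ordinal dd) = 0.
  by rewrite /comp_index /= -[in d%:Z](prednK d0) -addn1 PoszD addrK subrr.
rewrite -c0 entryE.
have -> : (E%:C - (e2pi z + e2pi (- z))) * A (Ordinal dd) j =
   \sum_(l < d + d) (if l.+1 == d :> nat then E%:C - (e2pi z + e2pi (- z)) else 0) * A l j.
  rewrite (bigD1 (Ordinal dd))//= prednK// eqxx big1 ?addr0// => l ld.
  case: eqP => [E1|]; last by rewrite mul0r.
  by exfalso; move/eqP: ld; apply; apply: val_inj; exact: (congr1 predn E1).
rewrite -sumrB; apply: eq_bigr => l _.
rewrite mxE i0 eqxx entryE mulrA mulrCA mulfV// mulr1 mulrBl.
by [].
Qed.

(** The matrix C_d stops at the coefficient of index d, whereas the form on columns
    uses v at all sums of indices; the truncated sequence reconciles the two. *)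
Definition truncate v d (k : int) : R[i] := if (k <= d%:Z) then v k else 0.

(** The product of blocks is B^* C A - A^* C^* B, where A and B hold the components
    of nonnegative and of negative index. *)
Lemma symplectic_entry v d (A : 'M[R[i]]_(d + d, 2)) (i j : 'I_2) :
  (adjmx A *m S_mx v d *m A) i j = symp_form (truncate v d) d (entry A i) (entry A j).
Proof.
pose Au := usubmx A; pose Ad := dsubmx A.
have adjE : adjmx A = row_mx (adjmx Au) (adjmx Ad).
  by rewrite -[in LHS](vsubmxK A) /adjmx map_col_mx tr_col_mx.
have -> : adjmx A *m S_mx v d *m A =
    adjmx Ad *m C_mx v d *m Au - adjmx Au *m adjmx (C_mx v d) *m Ad.
  rewrite adjE -[in LHS](vsubmxK A) /S_mx mul_row_block !mulmx0 add0r addr0.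
  by rewrite mul_row_col mulmxN mulNmx.
have entry_up (q : 'I_d) k : entry A k (d%:Z - 1 - q%:Z) = Au q k.
  by rewrite mxE -(entryE A k (lshift d q)).
have entry_dn (p : 'I_d) k : entry A k (- p.+1%:Z) = Ad p k.
  by rewrite mxE -(entryE A k (rshift d p)) /comp_index /= low_comp.
have CE (p q : 'I_d) : C_mx v d p q = truncate v d (d%:Z - 1 - q%:Z + p.+1%:Z).
  by rewrite mxE /truncate trunc_le; case: ifP => // _; congr v; exact: trunc_eq.
have conjE (w : R[i]) : Num.conj w = w^*%C by [].
rewrite mxE [X in _ + X]mxE /symp_form.
have -> : (adjmx Ad *m C_mx v d *m Au) i j =
    \sum_(l < d) \sum_(q < d) ((entry A i (- l.+1%:Z))^*%C * truncate v d (d%:Z - 1 - q%:Z + l.+1%:Z)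
       * entry A j (d%:Z - 1 - q%:Z)).
  rewrite mxE exchange_big /=; apply: eq_bigr => q _.
  rewrite mxE mulr_suml; apply: eq_bigr => l _.
  by rewrite entry_dn entry_up -CE /adjmx !mxE conjE.
have -> : (adjmx Au *m adjmx (C_mx v d) *m Ad) i j =
    \sum_(l < d) \sum_(q < d) ((entry A i (d%:Z - 1 - q%:Z))^*%C
       * (truncate v d (d%:Z - 1 - q%:Z + l.+1%:Z))^*%C * entry A j (- l.+1%:Z)).
  rewrite mxE; apply: eq_bigr => l _.
  rewrite mxE mulr_suml; apply: eq_bigr => q _.
  rewrite entry_dn entry_up -CE; congr (_ * _ * _).
    by rewrite /adjmx !mxE conjE.
  by rewrite /adjmx 2!mxE conjE.
rewrite -sumrB; apply: eq_bigr => l _.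
rewrite -sumrB (reindex_inj rev_ord_inj) /=; apply: eq_bigr => q _.
by rewrite rev_comp.
Qed.

End Rows.

(** * The columns of an almost conjugacy *)

Lemma abs_range (d : nat) (k : int) : (absz k <= d)%N -> k != d%:Z -> - d%:Z <= k /\ k < d%:Z.
Proof. lia. Qed.
Lemma abs_range_top (d : nat) : (0 < d)%N -> - d%:Z <= d%:Z - 1 /\ d%:Z - 1 < d%:Z.
Proof. lia. Qed.
Lemma abs_pred (d : nat) : (0 < d)%N -> (absz (d%:Z - 1)%R <= d)%N.
Proof. lia. Qed.
Lemma lt_neq_int (k d : int) : k < d -> k != d.
Proof. lia. Qed.

Lemma comp_index_lt (d : nat) (l : 'I_(d + d)) : comp_index l < d%:Z.
Proof. by rewrite /comp_index; lia. Qed.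

Section ColumnOfConjugacy.
Context {R : realType}.
Variables (xi eps K : R) (v : int -> R[i]) (d : nat) (E a err bnd b : R).
Variables (rho : R[i] -> R[i]) (U : R[i] -> 'M[R[i]]_(d + d, 2)).
Hypothesis eps0 : 0 < eps.
Hypothesis b0 : 0 < b.
Hypothesis vb : forall k, cabs (v k) <= expR (- (b * (absz k)%:R)).
Hypothesis xi0 : 0 <= xi.
Hypothesis xib : xi <= b.
Hypothesis d0 : (0 < d)%N.
Hypothesis vd : v d%:Z != 0.
Hypothesis err0 : 0 <= err.
Hypothesis bnd0 : 0 <= bnd.
Hypothesis ac : almost_conjugates xi eps K v E a err bnd rho U.

Definition real_rho (x : R) : R := complex.Re (rho x%:C).

Lemma real_rhoE x : (real_rho x)%:C = rho x%:C.
Proof.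
have [[[_ rr] _] _ _ _] := ac.
by rewrite /real_rho [RHS]complex_split rr rmorph0 mulr0 addr0.
Qed.

(** The component of index d is obtained from the one of index d - 1 by the
    translation, so that the step to it has no defect. *)
Definition col_of (j : 'I_2) (k : int) (x : R) : R[i] :=
  if k == d%:Z then entry (U (x + a)%:C) j (d%:Z - 1) * e2pi (rho x%:C)
  else entry (U x%:C) j k.

Lemma col_ofE j k x : k < d%:Z -> col_of j k x = entry (U x%:C) j k.
Proof. by move=> /lt_neq_int /negbTE kd; rewrite /col_of kd. Qed.

Lemma entry_bound j k (x : R) : - d%:Z <= k -> k < d%:Z ->
  cabs (entry (U x%:C) j k) <= bnd * expR (xi * (absz k)%:R).
Proof.
move=> k1 k2; have [_ _ _ bd] := ac.
have [i <-] := exists_row k1 k2; rewrite entryE.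
exact: (weighted_norm_le _ _ eps0 bd (strip_real x eps0)).
Qed.

Lemma defect_entry j (i : 'I_(d + d)) (x : R) :
  cabs ((transfer_mx v d E x%:C *m U x%:C) i j
        - entry (U (x + a)%:C) j (comp_index i) * e2pi (rho x%:C))
  <= err * expR (xi * (absz (comp_index i))%:R).
Proof.
have [_ _ df _] := ac.
have := weighted_norm_le i j eps0 df (strip_real x eps0).
rewrite /conj_defect mxE [X in cabs (_ + X)]mxE mul_mx_scalar [X in cabs (_ - X)]mxE.
by rewrite -rmorphD entryE [e2pi (rho _) * _]mulrC.
Qed.

(** The defect of the first row is multiplied by v d, whose decay compensates the
    weight exp (xi d). *)
Lemma column_of_conjugacy j : column d (truncate v d) xi a E real_rho bnd err (col_of j).
Proof.
have [t1 t2] := abs_range_top d0.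
split.
- move=> k x kd; rewrite /col_of; case: eqP => [kE|/eqP kd'].
    rewrite cabsM cabs_e2pi_real ?mulr1; last by rewrite -real_rhoE.
    apply: (le_trans (entry_bound j (x + a) t1 t2)).
    rewrite ler_wpM2l// ler_expR ler_wpM2l// ler_nat kE absz_nat; exact: abs_pred.
  by have [k1 k2] := abs_range kd kd'; exact: entry_bound.
- move=> k x k1 k2; rewrite (col_ofE _ _ k2) real_rhoE.
  have r0 : 0 <= err * expR (xi * (absz k)%:R) by rewrite mulr_ge0 ?expR_ge0.
  rewrite /col_of; case: eqP => [kE|/eqP kd].
    have -> : d%:Z - 1 = k by rewrite -kE addrK.
    by rewrite subrr cabs0.
  have [i ik] := exists_row k1 k2.
  have i0 : (i : nat) != 0%N.
    apply: contra kd => /eqP i0; rewrite -ik /comp_index i0 subr0 subrK.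
    by [].
  by have := defect_entry j i x; rewrite (transfer_row_shift v E _ _ j i0) ik.
- move=> x.
  have dd : (0 < d + d)%N by rewrite addn_gt0 d0.
  have := defect_entry j (Ordinal dd) x.
  have -> : comp_index (Ordinal dd) = d%:Z - 1 by rewrite /comp_index /= subr0.
  set T := (transfer_mx _ _ _ _ *m _) _ _ => H.
  have TE : v d%:Z * T = (E%:C - (e2pi x%:C + e2pi (- x%:C))) * entry (U x%:C) j 0
       - \sum_(l < d + d) v (comp_index l) * entry (U x%:C) j (comp_index l).
    exact: transfer_row_first.
  pose G k := truncate v d k * col_of j k x.
  have GE : \sum_(l < d + d) v (comp_index l) * entry (U x%:C) j (comp_index l) =
            \sum_(l < d + d) G (comp_index l).
    apply: eq_bigr => l _; have l1 := comp_index_lt l.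
    by rewrite /G /truncate (ltW l1) col_ofE.
  have Gd : G d%:Z = v d%:Z * (entry (U (x + a)%:C) j (d%:Z - 1) * e2pi (rho x%:C)).
    by rewrite /G /truncate lexx /col_of eqxx.
  have -> : ssum (fun k => truncate v d k * col_of j k x) d =
     \sum_(l < d + d) v (comp_index l) * entry (U x%:C) j (comp_index l)
     + v d%:Z * (entry (U (x + a)%:C) j (d%:Z - 1) * e2pi (rho x%:C)).
    by rewrite GE -Gd (sum_rows_ssum G).
  rewrite col_ofE; last by rewrite ltz_nat.
  have -> : \sum_(l < d + d) v (comp_index l) * entry (U x%:C) j (comp_index l)
     = (E%:C - (e2pi x%:C + e2pi (- x%:C))) * entry (U x%:C) j 0 - v d%:Z * T.
    by rewrite TE opprB addrC subrK.
  have -> : (E%:C - (e2pi x%:C + e2pi (- x%:C))) * entry (U x%:C) j 0 - v d%:Z * T +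
     v d%:Z * (entry (U (x + a)%:C) j (d%:Z - 1) * e2pi (rho x%:C)) +
     (e2pi x%:C + e2pi (- x%:C) - E%:C) * entry (U x%:C) j 0 =
     - (v d%:Z * (T - entry (U (x + a)%:C) j (d%:Z - 1) * e2pi (rho x%:C))) by ring.
  rewrite cabsN cabsM.
  apply: (@le_trans _ _ (expR (- (b * d%:R)) * (err * expR (xi * d%:R)))).
    have vdb := vb d%:Z; rewrite absz_nat in vdb.
    apply: ler_pM => //; [exact: cabs_ge0|exact: cabs_ge0|].
    apply: (le_trans H); rewrite ler_wpM2l// ler_expR ler_wpM2l// ler_nat; exact: abs_pred.
  rewrite mulrCA -expRD ler_piMr// -[leRHS]expR0 ler_expR.
  have := ler_wpM2r (ler0n R d) xib; lra.
Qed.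

Lemma col_of_symplectic i j :
  symp_form (truncate v d) d (col_of i ^~ 0) (col_of j ^~ 0) = J2 R i j.
Proof.
have [_ [_ hs] _ _] := ac.
rewrite -(hs 0) symplectic_entry; apply: eq_bigr => l _; apply: eq_bigr => k _.
have [k1 k2] := int_range_pos (ltn_ord k); have [l1 l2] := int_range_neg (ltn_ord l).
by rewrite !col_ofE.
Qed.

Lemma truncate_bound k : cabs (truncate v d k) <= expR (- (b * (absz k)%:R)).
Proof. by rewrite /truncate; case: ifP => // _; rewrite cabs0 expR_ge0. Qed.

End ColumnOfConjugacy.

(** * Choice of the constants *)

Section Final.
Context {R : realType}.
Implicit Types (v : int -> R[i]) (b eps x E : R) (d q : nat).

Lemma trig_trunc_bound v b d x : 0 < b ->
  (forall k, cabs (v k) <= expR (- (b * (absz k)%:R))) -> cabs (trig_trunc v d x) <= trig_bound b.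
Proof.
move=> b0 vb; rewrite /trig_trunc (sum_window_ssum (fun k => v k * e2pi ((k%:~R * x)%:C)) d).
apply: decaying_ssum_bound => // k kd.
by rewrite cabsM cabs_e2pi_real// mulr1.
Qed.

Lemma energy_bound v b d E : 0 < b ->
  (forall k, cabs (v k) <= expR (- (b * (absz k)%:R))) ->
  - 3 - inf (range (fun x : R => cabs (trig_trunc v d x))) <= E ->
  E <= 3 + sup (range (fun x : R => cabs (trig_trunc v d x))) ->
  `|E| <= 3 + trig_bound b.
Proof.
move=> b0 vb lo hi; pose S := range (fun x : R => cabs (trig_trunc v d x)).
rewrite -/S in lo hi.
have tb x : cabs (trig_trunc v d x) <= trig_bound b by exact: trig_trunc_bound.
have S0 : S (cabs (trig_trunc v d 0)) by exists 0.
have h1 : sup S <= trig_bound b.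
  by apply: sup_le_ub; [exists (cabs (trig_trunc v d 0))|move=> _ [x _ <-]].
have h2 : inf S <= trig_bound b.
  apply: le_trans (tb 0); apply: ge_inf => //.
  by exists 0 => _ [x _ <-]; exact: cabs_ge0.
by rewrite ler_norml; apply/andP; split; lra.
Qed.

(** The exponents of q %/ J and of its successor lie on the two sides of q / J. *)
Lemma floor_exponents (J q : nat) (A w : R) : (0 < J)%N -> 1 <= A -> 0 <= w ->
  A ^+ (2 * (q %/ J)) <= expR (2 * ln A / J%:R * q%:R) /\
  expR (- w) ^+ (q %/ J).+1 <= expR (- (w / J%:R * q%:R)).
Proof.
move=> J0 A1 w0; have JR : 0 < J%:R :> R by rewrite ltr0n.
have A0 : 0 < A by lra.
have lA : 0 <= ln A by rewrite ln_ge0.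
have f1 : (q %/ J)%:R * J%:R <= q%:R :> R by rewrite -natrM ler_nat leq_trunc_div.
have f2 : q%:R <= (q %/ J).+1%:R * J%:R :> R by rewrite -natrM ler_nat ltnW// ltn_ceil.
split.
  rewrite -{1}(lnK (x := A)) ?posrE// -expRM_natr ler_expR natrM.
  rewrite -(ler_pM2r JR) [X in _ <= X](_ : _ = 2 * ln A * q%:R); last by field; rewrite gt_eqF.
  have -> : ln A * (2 * (q %/ J)%:R) * J%:R = 2 * ln A * ((q %/ J)%:R * J%:R) by ring.
  by rewrite ler_wpM2l// mulr_ge0.
rewrite -expRM_natr ler_expR mulNr lerN2 -(ler_pM2r JR).
have -> : w / J%:R * q%:R * J%:R = w * q%:R by field; rewrite gt_eqF.
by rewrite -mulrA ler_wpM2l.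
Qed.

Definition constant_sum b Cg w : R := 4 + symp_const b + 8 / b + residual_const b
  + 1 / (1 - expR (- w)) + (1 + 2 * pi * Cg).

Lemma symp_const_ge0 b : 0 < b -> 0 <= symp_const b.
Proof.
move=> b0; have [h0 h1] := andP (exp_half_lt1 b0).
by rewrite divr_ge0// mulr_ge0 ?expR_ge0// exprn_ge0// subr_ge0 ltW.
Qed.

Lemma residual_const_ge0 b : 0 < b -> 0 <= residual_const b.
Proof.
move=> b0; have [h0 h1] := andP (exp_half_lt1 b0).
rewrite addr_ge0// divr_ge0//; last by rewrite subr_ge0 ltW.
by rewrite mulr_ge0// divr_ge0// ltW.
Qed.

Lemma growth_const_ge1 b E0 : 0 < b -> 0 <= E0 -> 1 <= growth_const b E0.
Proof.
move=> b0 E00; have := trig_bound_ge1 b0.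
by rewrite /growth_const; lra.
Qed.

(** With X = e^(s q), Y = e^(- c1 q), G = e^(c1 q / 2) and Z = e^(- w q / J), the
    smallness needed is 16 s <= c1 / 2 and 7 s <= w / J.  The number J makes the
    growth over 2 q / J steps at most e^(c1 q / 2). *)
Lemma scale_contradiction b E0 (c c1 w s Cg : R) (J q : nat) :
  0 < b -> 0 <= E0 -> 0 < c1 -> c1 <= c -> c1 <= w -> (0 < J)%N ->
  4 * ln (growth_const b E0) / c1 <= J%:R ->
  0 < s -> s <= c1 / 32 -> s <= w / J%:R / 7 -> 0 <= Cg ->
  constant_sum b Cg w * (q%:R + 1) <= expR (s * q%:R) ->
  let X := expR (s * q%:R) in let eta := expR ((- c + s) * q%:R) in
  let r := Cg * expR (- (w * q%:R)) in let t := expR (- w) in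
  let N := (q %/ J)%N in let M := q.+1 in
  ~ exists F, [/\ 0 <= F,
    1 <= symp_const b * (X * ((2 * N%:R + 1) * F + 4 * X ^+ 2 * t ^+ N.+1 / (1 - t)
                              + 8 / b * step_error r X eta)) &
    0 < F -> 1 <= symp_const b * (X * ((2 * N%:R + 1) * dependence_error b E0 r X eta (X ^+ 2) t N M F
                              + 4 * X ^+ 2 * t ^+ N.+1 / (1 - t) + 8 / b * step_error r X eta))].
Proof.
move=> b0 E00 c10 c1c c1w J0 JA s0 s1 s2 Cg0 XB X eta r t N M [F [F0 I1 I2]].
have pi0 := pi_gt0 R.
have w0 : 0 < w by exact: lt_le_trans c1w.
have JR : 0 < J%:R :> R by rewrite ltr0n.
have A1 := growth_const_ge1 b0 E00.
have t0 : 0 < t by exact: expR_gt0.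
have t1 : t < 1 by rewrite -[ltRHS]expR0 ltr_expR oppr_lt0.
have sc0 := symp_const_ge0 b0; have rc0 := residual_const_ge0 b0.
have b80 : 0 <= 8 / b by rewrite divr_ge0// ltW.
have it0 : 0 <= 1 / (1 - t) by rewrite divr_ge0// subr_ge0 ltW.
have pc0 : 0 <= 2 * pi * Cg by rewrite mulr_ge0// mulr_ge0// ltW.
have qR0 : 0 <= q%:R :> R by [].
have X0 : 0 <= X by exact: expR_ge0.
have CE : constant_sum b Cg w = 4 + symp_const b + 8 / b + residual_const b + 1 / (1 - t) + (1 + 2 * pi * Cg) by [].
have Call4 : 4 <= constant_sum b Cg w by rewrite CE; clear -sc0 rc0 b80 it0 pc0; lra.
have constX C : C <= constant_sum b Cg w -> C <= X.
  move=> CC; apply: le_trans XB; rewrite (le_trans CC)// ler_peMr ?lerDr//.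
  by rewrite (le_trans _ Call4).
have X4 : 4 * (q%:R + 1) <= X by apply: le_trans XB; rewrite ler_wpM2r// addr_ge0.
have [gr tail] := floor_exponents q J0 A1 (ltW w0).
pose Y := expR (- (c1 * q%:R)).
pose Z := expR (- (w / J%:R * q%:R)).
pose G := expR (c1 / 2 * q%:R).
have NR : N%:R <= q%:R :> R by rewrite ler_nat leq_div.
have MR : M%:R = q%:R + 1 :> R by rewrite /M -natr1.
have T4 : 4 * X ^+ 2 * t ^+ N.+1 / (1 - t) = 4 * X ^+ 2 * (t ^+ N.+1 / (1 - t)) by rewrite mulrA.
rewrite T4 in I1 I2; rewrite /dependence_error /wronskian_error natrM in I2.
have n0 : 0 <= N%:R :> R by [].
have m0 : 0 <= M%:R :> R by [].
have k1 : 4 <= X by apply: constX.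
have k2 : 1 <= G by rewrite -[leLHS]expR0 ler_expR mulr_ge0// divr_ge0// ltW.
have k3 : 0 <= symp_const b <= X.
  by rewrite sc0 constX// CE; clear -sc0 rc0 b80 it0 pc0; lra.
have k4 : 0 <= t ^+ N.+1 / (1 - t) <= X * Z.
  rewrite divr_ge0 ?exprn_ge0 ?subr_ge0 ?(ltW t0) ?(ltW t1)//= mulrC.
  apply: ler_pM; rewrite ?invr_ge0 ?subr_ge0 ?(ltW t1) ?exprn_ge0 ?(ltW t0)//.
  by rewrite -div1r constX// CE; clear -sc0 rc0 b80 it0 pc0; lra.
have k5 : 0 <= 8 / b <= X by rewrite b80 constX// CE; clear -sc0 rc0 b80 it0 pc0; lra.
have k6 : 0 <= step_error r X eta <= X ^+ 2 * Y.
  have r0 : 0 <= r by rewrite mulr_ge0// expR_ge0.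
  have e0 : 0 <= step_error r X eta.
    by rewrite addr_ge0 ?expR_ge0// mulr_ge0// mulr_ge0// mulr_ge0// ltW.
  rewrite e0 /step_error /=.
  have e1 : eta <= X * Y.
    by rewrite /X /Y -expRD ler_expR; have := ler_wpM2r qR0 c1c; clear; lra.
  have e2 : expR (- (w * q%:R)) <= Y.
    by rewrite ler_expR lerN2 ler_wpM2r.
  have e3 : 2 * pi * X * r <= 2 * pi * Cg * (X * Y).
    have -> : 2 * pi * X * r = 2 * pi * Cg * (X * expR (- (w * q%:R))) by rewrite /r; ring.
    by rewrite ler_wpM2l// ler_wpM2l.
  have e4 : 1 + 2 * pi * Cg <= X.
    by apply: constX; rewrite CE; clear -sc0 rc0 b80 it0 pc0; lra.
  have XY0 : 0 <= X * Y by rewrite mulr_ge0// expR_ge0.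
  have e5 := ler_wpM2r XY0 e4.
  have -> : X ^+ 2 * Y = X * (X * Y) by ring.
  move: (X * (X * Y)) (X * Y) (2 * pi * X * r) e1 e3 e5 => u1 u2 u3; clear; lra.
have k7 : 0 <= residual_const b <= X.
  by rewrite rc0 constX// CE; clear -sc0 rc0 b80 it0 pc0; lra.
have k8 : 0 <= t ^+ M <= Y.
  rewrite exprn_ge0 ?(ltW t0)//= /t -expRM_natr ler_expR mulNr lerN2 MR.
  by have := ler_wpM2r qR0 c1w; clear -w0; lra.
have k9 : 0 <= growth_const b E0 ^+ (2 * N) <= G.
  rewrite exprn_ge0 /=; last by rewrite (le_trans _ A1).
  apply: (le_trans gr); rewrite ler_expR ler_wpM2r//.
  rewrite ler_pdivrMr//; move: JA; rewrite ler_pdivrMr//; clear; lra.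
have k10 : 2 * (2 * N%:R) + 1 <= X by clear -X4 NR; lra.
have k11 : 2 * M%:R <= X by rewrite MR; clear -X4 qR0; lra.
have k12 : X ^+ 16 * G * Y <= 1.
  rewrite /X /G /Y -expRM_natr -!expRD -[leRHS]expR0 ler_expR.
  by have := ler_wpM2r qR0 s1; clear; lra.
have k13 : X ^+ 7 * Z <= 1.
  rewrite /X /Z -expRM_natr -!expRD -[leRHS]expR0 ler_expR.
  have := ler_wpM2r qR0 s2; move: (w / J%:R) => wJ; clear; lra.
have kX : 0 <= X <= X by rewrite X0 lexx.
have kX2 : 0 <= X ^+ 2 <= X ^+ 2 by rewrite exprn_ge0//= lexx.
exact: (core_numeric k1 (expR_ge0 _) (expR_ge0 _) k2 k3 kX kX2 k4 k5 k6 k7 k8 k9 n0 m0 k10 k11 F0 k12 k13 I1 I2).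
Qed.

(** The threshold on q is uniform in d, E, a, rho and U.  The gauge is taken with
    tau = s / (2 pi), so that e(phi) is at most e^(s q) on the strip of half-width
    eps / 4, and the coefficients decay like e^(- w |m|) with
    w = 2 pi (eps / 8). *)
Lemma no_conjugacy_near (alpha eps c K xi : R) v :
  not_fraction alpha -> 0 < eps -> 0 < c -> 0 < K -> 0 < xi -> xi <= 1 / 4 * (2 * pi * eps) ->
  (forall k, cabs (v k) <= expR (- (2 * pi * eps * (absz k)%:R))) ->
  exists delta Q : R, [/\ 0 < delta, 0 < Q &
    forall (q : nat) (p : int) (a : R), Q < q%:R -> coprime (absz p) q ->
      `|a * q%:R - p%:~R| * q%:R <= 1 -> `|a - alpha| * q%:R <= 2 ->
      forall (d : nat) (E : R), (1 <= d)%N -> v d%:Z != 0 -> `|E| <= 3 + trig_bound (2 * pi * eps) ->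
      ~ exists (rho : R[i] -> R[i]) (U : R[i] -> 'M[R[i]]_(d + d, 2)),
        almost_conjugates xi eps K v E a (expR ((- c + delta) * q%:R)) (expR (delta * q%:R)) rho U].
Proof.
move=> na eps0 c0 K0 xi0 xib vb; have pi0 := pi_gt0 R.
pose b := 2 * pi * eps; have b0 : 0 < b by rewrite !mulr_gt0.
have xib' : xi <= b / 4 by rewrite /b; lra.
have xib1 : xi <= b by lra.
pose w := pi * eps / 4; have w0 : 0 < w by rewrite divr_gt0// mulr_gt0.
pose t := expR (- w).
have t0 : 0 < t by exact: expR_gt0.
have t1 : t < 1 by rewrite -[ltRHS]expR0 ltr_expR oppr_lt0.
pose c1 := Num.min c w; have c10 : 0 < c1 by rewrite lt_min c0.
have c1c : c1 <= c by rewrite ge_min lexx.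
have c1w : c1 <= w by rewrite ge_min lexx orbT.
pose E0 := 3 + trig_bound b.
have E00 : 0 <= E0 by rewrite addr_ge0// (le_trans _ (trig_bound_ge1 b0)).
pose A := growth_const b E0.
pose J := (Num.truncn (4 * ln A / c1)).+1.
have JR : 0 < J%:R :> R by rewrite ltr0n.
have JA : 4 * ln A / c1 <= J%:R by apply: ltW; exact: truncnS_gt.
pose s := Num.min (c1 / 32) (w / J%:R / 7).
have s0 : 0 < s by rewrite lt_min; apply/andP; split; [|apply: divr_gt0 => //]; exact: divr_gt0.
have s1 : s <= c1 / 32 by rewrite ge_min lexx.
have s2 : s <= w / J%:R / 7 by rewrite ge_min lexx orbT.
pose tau := s / (2 * pi); have tau0 : 0 < tau by rewrite divr_gt0// mulr_gt0.
have [Q1 HQ1] := gauge_exists na eps0 K0 tau0.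
pose Cg := 2 * K / (1 - expR (- (pi * eps))).
have Cg0 : 0 <= Cg.
  rewrite divr_ge0 ?mulr_ge0 ?(ltW K0)// subr_ge0 -[leRHS]expR0 ler_expR oppr_le0.
  by rewrite mulr_ge0 ?ltW.
have Call0 : 0 <= constant_sum b Cg w.
  have sc0 := symp_const_ge0 b0; have rc0 := residual_const_ge0 b0.
  have b80 : 0 <= 8 / b by rewrite divr_ge0// ltW.
  have it0 : 0 <= 1 / (1 - t) by rewrite divr_ge0// subr_ge0 ltW.
  have pc0 : 0 <= 2 * pi * Cg by rewrite mulr_ge0// mulr_ge0// ltW.
  by rewrite /constant_sum -/t; clear -sc0 rc0 b80 it0 pc0; lra.
have [Q2 HQ2] := linear_le_exp s0 Call0.
exists s, (Num.max 1 (Num.max Q1 Q2)); split => //; first by rewrite lt_max ltr01.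
move=> q p a; rewrite !gt_max => /andP[q1 /andP[qQ1 qQ2]] cop aq aal d E d1 vd EE [rho [U ac]].
have q0 : (0 < q)%N by rewrite -(ltr_nat R); lra.
have [[[rhoC rhor] rhoK] [UC _] _ Ub] := ac.
have rK z : strip eps z -> cabs (rho z) <= K by move=> zs; exact: (strip_sup_le rhoK zs).
have [phi [rho0 [dphi pphi rphi bphi coh]]] :=
  HQ1 q p a rho qQ1 q0 cop aq aal (Comega_holo rhoC) (Comega_periodic rhoC) rhor rK.
set X := expR (s * q%:R) in Ub ac.
have XB : constant_sum b Cg w * (q%:R + 1) <= X by exact: HQ2.
pose eta := expR ((- c + s) * q%:R).
pose r := Cg * expR (- (w * q%:R)).
have r0 : 0 <= r by rewrite mulr_ge0// expR_ge0.
pose phiR (x : R) := complex.Re (phi x%:C).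
have phiRE x : (phiR x)%:C = phi x%:C.
  by rewrite /phiR [RHS]complex_split rphi rmorph0 mulr0 addr0.
have cohR x : `|real_rho rho x - rho0 - (phiR (x + a) - phiR x)| <= r.
  apply: le_trans (coh x); apply: le_trans (Re_le_cabs _).
  by rewrite !(cReD, cReN) /=.
have dd : (0 < d)%N by [].
pose y j := col_of a rho U j.
have ycol j : column d (truncate v d) xi a E (real_rho rho) X eta (y j).
  by apply: (@column_of_conjugacy R xi eps K v d E a eta X b) => //; rewrite ?expR_ge0 ?ltW.
have [i0 ci0] : exists i : 'I_(d + d), comp_index i = 0.
  by apply: exists_row; rewrite ?oppr_le0 ?ltz_nat.
pose F j (z : R[i]) := U z i0 j * e2pi (phi z).
have FE j x : gauged phiR (y j) x = F j x%:C.
  rewrite /gauged /y col_ofE ?ltz_nat// phiRE -ci0.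
  by rewrite entryE.
have eps4 : 0 < eps / 4 by rewrite divr_gt0.
have eps44 : eps / 4 <= eps by rewrite ler_pdivrMr// ler_peMr ?(ltW eps0)// ler1n.
have sub4 z : strip (eps / 4) z -> strip eps z.
  by rewrite /strip /= => h; exact: lt_le_trans eps44.
have Fholo j : holo (eps / 4) (F j).
  move=> z /sub4 zs; have [l Hl] := Comega_holo (UC i0 j) zs.
  have [k Hk] := dphi z.
  by eexists; apply: (cderivM Hl); exact: cderiv_comp Hk (cderiv_e2pi _).
have Fper j : strip_periodic (eps / 4) (F j).
  by move=> z /sub4 zs; rewrite /F pphi (Comega_periodic (UC i0 j) zs).
have FB j z : strip (eps / 4) z -> cabs (F j z) <= X ^+ 2.
  move=> zs; rewrite /F cabsM expr2; apply: ler_pM; rewrite ?cabs_ge0//.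
    have := weighted_norm_le i0 j eps0 Ub (sub4 z zs).
    by rewrite ci0 absz0 mulr0 expR0 mulr1.
  rewrite cabs_e2pi ler_expR -mulrN.
  have := Im_le_cabs (phi z); have := bphi z (ltW zs).
  have := ler_norm (- complex.Im (phi z)); rewrite normrN => g1 g2 g3.
  have -> : s * q%:R = 2 * pi * (tau * q%:R) by rewrite /tau mulrA (mulrC _ (s / _)) divfK// gt_eqF// mulr_gt0.
  by rewrite ler_wpM2l ?mulr_ge0 ?(ltW pi0)//; clear -g1 g2 g3; lra.
have der j x : exists l, rderiv (gauged phiR (y j)) x l.
  have [|l Hl] := Fholo j (x +i* 0); first by rewrite /strip /= normr0.
  have := cderiv_horizontal Hl => H; exists l => e /H[u u0 Hu]; exists u => // h /Hu.
  by rewrite !FE.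
have per j x : gauged phiR (y j) (x + 1) = gauged phiR (y j) x.
  by rewrite !FE rmorphD /= Fper//; exact: strip_real.
have dec j m : cabs (fcoef (gauged phiR (y j)) m) <= X ^+ 2 * t ^+ absz m.
  have -> : gauged phiR (y j) = (fun x => F j x%:C) by apply/funext => x; exact: FE.
  have e8 : 0 <= eps / 8 < eps / 4 by clear -eps0; apply/andP; split; lra.
  apply: (le_trans (fcoef_decay m (Fholo j) (Fper j) (FB j) e8)).
  rewrite /t -expRM_natr /w ler_wpM2l ?exprn_ge0 ?expR_ge0// ler_expR.
  by rewrite le_eqVlt; apply/orP; left; apply/eqP; field.
pose j0 : 'I_2 := lshift 1 (ord0 : 'I_1). pose j1 : 'I_2 := rshift 1 (ord0 : 'I_1).
have sy i j : symp_form (truncate v d) d (y i ^~ 0) (y j ^~ 0) = J2 R i j.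
  exact: (col_of_symplectic ac).
have s00 : symp_form (truncate v d) d (y j0 ^~ 0) (y j0 ^~ 0) = 0.
  by rewrite sy /J2 block_mxEul mxE.
have s11 : symp_form (truncate v d) d (y j1 ^~ 0) (y j1 ^~ 0) = 0.
  by rewrite sy /J2 block_mxEdr mxE.
have s01 : cabs (symp_form (truncate v d) d (y j0 ^~ 0) (y j1 ^~ 0)) = 1.
  by rewrite sy /J2 block_mxEur !mxE eqxx cabsN cabs1.
have s10 : cabs (symp_form (truncate v d) d (y j1 ^~ 0) (y j0 ^~ 0)) = 1.
  by rewrite sy /J2 block_mxEdl !mxE eqxx cabs1.
pose N := (q %/ J)%N. pose M := q.+1.
have NM : (N.+1 <= M)%N by exact: leq_div.
have t01 : 0 <= t < 1 by rewrite (ltW t0).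
have tvb k : cabs (truncate v d k) <= expR (- (b * (absz k)%:R)) by exact: truncate_bound.
apply: (scale_contradiction b0 E00 c10 c1c c1w (ltn0Sn _) JA s0 s1 s2 Cg0 XB).
exact: (core_inequality dd b0 tvb (ltW xi0) xib' EE (expR_ge0 _) r0 (expR_ge0 _)
  cohR (ycol j0) (ycol j1) t01 (der j0) (der j1) (per j0) (per j1) (dec j0) (dec j1)
  s00 s11 s01 s10 NM).
Qed.

End Final.

Unset Implicit Arguments.

Theorem proposition7p1 (R : realType) :
  exists2 kappa : R, 0 < kappa &
  forall (alpha : R), @irrational R alpha ->
  forall (eps c K xi : R), 0 < eps -> 0 < c -> 0 < K ->
  0 < xi -> xi <= kappa * (2 * pi * eps) ->
  forall (v : R[i] -> R[i]), Comega_real eps v ->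
  let vhat := fourier_coef (fun x : R => v x%:C) in
  (forall k : int,
     cabs (vhat k) <= expR (- (2 * pi * eps * (absz k)%:R))) ->
  (exists (delta qstar : R) (s : nat -> nat),
     [/\ 0 < delta, 0 < qstar, subsequence s &
         no_almost_conjugacy xi eps K c vhat delta qstar
           (fun n => cf_denR alpha (s n)) (fun=> alpha)]) /\
  ((0 < betaCF alpha)%E ->
   forall s : nat -> nat, subsequence s -> liouville_along alpha s ->
   exists delta qstar : R,
     [/\ 0 < delta, 0 < qstar,
         no_almost_conjugacy xi eps K c vhat delta qstar
           (fun n => cf_denR alpha (s n)) (fun=> alpha) &
         no_almost_conjugacy xi eps K c vhat delta qstar
           (fun n => cf_denR alpha (s n)) (fun n => convergent alpha (s n))]).
Proof.
(* with b = 2 pi eps, xi <= b / 4 leaves room for the factor k of the orbit estimate *)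
exists (1 / 4) => // alpha irr eps c K xi eps0 c0 K0 xi0 xib v _ vhat vb.
have na := irrational_not_fraction irr.
have [delta [Q [delta0 Q0 H]]] := no_conjugacy_near na eps0 c0 K0 xi0 xib vb.
have b0 : 0 < 2 * pi * eps by rewrite !mulr_gt0// pi_gt0.
have spec n : exists2 q : nat, cf_denR alpha n = q%:R &
    [/\ (0 < q)%N, coprime (absz (cf_num alpha n)) q &
        `|alpha * q%:R - (cf_num alpha n)%:~R| * q%:R <= 1].
  have [q0 cop ap] := convergent_spec n na.
  have qE : cf_den alpha n = (absz (cf_den alpha n))%:Z by rewrite gez0_abs// ltW.
  exists (absz (cf_den alpha n)); first by rewrite /cf_denR {1}qE.
  by split; [rewrite absz_gt0 gt_eqF|rewrite -coprimezE|move: ap; rewrite {1 2}qE].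
have at_alpha s : no_almost_conjugacy xi eps K c vhat delta Q
    (fun n => cf_denR alpha (s n)) (fun=> alpha).
  move=> d n E d1 vd; have [q -> [q0 cop ap]] := spec (s n).
  move=> Qq lo hi; apply: (H q (cf_num alpha (s n)) alpha) => //.
    by rewrite subrr normr0 mul0r.
  exact: energy_bound lo hi.
have at_conv s : no_almost_conjugacy xi eps K c vhat delta Q
    (fun n => cf_denR alpha (s n)) (fun n => convergent alpha (s n)).
  move=> d n E d1 vd; have [q qE [q0 cop ap]] := spec (s n).
  rewrite /convergent qE => Qq lo hi.
  have qR : q%:R != 0 :> R by rewrite pnatr_eq0 -lt0n.
  have q1 : 1 <= q%:R :> R by rewrite ler1n.
  apply: (H q (cf_num alpha (s n)) _) => //.
  - by rewrite divfK// subrr normr0 mul0r.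
  - have -> : `|(cf_num alpha (s n))%:~R / q%:R - alpha| * q%:R = `|alpha * q%:R - (cf_num alpha (s n))%:~R|.
      rewrite distrC -[X in _ * X]ger0_norm// -normrM mulrBl divfK//.
    by have := normr_ge0 (alpha * q%:R - (cf_num alpha (s n))%:~R); nra.
  - exact: energy_bound lo hi.
split; first by exists delta, Q, id; split.
by move=> _ s _ _; exists delta, Q; split.
Qed.
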